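(* There exist absolute constants $0<c\le C<\infty$ such that for all $k\in\mathbb{N}=\{1,2,\dots\}$, $$c\,k\;\le\;\|R^k\|_{L^1\to L^{1,\infty}}\;\le\; C\,k .$$
   Context: Identify $\mathbb{R}^2\equiv\mathbb{C}$. $R=R_2+iR_1$, where $R_1,R_2$ are the classical scalar Riesz transforms on $\mathbb{R}^2$; equivalently (with $\hat f(\xi)=\int f(x)e^{-2\pi i x\cdot\xi}\,dx$) $R^k$ is the Fourier multiplier operator with symbol $(\bar\zeta/|\zeta|)^k$. It is the principal-value convolution singular integral with kernel $\Omega_k(z)=\frac{i^{k}k}{2\pi}\frac{(z/|z|)^{-k}}{|z|^2}$, $k\in\mathbb{N}$. The weak-type norm $\|R^k\|_{L^1\to L^{1,\infty}}$ is the smallest constant $N$ such that $m(\{z\in\mathbb{C}:|R^kf(z)|>\alpha\})\le \frac{N}{\alpha}\|f\|_{L^1(\mathbb{C})}$ for all $f\in L^1(\mathbb{C})$ and $\alpha>0$, where $m$ is Lebesgue measure on $\mathbb{C}$. *)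

(* Defs.v *)
From HB Require Import structures.
From mathcomp Require Import all_boot all_order all_algebra.
From mathcomp Require Import all_classical all_reals all_analysis.
From mathcomp Require Import complex.

Set Implicit Arguments.
Unset Strict Implicit.
Unset Printing Implicit Defensive.

Import Order.TTheory GRing.Theory Num.Theory.
Import numFieldNormedType.Exports.

Local Open Scope classical_set_scope.
Local Open Scope ring_scope.
Local Open Scope complex_scope.

(* The plane carries its Borel sigma-algebra and Lebesgue measure as the       *)
(* product R * R; [cplx] is the identification of the plane with C = R[i].     *)
Definition leb2 {R : realType} :
    {measure set (measurableTypeR R * measurableTypeR R) -> \bar R} :=
  (lebesgue_measure \x lebesgue_measure)%E.

Definition cplx {R : realType} (p : R * R) : R[i] := p.1 +i* p.2.

(* The modulus as an element of R; on R[i] the library's `|z| lies in R[i].    *)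
Definition cabs {R : realType} (z : R[i]) : R := complex.Re `|z|.

Definition cintegral {R : realType} (A : set (R * R)) (f : R * R -> R[i])
    : R[i] :=
  (\int[leb2]_(w in A) complex.Re (f w)) +i*
  (\int[leb2]_(w in A) complex.Im (f w)).

Definition L1fun {R : realType} (f : R * R -> R[i]) : Prop :=
  leb2.-integrable setT (fun z => (complex.Re (f z))%:E) /\
  leb2.-integrable setT (fun z => (complex.Im (f z))%:E).

Definition L1norm {R : realType} (f : R * R -> R[i]) : \bar R :=
  (\int[leb2]_z (cabs (f z))%:E)%E.

(* Convolution kernel of (R_2 + i R_1)^k for the planar Riesz transforms R_1,   *)
(* R_2, i.e. of the Fourier multiplier (zeta^* / |zeta|)^k for the convention   *)
(* hat f(xi) = int f(x) e^(-2 pi i x.xi) dx.                                   *)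
Definition Omega {R : realType} (k : nat) (z : R[i]) : R[i] :=
  ('i%C ^+ k * k%:R) / (2 * pi)%:C * ((z / `|z|) ^- k / `|z| ^+ 2).

Definition riesz_trunc {R : realType} (k : nat) (e : R) (f : R * R -> R[i])
    (z : R * R) : R[i] :=
  cintegral [set w | e < cabs (cplx w)]
    (fun w => Omega k (cplx w) * f (z - w)).

(* R^k f(z) is the principal value; [lim] returns 0 at the points where the    *)
(* truncated integrals diverge, a Lebesgue-null set when f is in L^1.          *)
Definition riesz_pow {R : realType} (k : nat) (f : R * R -> R[i])
    (z : R * R) : R[i] :=
  lim ((riesz_trunc k e f z : R[i]^o) @[e --> 0^'+]).

Definition weak_type_bound {R : realType}
    (T : (R * R -> R[i]) -> (R * R -> R[i])) (N : R) : Prop :=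
  forall f : R * R -> R[i], L1fun f ->
  forall alpha : R, 0 < alpha ->
    (leb2 [set z : R * R | (alpha < cabs (T f z))%R] <= (N / alpha)%:E * L1norm f)%E.

(* The infimum is attained when finite; it is +oo if no N is admissible.       *)
Definition weak_type_norm {R : realType}
    (T : (R * R -> R[i]) -> (R * R -> R[i])) : \bar R :=
  ereal_inf [set N%:E | N in weak_type_bound T].

(* Main.v *)
(** R^k is a singular integral whose kernel has modulus k / (2 pi |z|^2) and derivative
    O(k^2 / |z|^3). Replacing |z|^2 by |z|^2 + d in the denominator multiplies the kernel
    by an increasing function of |z|, so the regularised operator is an average of
    truncations and its limit as d -> 0 recovers the principal value. By Fatou it suffices
    to bound the regularised operators uniformly in d.
    Writing the regularised kernel as a Mellin superposition of harmonic polynomials times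
    Gaussians exhibits it as a Fourier transform with uniformly bounded multiplier, whence
    an L^2 bound independent of k. For the weak type bound, f is decomposed at height
    k alpha rather than alpha: the stopping squares then have total area at most
    |f|_1 / (k alpha), so dilating them by a factor of order k costs only O(k |f|_1 / alpha);
    outside the dilates the kernel differences have integral O(k), and the good part
    contributes O(k |f|_1 / alpha) through the L^2 bound.
    Conversely, at distance of order k from the unit square, R^k of its indicator is
    comparable with the kernel, which exceeds c / k on a set of measure of order k^2. *)

Require Import Defs.
From HB Require Import structures.
From mathcomp Require Import all_boot all_order all_algebra.
From mathcomp Require Import all_classical all_reals all_analysis.
From mathcomp Require Import measurable_realfun complex ring lra.
Import Order.TTheory GRing.Theory Num.Theory.
Import numFieldNormedType.Exports.
Set Implicit Arguments.
Unset Strict Implicit.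
Unset Printing Implicit Defensive.
Local Open Scope classical_set_scope.
Local Open Scope ring_scope.

(** * Integration on product spaces and on the plane *)

(** The height [k * alpha] and the dilation of order [k] come from one balance. With height [lam]
    and dilation factor [M], the good part costs a multiple of [lam / alpha ^ 2], the dilated
    squares [M ^ 2 / lam], and the kernel differences outside them [k ^ 2 / (M * alpha)], each times
    the norm of [f]. Taking [M = k] and [lam = k * alpha] makes all three of order [k / alpha]; the
    usual [lam = alpha] would leave [k ^ 2 / alpha] in the second. For fixed [dl > 0] the kernel is
    bounded and Lipschitz. These two constants blow up as [dl] tends to 0, but they never enter the
    weak type constant: they give integrability and decide how many dyadic levels are inspected, so
    that the stopping rule is finite. Sums over cells become integrals against an averaging kernel.
    Complex values are split into real and imaginary parts, and Fourier analysis is done with real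
    cosine transforms carrying a phase. The superlevel set of [R^k f] is handled through the
    monotonicity of [leb2] on arbitrary sets: it is included in a lower limit of measurable sets. *)

Section product_sigma_finite.
Context d1 d2 (T1 : measurableType d1) (T2 : measurableType d2) (R : realType).
Variable m1 : {sigma_finite_measure set T1 -> \bar R}.
Variable m2 : {sigma_finite_measure set T2 -> \bar R}.

Lemma product_measure_sigma_finite : sigma_finite setT (m1 \x m2)%E.
Proof.
have /sigma_finiteP[F [TF ndF Foo]] := sigma_finiteT m1.
have /sigma_finiteP[G [TG ndG Goo]] := sigma_finiteT m2.
exists (fun n => F n `*` G n).
  rewrite -setXTT TF TG predeqE => -[x y]; split.
    move=> [/= [n _ Fnx] [k _ Gky]]; exists (maxn n k) => //; split.
    - by move: x Fnx; exact/subsetPset/ndF/leq_maxl.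
    - by move: y Gky; exact/subsetPset/ndG/leq_maxr.
  by move=> [n _ []/= ? ?]; split; exists n.
move=> k; have [? ?] := Foo k; have [? ?] := Goo k.
split; first exact: measurableX.
by rewrite product_measure1E// lte_mul_pinfty// ge0_fin_numE.
Qed.

(** Packed with its sigma-finiteness so that the construction iterates: the kernel estimates use
    Fubini on the product of two planes. *)
Definition prodm : {sigma_finite_measure set (T1 * T2)%type -> \bar R} :=
  HB.pack (m1 \x m2)%E (Measure_isSigmaFinite.Build _ _ _ (m1 \x m2)%E
    product_measure_sigma_finite).

End product_sigma_finite.

Section measurability.
Context {R : realType}.

Lemma measurable_fcomp d1 d2 d3 (T1 : measurableType d1) (T2 : measurableType d2)
    (T3 : measurableType d3) (f : T2 -> T3) (g : T1 -> T2) :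
  measurable_fun setT f -> measurable_fun setT g ->
  measurable_fun setT (fun x => f (g x)).
Proof. exact: measurableT_comp. Qed.

(** Writing the inverse of [x] as [x] times the power [-1] of [x ^+ 2] reduces to the real power
    function at nonnegative bases; at 0 the factor [x] yields the convention that 0 is its own
    inverse. *)
Lemma measurable_inv : measurable_fun setT (@GRing.inv R).
Proof.
have -> : @GRing.inv R = fun x => x * (x ^+ 2) `^ (-1).
  apply/funext => x; have [->|x0] := eqVneq x 0; first by rewrite invr0 mul0r.
  rewrite powR_inv1 ?sqr_ge0// expr2 invfM mulrA mulfV ?mul1r//.
apply: measurable_funM => //.
apply: (measurable_fcomp (f := fun y : R => y `^ (-1))).
  exact: measurable_powR.
exact: exprn_measurable.
Qed.

Lemma measurable_sqrt : measurable_fun setT (@Num.sqrt R).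
Proof. apply: nondecreasing_measurable; [exact: measurableT|exact: ler_wsqrtr]. Qed.

Lemma measurable_cos : measurable_fun setT (@cos R).
Proof. by apply: continuous_measurable_fun => x; exact: continuous_cos. Qed.

Lemma measurable_sin : measurable_fun setT (@sin R).
Proof. by apply: continuous_measurable_fun => x; exact: continuous_sin. Qed.

Lemma measurable_fun_vec d (T : measurableType d) (h : T -> R * R) :
  measurable_fun setT (fun x => (h x).1) ->
  measurable_fun setT (fun x => (h x).2) -> measurable_fun setT h.
Proof. by move=> h1 h2; apply/measurable_fun_pairP; split. Qed.

Lemma measurable_funV d (T : measurableType d) (h : T -> R) :
  measurable_fun setT h -> measurable_fun setT (fun x => (h x)^-1).
Proof. exact: (measurableT_comp measurable_inv). Qed.

Lemma measurable_funexpR d (T : measurableType d) (h : T -> R) :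
  measurable_fun setT h -> measurable_fun setT (fun x => expR (h x)).
Proof. by move=> mh; apply: measurableT_comp mh. Qed.

Lemma measurable_funcos d (T : measurableType d) (h : T -> R) :
  measurable_fun setT h -> measurable_fun setT (fun x => cos (h x)).
Proof. exact: (measurableT_comp measurable_cos). Qed.

Lemma measurable_funsin d (T : measurableType d) (h : T -> R) :
  measurable_fun setT h -> measurable_fun setT (fun x => sin (h x)).
Proof. exact: (measurableT_comp measurable_sin). Qed.

Lemma measurable_funsqrt d (T : measurableType d) (h : T -> R) :
  measurable_fun setT h -> measurable_fun setT (fun x => Num.sqrt (h x)).
Proof. exact: (measurableT_comp measurable_sqrt). Qed.

Lemma measurable_funnormr d (T : measurableType d) (h : T -> R) :
  measurable_fun setT h -> measurable_fun setT (fun x => `|h x|).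
Proof. by move=> mh; apply: measurableT_comp mh. Qed.

Lemma measurable_funfst d1 d2 d (T : measurableType d) (T1 : measurableType d1)
   (T2 : measurableType d2) (h : T -> T1 * T2) :
  measurable_fun setT h -> measurable_fun setT (fun x => (h x).1).
Proof. by move=> mh; exact: measurableT_comp. Qed.

Lemma measurable_funsnd d1 d2 d (T : measurableType d) (T1 : measurableType d1)
   (T2 : measurableType d2) (h : T -> T1 * T2) :
  measurable_fun setT h -> measurable_fun setT (fun x => (h x).2).
Proof. by move=> mh; exact: measurableT_comp. Qed.

End measurability.

(** Dispatch is on the head symbol of the body. The last alternative for sums and for opposites
    serves functions with values in the plane, which are split into coordinates. *)
Ltac meas1 := lazymatch goal with
  | |- measurable_fun _ (fun x => EFin (@?h1 x)) => apply/measurable_EFinP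
  | |- measurable_fun _ (EFin \o _) => apply/measurable_EFinP
  | |- measurable_fun _ (fun x => abse (@?h1 x)) => apply: (measurable_fcomp (@abse_measurable _ _))
  | |- measurable_fun _ (fun x => GRing.add (@?h1 x) (@?h2 x)) =>
      first [apply: measurable_funB | apply: measurable_funD | apply: measurable_fun_vec => /=]
  | |- measurable_fun _ (fun x => GRing.opp (@?h1 x)) =>
      first [apply: measurable_funN | apply: measurable_fun_vec => /=]
  | |- measurable_fun _ (fun x => GRing.mul (@?h1 x) (@?h2 x)) => apply: measurable_funM
  | |- measurable_fun _ (fun x => GRing.exp (@?h1 x) ?n) => apply: measurable_funX
  | |- measurable_fun _ (fun x => GRing.inv (@?h1 x)) => apply: measurable_funV
  | |- measurable_fun _ (fun x => Num.sqrt (@?h1 x)) => apply: measurable_funsqrt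
  | |- measurable_fun _ (fun x => cos (@?h1 x)) => apply: measurable_funcos
  | |- measurable_fun _ (fun x => sin (@?h1 x)) => apply: measurable_funsin
  | |- measurable_fun _ (fun x => expR (@?h1 x)) => apply: measurable_funexpR
  | |- measurable_fun _ (fun x => Num.norm (@?h1 x)) => apply: measurable_funnormr
  | |- measurable_fun _ (fun x => Num.max (@?h1 x) (@?h2 x)) => apply: measurable_maxr
  | |- measurable_fun _ (fun x => ((@?h1 x), (@?h2 x))) => apply: measurable_fun_pair
  | |- measurable_fun _ (fun x => fst (@?h1 x)) => apply: measurable_funfst
  | |- measurable_fun _ (fun x => snd (@?h1 x)) => apply: measurable_funsnd
  | |- measurable_fun _ (fun x => ((@?h1 x) < (@?h2 x))%R) => apply: measurable_fun_ltr
  | |- measurable_fun _ (fun x => ((@?h1 x) <= (@?h2 x))%R) => apply: measurable_fun_ler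
  | |- measurable_fun _ (fun x => ((@?h1 x) && (@?h2 x))%B) => apply: measurable_and
  | |- measurable_fun _ (fun x => ?f (@?h1 x)) => apply: (measurable_fcomp (f := f))
  end.
Ltac meas := repeat first [assumption | apply: measurable_cst | apply: measurable_id | meas1 | apply: measurable_fun_ifT | by []].

Section integrable_real.
Context d (T : measurableType d) (R : realType) (m : {measure set T -> \bar R}).

Lemma integrable_le (f g : T -> R) : measurable_fun setT f ->
  m.-integrable setT (EFin \o g) -> (forall x, `|f x| <= g x) ->
  m.-integrable setT (EFin \o f).
Proof.
move=> mf ig fg; apply: le_integrable ig => //; first exact/measurable_EFinP.
by move=> x _; rewrite !abse_EFin lee_fin (le_trans (fg x))// ler_norm.
Qed.

Lemma integrable_ltyP (f : T -> R) : measurable_fun setT f ->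
  (\int[m]_x `|f x|%:E < +oo)%E -> m.-integrable setT (EFin \o f).
Proof. by move=> mf fy; apply/integrableP; split => //; exact/measurable_EFinP. Qed.

End integrable_real.

Section integration.
Context d1 d2 (T1 : measurableType d1) (T2 : measurableType d2) (R : realType).
Variable m1 : {sigma_finite_measure set T1 -> \bar R}.
Variable m2 : {sigma_finite_measure set T2 -> \bar R}.
Local Notation m12 := (prodm m1 m2).

Lemma integrable_prod_le (f : T1 * T2 -> R) (a : T1 -> R) (b : T2 -> R) :
  measurable_fun setT f ->
  m1.-integrable setT (EFin \o a) -> m2.-integrable setT (EFin \o b) ->
  (forall x y, `|f (x, y)| <= a x * b y) ->
  m12.-integrable setT (EFin \o f).
Proof.
move=> mf /[dup] ia /integrableP[ma ia'] /[dup] ib /integrableP[mb ib'] fab.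
have mfe : measurable_fun setT (EFin \o f) by exact/measurable_EFinP.
apply: (proj2 (@integrable12ltyP _ _ _ _ _ m1 m2 _ mfe)) => /=.
have mb' : measurable_fun setT (fun y => `|b y|%:E).
  by apply/measurable_EFinP/measurableT_comp => //; exact/measurable_EFinP.
have ma' : measurable_fun setT (fun y => `|a y|%:E).
  by apply/measurable_EFinP/measurableT_comp => //; exact/measurable_EFinP.
have mf' : measurable_fun setT (fun z => `|f z|%:E).
  by apply/measurable_EFinP/measurableT_comp.
apply: (@le_lt_trans _ _ (\int[m1]_x (`|a x|%:E * \int[m2]_y `|b y|%:E))%E).
  apply: ge0_le_integral => //.
  - by move=> x _; exact: integral_ge0.
  - exact: (measurable_fun_fubini_tonelli_F (fun z => `|f z|%:E)).
  - by apply: emeasurable_funM => //; exact: measurable_cst.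
  - move=> x _; rewrite -ge0_integralZl_EFin//; apply: ge0_le_integral => //.
    + exact: (measurableT_comp mf').
    + by apply: emeasurable_funM => //; exact: measurable_cst.
    + by move=> y _; rewrite lee_fin (le_trans (fab x y))// -normrM ler_norm.
rewrite ge0_integralZr//; last exact: integral_ge0.
by rewrite lte_mul_pinfty//; [exact: integral_ge0|rewrite ge0_fin_numE//; exact: integral_ge0].
Qed.

Lemma tonelli1 (f : T1 * T2 -> R) : measurable_fun setT f -> (forall z, 0 <= f z) ->
  (\int[m12]_z (f z)%:E = \int[m1]_x \int[m2]_y (f (x, y))%:E)%E.
Proof.
move=> mf f0; by rewrite (fubini_tonelli1 (EFin \o f))//; exact/measurable_EFinP.
Qed.

Lemma tonelli2 (f : T1 * T2 -> R) : measurable_fun setT f -> (forall z, 0 <= f z) ->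
  (\int[m12]_z (f z)%:E = \int[m2]_y \int[m1]_x (f (x, y))%:E)%E.
Proof.
move=> mf f0; by rewrite (fubini_tonelli2 (EFin \o f))//; exact/measurable_EFinP.
Qed.

Lemma measurable_integral1 (f : T1 * T2 -> R) : measurable_fun setT f -> (forall z, 0 <= f z) ->
  measurable_fun setT (fun x => \int[m2]_y (f (x, y))%:E)%E.
Proof.
move=> mf f0; apply: (measurable_fun_fubini_tonelli_F (EFin \o f)).
  exact/measurable_EFinP.
by move=> z; rewrite lee_fin.
Qed.

(** [Rintegral] sends an infinite inner integral to 0. Integrability confines such points to a null
    set, so the iterated real integral agrees with the extended one. *)
Lemma Rintegral_fubini1 (f : T1 * T2 -> R) : m12.-integrable setT (EFin \o f) ->
  \int[m1]_x \int[m2]_y f (x, y) = \int[m12]_z f z.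
Proof.
move=> intf; rewrite /Rintegral; congr fine.
rewrite -(integral12_prod_meas1 intf).
have iF := integrable_fubini_F intf.
apply: ae_eq_integral => //.
- apply: (measurableT_comp (f := fun x => EFin (fine x))).
    by apply: measurableT_comp => //.
  exact: measurable_int iF.
- exact: measurable_int iF.
- have := integrable_ae measurableT iF; apply: filterS => x /(_ I) h _ /=.
  by rewrite fineK.
Qed.

Lemma integrable_fubini_G (f : T1 * T2 -> \bar R) : m12.-integrable setT f ->
  m2.-integrable setT (fubini_G m1 f).
Proof.
move=> intf; have mf : measurable_fun setT f by exact: measurable_int intf.
apply/integrableP; split; first exact: measurable_fubini_G intf.
apply: le_lt_trans (proj1 (@integrable21ltyP _ _ _ _ _ m1 m2 _ mf) intf).
have maf : measurable_fun setT (fun z => `|f z|)%E by exact: measurableT_comp.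
apply: ge0_le_integral => //.
- by apply: measurableT_comp => //; exact: measurable_fubini_G intf.
- exact: (measurable_fun_fubini_tonelli_G (fun z => `|f z|)%E).
- by move=> y _; apply: le_abse_integral => //; exact: measurableT_comp.
Qed.

Lemma Rintegral_fubini2 (f : T1 * T2 -> R) : m12.-integrable setT (EFin \o f) ->
  \int[m2]_y \int[m1]_x f (x, y) = \int[m12]_z f z.
Proof.
move=> intf; rewrite /Rintegral; congr fine.
rewrite -(integral21_prod_meas1 intf).
have iF := integrable_fubini_G intf.
apply: ae_eq_integral => //.
- apply: (measurableT_comp (f := fun x => EFin (fine x))).
    by apply: measurableT_comp => //.
  exact: measurable_int iF.
- exact: measurable_int iF.
- have := integrable_ae measurableT iF; apply: filterS => x /(_ I) h _ /=.
  by rewrite fineK.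
Qed.

Lemma Rintegral_fubini (f : T1 * T2 -> R) : m12.-integrable setT (EFin \o f) ->
  \int[m1]_x \int[m2]_y f (x, y) = \int[m2]_y \int[m1]_x f (x, y).
Proof. by move=> ?; rewrite Rintegral_fubini1// Rintegral_fubini2. Qed.

(** Tonelli makes the integrals of the positive and of the negative part measurable in [x]; their
    difference is measurable as an extended real, also where it is infinite, and [fine] preserves
    this. *)
Lemma measurable_Rintegral (f : T1 * T2 -> R) : measurable_fun setT f ->
  measurable_fun setT (fun x => \int[m2]_y f (x, y)).
Proof.
move=> mf; have mf' : measurable_fun setT (EFin \o f) by exact/measurable_EFinP.
apply: (measurableT_comp (f := fine)) => //.
have -> : (fun x => \int[m2]_y (f (x, y))%:E)%E =
  ((fun x => \int[m2]_y ((EFin \o f)^\+ (x, y))) \-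
   (fun x => \int[m2]_y ((EFin \o f)^\- (x, y))))%E.
  apply/funext => x; rewrite /= [LHS]integralE.
  by congr (_ - _)%E; apply: eq_integral => y _; rewrite ?funeposE ?funenegE.
apply: emeasurable_funB.
  apply: (measurable_fun_fubini_tonelli_F (fun z => (EFin \o f)^\+ z)%E) => //.
  exact: measurable_funepos.
apply: (measurable_fun_fubini_tonelli_F (fun z => (EFin \o f)^\- z)%E) => //.
exact: measurable_funeneg.
Qed.

Lemma integrable_Rintegral (f : T1 * T2 -> R) : m12.-integrable setT (EFin \o f) ->
  m1.-integrable setT (fun x => (\int[m2]_y f (x, y))%:E).
Proof.
move=> intf; have iF := integrable_fubini_F intf.
apply: le_integrable iF => //.
  apply/measurable_EFinP. apply: measurable_Rintegral. apply/measurable_EFinP.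
  exact: measurable_int intf.
by move=> x _; rewrite /= /fubini_F /Rintegral; case: integral => [r| |] /=; rewrite ?leey ?lexx.
Qed.

End integration.

Lemma ge0_integralZ d (T : measurableType d) (R : realType)
    (m : {measure set T -> \bar R}) (k : R) (g : T -> R) : 0 <= k ->
  measurable_fun setT g -> (forall x, 0 <= g x) ->
  (\int[m]_x (k * g x)%:E = k%:E * \int[m]_x (g x)%:E)%E.
Proof.
move=> k0 mg g0; rewrite -ge0_integralZl_EFin//.
  by move=> x _; rewrite lee_fin.
exact/measurable_EFinP.
Qed.

Section real_integrable.
Context d (T : measurableType d) (R : realType) (m : {measure set T -> \bar R}).

Lemma integrable_rZl (k : R) (g : T -> R) : m.-integrable setT (EFin \o g) ->
  m.-integrable setT (EFin \o (fun x => k * g x)).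
Proof. by move=> /(integrableZl measurableT k); apply: eq_integrable => // x _; rewrite /= EFinM. Qed.

Lemma integrable_rD (f g : T -> R) : m.-integrable setT (EFin \o f) ->
  m.-integrable setT (EFin \o g) -> m.-integrable setT (EFin \o (fun x => f x + g x)).
Proof. by move=> fi gi; apply: eq_integrable (integrableD measurableT fi gi). Qed.

Lemma integrable_rMbd (f g : T -> R) C : m.-integrable setT (EFin \o f) ->
  measurable_fun setT g -> (forall x, `|g x| <= C) ->
  m.-integrable setT (EFin \o (fun x => f x * g x)).
Proof.
move=> fi mg gC; have := integrable_rZl C (integrable_norm fi).
apply: le_integrable => //.
  by apply/measurable_EFinP/measurable_funM => //; apply/measurable_EFinP; exact: measurable_int fi.
move=> x _ /=; rewrite lee_fin !normrM normr_id mulrC ler_wpM2r//.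
by rewrite (le_trans (gC x))// ler_norm.
Qed.

Lemma ge0_integral_rD (f g : T -> R) : measurable_fun setT f ->
  measurable_fun setT g -> (forall x, 0 <= f x) -> (forall x, 0 <= g x) ->
  (\int[m]_x (f x + g x)%:E = \int[m]_x (f x)%:E + \int[m]_x (g x)%:E)%E.
Proof.
move=> mf mg f0 g0; under eq_integral => x _ do rewrite EFinD.
rewrite ge0_integralD//; try exact/measurable_EFinP; by move=> x _; rewrite lee_fin.
Qed.

End real_integrable.

(** * Lebesgue measure on the plane, monotonicity on arbitrary sets, and reflections *)

Section lebesgue_plane.
Context {R : realType}.

Local Notation mu := (@lebesgue_measure R).

Definition mu2 : {sigma_finite_measure set (measurableTypeR R * measurableTypeR R)%type -> \bar R} :=
  prodm mu mu.

(* The outer measures behind [leb2] are monotone on all sets, measurable or not. *)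
Lemma le_lebesgue_measure (A B : set R) : A `<=` B -> (mu A <= mu B)%E.
Proof.
move=> AB; rewrite /lebesgue_measure /lebesgue_stieltjes_measure /=.
exact: le_outer_measure.
Qed.

(** The integral of a nonnegative function is the supremum of the integrals of the simple functions
    below it, and this supremum is monotone whether or not [f] and [g] are measurable. *)
Lemma le_integral_any d (T : measurableType d) (m : {measure set T -> \bar R})
    (f g : T -> \bar R) : (forall x, 0 <= f x)%E -> (forall x, f x <= g x)%E ->
  (\int[m]_x f x <= \int[m]_x g x)%E.
Proof.
move=> f0 fg; rewrite !ge0_integralTE//; last first.
  by move=> x; exact: le_trans (fg x).
apply: le_ereal_sup => _ [h hf <-]; exists h => // x.
exact: le_trans (fg x).
Qed.

Lemma le_leb2 (A B : set (R * R)) : A `<=` B -> (leb2 A <= leb2 B)%E.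
Proof.
move=> AB; apply: le_integral_any => x //=.
by apply: le_lebesgue_measure => y; rewrite /xsection/= !inE; exact: AB.
Qed.

Lemma measurable_reflect1 (a : R) : measurable_fun [set: R] (fun t : R => a - t).
Proof. by meas. Qed.

Lemma measurable_reflect (z : R * R) :
  measurable_fun [set: R * R] (fun w : R * R => z - w).
Proof. by meas. Qed.

(** By uniqueness of the measure with the right values on half-open intervals. Reflection is taken
    as the basic map because it is the substitution of a convolution; a translation is then a
    product of two reflections. *)
Lemma lebesgue_reflect (a : R) (A : set R) : measurable A ->
  mu ((fun t => a - t) @^-1` A) = mu A.
Proof.
move=> mA; have mf : measurable_fun [set: measurableTypeR R] (fun t : measurableTypeR R => (a - t) : measurableTypeR R).
  exact: measurable_reflect1.
pose mf' := isMeasurableFun.Build _ _ _ _ _ mf.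
pose fm : {mfun measurableTypeR R >-> measurableTypeR R} := HB.pack (fun t : R => a - t) mf'.
pose m := pushforward mu fm.
suff : mu A = m A by move=> ->.
apply: (@lebesgue_measure_unique R m) mA => //= _ [[b c]] _ <-.
rewrite /m /pushforward /=.
have -> : (fun t => a - t) @^-1` `]b, c] = `[a - c, a - b[%classic.
  by apply/seteqP; split => t /=; rewrite !in_itv /= => /andP[h1 h2]; apply/andP; split; lra.
rewrite !lebesgue_measure_itv/= !lte_fin.
have -> : (a - c < a - b) = (b < c) by apply/idP/idP; lra.
by case: ifP => // _; congr EFin; ring.
Qed.

Lemma leb2_reflect (z : R * R) (A : set (R * R)) : measurable A ->
  mu2 ((fun w => z - w) @^-1` A) = mu2 A.
Proof.
move=> mA.
pose V := (measurableTypeR R * measurableTypeR R)%type.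
have mf : measurable_fun [set: V] (fun t : V => (z - t) : V).
  exact: measurable_reflect.
pose mf' := isMeasurableFun.Build _ _ _ _ _ mf.
pose fm : {mfun (measurableTypeR R * measurableTypeR R)%type >-> (measurableTypeR R * measurableTypeR R)%type} := HB.pack (fun w : R * R => z - w) mf'.
pose m := pushforward mu2 fm.
suff : mu2 A = m A by move=> ->.
apply: (@product_measure_unique _ _ _ _ R mu mu m) mA => //= B C mB mC.
rewrite /m /pushforward /=.
have -> : (fun w => z - w) @^-1` (B `*` C) =
   ((fun t => z.1 - t) @^-1` B) `*` ((fun t => z.2 - t) @^-1` C).
  by apply/seteqP; split => t.
rewrite product_measure1E.
- by congr (_ * _)%E; exact: lebesgue_reflect.
- by rewrite -[X in measurable X]setTI; exact: measurable_reflect1.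
- by rewrite -[X in measurable X]setTI; exact: measurable_reflect1.
Qed.

Section measure_preserving.
Context d (T : measurableType d) (m : {measure set T -> \bar R}) (phi : T -> T).
Hypothesis mphi : measurable_fun setT phi.
Hypothesis phim : forall A, measurable A -> m (phi @^-1` A) = m A.

Lemma ge0_integral_preserve (g : T -> \bar R) : measurable_fun setT g ->
  (forall x, 0 <= g x)%E -> (\int[m]_x g (phi x) = \int[m]_x g x)%E.
Proof.
move=> mg g0.
pose fm : {mfun T >-> T} := HB.pack phi (isMeasurableFun.Build _ _ _ _ _ mphi).
have := @ge0_integral_pushforward _ _ _ _ _ fm mphi m setT g measurableT mg.
rewrite preimage_setT => <-; last by move=> y _; exact: g0.
by apply: eq_measure_integral => //= A mA _; rewrite -phim.
Qed.

Lemma integral_preserve (g : T -> \bar R) : measurable_fun setT g ->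
  (\int[m]_x g (phi x) = \int[m]_x g x)%E.
Proof.
move=> mg; rewrite [LHS]integralE [RHS]integralE.
rewrite -(ge0_integral_preserve (measurable_funepos mg))//.
rewrite -(ge0_integral_preserve (measurable_funeneg mg))//.
by congr (_ - _)%E; apply: eq_integral => y _; rewrite ?funeposE ?funenegE.
Qed.

Lemma Rintegral_preserve (g : T -> R) : measurable_fun setT g ->
  \int[m]_x g (phi x) = \int[m]_x g x.
Proof.
move=> mg; rewrite /Rintegral -(integral_preserve (g := EFin \o g))//.
exact/measurable_EFinP.
Qed.

Lemma integrable_preserve (g : T -> R) : m.-integrable setT (EFin \o g) ->
  m.-integrable setT (fun x => (g (phi x))%:E).
Proof.
move=> /integrableP[mg gy]; apply/integrableP; split.
  exact: (measurable_fcomp (f := EFin \o g)).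
by rewrite (ge0_integral_preserve (g := fun x => `|(g x)%:E|%E))//; exact: measurableT_comp.
Qed.

End measure_preserving.

End lebesgue_plane.

(** * Gaussian integrals *)

Section real_line.
Context {R : realType}.
Local Notation mu := (@lebesgue_measure R).
Implicit Types (a b c t x : R).

Lemma measurable_shift1 a : measurable_fun [set: R] (fun t : R => t + a).
Proof. by meas. Qed.

Lemma lebesgue_shift a (A : set R) : measurable A ->
  mu ((fun t => t + a) @^-1` A) = mu A.
Proof.
move=> mA.
have -> : (fun t => t + a) @^-1` A =
    (fun t => 0 - t) @^-1` ((fun t => a - t) @^-1` A).
  by apply/seteqP; split => t /=; rewrite sub0r opprK addrC.
rewrite lebesgue_reflect ?lebesgue_reflect//.
by rewrite -[X in measurable X]setTI; exact: measurable_reflect1.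
Qed.

Lemma is_derive_shift (f : R -> R) t a l : is_derive (t + a) (1:R) f l ->
  is_derive t (1:R) (fun s => f (s + a)) l.
Proof.
move=> df; rewrite -[l]mulr1.
apply: (@is_derive1_comp _ f (fun s => s + a)).
by apply: is_derive_eq; rewrite addr0.
Qed.

Lemma is_derive_continuous (f : R -> R) (l : R -> R) :
  (forall t, is_derive t (1:R) f (l t)) -> continuous f.
Proof.
move=> df t; apply/differentiable_continuous/derivable1_diffP.
by have [] := df t.
Qed.

(* [0 = \int (H (t + 1) - H t) dt = \int_(0 <= s <= 1) \int h (t + s) dt ds = \int h]. *)
Lemma Rintegral_derive (H h : R -> R) : continuous h ->
  (forall t, is_derive t (1:R) H (h t)) ->
  mu.-integrable setT (EFin \o H) -> mu.-integrable setT (EFin \o h) ->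
  \int[mu]_t h t = 0.
Proof.
move=> ch dH iH ih.
have mh : measurable_fun setT h by exact: continuous_measurable_fun.
have mH : measurable_fun setT H.
  by apply: continuous_measurable_fun; exact: is_derive_continuous dH.
pose I01 : R -> R := \1_`[0, 1].
have mI : measurable_fun setT I01 by exact: measurable_indic.
have i01 : mu.-integrable setT (EFin \o I01) by exact: integrable_indic_itv.
have ftc t : H (t + 1) - H t = \int[mu]_s (I01 s * h (t + s)).
  have := @continuous_FTC2 R (fun s => h (t + s)) (fun s => H (t + s)) 0 1 ltr01.
  have dHt s : is_derive s (1:R) (fun s => H (t + s)) (h (t + s)).
    under eq_fun do rewrite addrC; apply: is_derive_shift.
    by rewrite addrC.
  have cHt : continuous (fun s => H (t + s)) := is_derive_continuous dHt.
  rewrite addr0; move=> /(_ _ _ _) FTC.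
  have c1 : {within `[0, 1], continuous (fun s : R => h (t + s))}.
    apply: continuous_subspaceT => s.
    apply: (@continuous_comp _ _ _ (fun s => t + s) h); last exact: ch.
    by apply: (@continuousD _ _ _ (cst t) id); [exact: cvg_cst|exact: cvg_id].
  have c2 : derivable_oo_LRcontinuous (fun s : R => H (t + s)) 0 1.
    split.
    + by move=> s _; have [] := dHt s.
    + by have := cvg_at_right_filter (cHt 0); rewrite addr0.
    + exact: cvg_at_left_filter (cHt 1).
  have c3 : {in `]0, 1[, derive1 (fun s : R => H (t + s)) =1 (fun s : R => h (t + s))}.
    by move=> s _; rewrite derive1E; have [_ ->] := dHt s.
  have {c1 c2 c3}FTC := FTC c1 c2 c3.
  have /(congr1 fine) := FTC => /=; rewrite -/(Rintegral mu _ _).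
  rewrite -[X in _ = X -> _]/(H (t + 1) - H t) => <-.
  rewrite Rintegral_mkcond; apply: eq_Rintegral => s _.
  by rewrite patchE /I01 indicE; case: ifPn => _; rewrite ?mul1r ?mul0r.
have E1 y : (\int[mu]_x `|h (x + y)|%:E = \int[mu]_x `|h x|%:E)%E.
  refine (@ge0_integral_preserve R _ _ mu _ (measurable_shift1 y) (@lebesgue_shift y) (fun t => `|h t|%:E) _ _) => //.
  by apply/measurable_EFinP; meas.
have E2 y : \int[mu]_x h (x + y) = \int[mu]_x h x.
  exact: (@Rintegral_preserve R _ _ mu _ (measurable_shift1 y) (@lebesgue_shift y) h).
have E3 : \int[mu]_x H (x + 1) = \int[mu]_x H x.
  exact: (@Rintegral_preserve R _ _ mu _ (measurable_shift1 1) (@lebesgue_shift 1) H).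
have int2 : (prodm mu mu).-integrable setT (EFin \o (fun z : R * R => I01 z.2 * h (z.1 + z.2))).
  have mhh : measurable_fun setT (fun z : R * R => I01 z.2 * h (z.1 + z.2)) by meas.
  have mfe : measurable_fun setT (EFin \o (fun z : R * R => I01 z.2 * h (z.1 + z.2))).
    exact/measurable_EFinP.
  apply: (proj2 (@integrable21ltyP _ _ _ _ _ mu mu _ mfe)) => /=.
  have /integrableP[_ ihy] := ih.
  have /integrableP[_ i01y] := i01.
  under eq_integral => y _.
    under eq_integral => x _ do rewrite normrM EFinM.
    rewrite ge0_integralZl_EFin//; last first.
      by apply/measurable_EFinP; meas.
    rewrite E1; over.
  rewrite ge0_integralZr//; last 2 first.
  - by apply/measurable_EFinP; meas.
  - exact: integral_ge0.
  apply: lte_mul_pinfty => //; first exact: integral_ge0.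
  by rewrite ge0_fin_numE//; exact: integral_ge0.
have := Rintegral_fubini int2.
under eq_Rintegral => x _ do rewrite -ftc.
rewrite RintegralB//; last exact: (@integrable_preserve R _ _ mu _ (measurable_shift1 1) (@lebesgue_shift 1) H).
rewrite E3 subrr => /esym /=.
under eq_Rintegral => y _.
  rewrite RintegralZl//; last exact: (@integrable_preserve R _ _ mu _ (measurable_shift1 y) (@lebesgue_shift y) h).
  rewrite E2; over.
rewrite RintegralZr//= /Rintegral integral_indic//= setIT lebesgue_measure_itv/= lte_fin ltr01.
by rewrite oppr0 adde0 /= mul1r.
Qed.

Lemma integral_gauss a : 0 < a ->
  (\int[mu]_t (expR (- (a * t ^+ 2)))%:E = (Num.sqrt (pi / a))%:E)%E.
Proof.
(* [s ^+ 2] is the variance for which the normal density is proportional to the given Gaussian. *)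
move=> a0; pose s : R := Num.sqrt (1 / (2 * a)).
have s2 : s ^+ 2 = 1 / (2 * a) by rewrite sqr_sqrtr// divr_ge0// mulr_ge0// ltW.
have s0 : s != 0 by rewrite gt_eqF// sqrtr_gt0 divr_gt0// mulr_gt0.
have := integral_normal_pdf 0 s; rewrite normal_pdfE//.
have q0 : 0 < Num.sqrt (pi / a) by rewrite sqrtr_gt0 divr_gt0// pi_gt0.
have E t : normal_peak s * normal_fun 0 s t = (Num.sqrt (pi / a))^-1 * expR (- (a * t ^+ 2)).
  rewrite /normal_peak /normal_fun s2; congr (_^-1 * expR _).
    by congr Num.sqrt; rewrite -mulr_natr; field; rewrite gt_eqF.
  by rewrite subr0 -mulr_natr; field; rewrite gt_eqF.
under eq_integral => t _ do rewrite E.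
rewrite ge0_integralZ; [|by rewrite invr_ge0 ltW|by meas|by move=> t; exact: expR_ge0].
move=> h; rewrite -[LHS]mul1e -[in LHS](mulfV (lt0r_neq0 q0)) EFinM -muleA h mule1//.
Qed.

Lemma integrable_gauss a : 0 < a ->
  mu.-integrable setT (EFin \o (fun t => expR (- (a * t ^+ 2)))).
Proof.
move=> a0; apply: integrable_ltyP; first by meas.
under eq_integral => t _ do rewrite ger0_norm ?expR_ge0//.
by rewrite integral_gauss// ltry.
Qed.

(** Completing the square: half of the Gaussian absorbs an exponential of [|t|], so a Gaussian times
    any function of exponential growth remains integrable. *)
Lemma expR_gauss_le a b t : 0 < a ->
  expR (b * `|t|) * expR (- (a * t ^+ 2)) <=
  expR (b ^+ 2 / (2 * a)) * expR (- (a / 2 * t ^+ 2)).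
Proof.
move=> a0; rewrite -!expRD ler_expR -[t ^+ 2]real_normK ?num_real//.
have : 0 <= a / 2 * (`|t| - b / a) ^+ 2 by rewrite mulr_ge0// ?sqr_ge0// divr_ge0// ltW.
have -> : a / 2 * (`|t| - b / a) ^+ 2 = a / 2 * `|t| ^+ 2 - b * `|t| + b ^+ 2 / (2 * a).
  by field; rewrite gt_eqF.
lra.
Qed.

Lemma integrable_gauss_le a b C (f : R -> R) : 0 < a -> measurable_fun setT f ->
  (forall t, `|f t| <= C * (expR (b * `|t|) * expR (- (a * t ^+ 2)))) ->
  mu.-integrable setT (EFin \o f).
Proof.
move=> a0 mf fle.
have C0 : 0 <= C.
  by have := le_trans (normr_ge0 _) (fle 0); rewrite pmulr_lge0// mulr_gt0// expR_gt0.
refine (@integrable_le _ _ _ mu _ (fun t => C * expR (b ^+ 2 / (2 * a)) * expR (- (a / 2 * t ^+ 2))) mf _ _).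
  have := @integrableZl _ _ _ mu setT measurableT (C * expR (b ^+ 2 / (2 * a))) _
    (integrable_gauss (divr_gt0 a0 (ltr0n R 2))).
  by apply: eq_integrable => // t _; rewrite /= EFinM.
move=> t; apply: (le_trans (fle t)); rewrite -mulrA ler_wpM2l//.
exact: expR_gauss_le.
Qed.

Lemma normr_sin_le1 (x : R) : `|sin x| <= 1.
Proof. by rewrite ler_norml sin_geN1 sin_le1. Qed.

Lemma normr_cos_le1 (x : R) : `|cos x| <= 1.
Proof. by rewrite ler_norml cos_geN1 cos_le1. Qed.

Lemma normr_le_expR (t : R) : `|t| <= expR `|t|.
Proof. by apply: le_trans (expR_ge1Dx _); rewrite lerDr. Qed.

(** As a function [y] of [x], the integral solves [y' = - (x / (2 * a)) * y]: differentiating under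
    the integral produces a factor [- t * sin (x * t)], and integration by parts against the
    Gaussian ([h] is the derivative of [H] in [t]) turns the result into a multiple of [y]. Hence
    [y] times the inverse Gaussian is constant, and its value at 0 is the Gaussian integral. *)
Lemma Rintegral_gauss_cos0 a x : 0 < a ->
  \int[mu]_t (expR (- (a * t ^+ 2)) * cos (x * t)) =
  Num.sqrt (pi / a) * expR (- (x ^+ 2 / (4 * a))).
Proof.
move=> a0.
pose f (x t : R) := expR (- (a * t ^+ 2)) * cos (x * t).
pose f' (x t : R) := expR (- (a * t ^+ 2)) * (- (t * sin (x * t))).
pose y (x : R) := \int[mu]_t f x t.
pose H (x0 t : R) := expR (- (a * t ^+ 2)) * sin (x0 * t).
pose h (x0 t : R) := 2 * a * f' x0 t + x0 * f x0 t.
have dh x0 t : derivable (h x0) t 1.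
  by rewrite /h /f' /f; apply: ex_derive.
have dH x0 t : is_derive t (1:R) (H x0) (h x0 t).
  by clear dh; rewrite /H /h /f' /f; apply: is_derive_eq; rewrite /GRing.scale /=; ring.
have df x0 t : is_derive x0 (1:R) (f ^~ t) (f' x0 t).
  clear dh dH.
  rewrite /f /f'; apply: is_derive_eq; rewrite /GRing.scale /=. ring.
have if_ x0 : mu.-integrable setT (EFin \o f x0).
  apply: (@integrable_gauss_le a 0 1) => //; first by rewrite /f; meas.
  move=> t; rewrite mul0r expR0 !mul1r normrM (ger0_norm (expR_ge0 _)).
  by rewrite ler_piMr ?expR_ge0 ?normr_cos_le1.
pose G t := `|t| * expR (- (a * t ^+ 2)).
have mG : measurable_fun setT G by rewrite /G; meas.
have iG : mu.-integrable setT (EFin \o G).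
  apply: (@integrable_gauss_le a 1 1) => // t.
  rewrite normrM normr_id ger0_norm ?expR_ge0// mul1r mul1r.
  by rewrite ler_wpM2r ?expR_ge0// normr_le_expR.
have f'G x0 t : `|f' x0 t| <= G t.
  rewrite /f' /G normrM normrN normrM ger0_norm ?expR_ge0// mulrC.
  by rewrite ler_wpM2r ?expR_ge0// ler_piMr// normr_sin_le1.
have mf' x0 : measurable_fun setT (f' x0) by rewrite /f'; meas.
have if' x0 : mu.-integrable setT (EFin \o f' x0) by exact: (@integrable_le _ _ _ mu _ G (mf' x0) iG (f'G x0)).
have dy x0 : is_derive x0 (1:R) y (\int[mu]_t f' x0 t).
  have xI : `]x0 - 1, x0 + 1[%classic x0 by rewrite /= in_itv/=; apply/andP; split; lra.
  have p1E (x1 t : R) : partial1of2 f x1 t = f' x1 t.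
    by rewrite partial1of2E; have [_ ->] := df x1 t.
  have d1 (x1 t : R) : `]x0 - 1, x0 + 1[%classic x1 -> setT t -> derivable (f ^~ t) x1 1.
    by move=> _ _; have [] := df x1 t.
  have d2 (x1 t : R) : `]x0 - 1, x0 + 1[%classic x1 -> setT t -> `|partial1of2 f x1 t| <= G t.
    by move=> _ _; rewrite p1E.
  have G0 t : 0 <= G t by rewrite mulr_ge0// expR_ge0.
  split.
    exact: (@derivable_under_integral _ _ _ mu f setT measurableT x0 _ _ xI (fun x _ => if_ x) d1 G G0 iG d2).
  have := (@differentiation_under_integral _ _ _ mu f setT measurableT x0 _ _ xI (fun x _ => if_ x) d1 G G0 iG d2).
  by rewrite derive1E => ->; apply: eq_Rintegral => t _; rewrite p1E.
have ode x0 : \int[mu]_t f' x0 t = - (x0 / (2 * a)) * y x0.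
  have iH : mu.-integrable setT (EFin \o H x0).
    apply: (@integrable_gauss_le a 0 1) => //; first by rewrite /H; meas.
    move=> t; rewrite mul0r expR0 !mul1r normrM (ger0_norm (expR_ge0 _)).
    by rewrite ler_piMr ?expR_ge0 ?normr_sin_le1.
  have i1 := @integrableZl _ _ _ mu setT measurableT (2 * a) _ (if' x0).
  have i2 := @integrableZl _ _ _ mu setT measurableT x0 _ (if_ x0).
  have ih : mu.-integrable setT (EFin \o h x0).
    by have := integrableD measurableT i1 i2; apply: eq_integrable.
  have ch : continuous (h x0).
    by move=> t; apply/differentiable_continuous/derivable1_diffP; exact: dh.
  have := Rintegral_derive ch (dH x0) iH ih.
  rewrite RintegralD// !RintegralZl// -/(y x0) => h0.
  apply: (mulfI (x := 2 * a)); first by rewrite mulf_neq0// gt_eqF.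
  rewrite (_ : _ * (- _ * _) = - (x0 * y x0)); first lra.
  by field; rewrite gt_eqF.
have cst0 : y x * expR (x ^+ 2 / (4 * a)) = y 0 * expR (0 ^+ 2 / (4 * a)).
  apply: (@is_derive_0_is_cst _ (fun x => y x * expR (x ^+ 2 / (4 * a)))) => x0.
  have := dy x0; rewrite ode => dy0.
  apply: is_derive_eq; rewrite /GRing.scale /=.
  by field; rewrite gt_eqF.
have y0 : y 0 = Num.sqrt (pi / a).
  rewrite /y /f; under eq_Rintegral => t _ do rewrite mul0r cos0 mulr1.
  by rewrite /Rintegral integral_gauss.
move: cst0; rewrite expr0n mul0r expR0 mulr1 y0 => <-.
by rewrite -mulrA -expRD subrr expR0 mulr1.
Qed.

End real_line.

(** * Fourier transforms of harmonic polynomials times Gaussians *)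

Section harmonic_polynomials.
Context {R : realType}.
Local Notation mu := (@lebesgue_measure R).
Implicit Types (a b c t : R) (x z : R * R).

(* The real part of [(c1 - i c2) * conj(x)^k]. *)
Fixpoint harm (k : nat) (c1 c2 : R) (x : R * R) : R :=
  if k is k'.+1 then x.1 * harm k' c1 c2 x + x.2 * harm k' (- c2) c1 x else c1.

Lemma measurable_harm k c1 c2 : measurable_fun setT (harm k c1 c2).
Proof.
elim: k c1 c2 => [|k IHk] c1 c2 /=; first exact: measurable_cst.
by apply: measurable_funD; apply: measurable_funM => //; meas.
Qed.

Lemma harmD k c1 c2 d1 d2 x :
  harm k (c1 + d1) (c2 + d2) x = harm k c1 c2 x + harm k d1 d2 x.
Proof. by elim: k c1 c2 d1 d2 => //= k IHk c1 c2 d1 d2; rewrite opprD !IHk; ring. Qed.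

Lemma harmZ k s c1 c2 x : harm k (s * c1) (s * c2) x = s * harm k c1 c2 x.
Proof. by elim: k c1 c2 => //= k IHk c1 c2; rewrite -mulrN !IHk; ring. Qed.

Lemma harmN k c1 c2 x : harm k (- c1) (- c2) x = - harm k c1 c2 x.
Proof. by rewrite -mulN1r -[- c2]mulN1r harmZ mulN1r. Qed.

Lemma harm_le k c1 c2 x :
  `|harm k c1 c2 x| <= (`|c1| + `|c2|) * (`|x.1| + `|x.2|) ^+ k.
Proof.
elim: k c1 c2 => [|k IHk] c1 c2 /=; first by rewrite mulr1 lerDl.
apply: (le_trans (ler_normD _ _)); rewrite !normrM.
have := ler_wpM2l (normr_ge0 x.1) (IHk c1 c2).
have := ler_wpM2l (normr_ge0 x.2) (IHk (- c2) c1); rewrite normrN exprS.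
lra.
Qed.

Lemma is_derive_harm1 k c1 c2 t y :
  is_derive t (1:R) (fun t => harm k c1 c2 (t, y)) (k%:R * harm k.-1 c1 c2 (t, y)).
Proof.
elim: k c1 c2 => [|k IHk] c1 c2 /=; first by rewrite mul0r; exact: is_derive_cst.
have h1 := IHk c1 c2; have h2 := IHk (- c2) c1; clear IHk.
apply: is_derive_eq; rewrite /GRing.scale /= -natr1.
by case: k h1 h2 => [|k] _ _ /=; ring.
Qed.

(** The derivative in the second coordinate carries an extra factor [-i], which turns the
    coefficients [c1, c2] into [- c2, c1]. Compared with the derivative in the first coordinate,
    this is the Cauchy-Riemann relation for a power of the conjugate variable. *)
Lemma is_derive_harm2 k c1 c2 t y :
  is_derive t (1:R) (fun t => harm k c1 c2 (y, t)) (k%:R * harm k.-1 (- c2) c1 (y, t)).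
Proof.
elim: k c1 c2 => [|k IHk] c1 c2 /=; first by rewrite mul0r; exact: is_derive_cst.
have h1 := IHk c1 c2; have h2 := IHk (- c2) c1; clear IHk.
apply: is_derive_eq; rewrite /GRing.scale /= -natr1.
by case: k h1 h2 => [|k] _ _ /=; ring.
Qed.

Definition dot x z := x.1 * z.1 + x.2 * z.2.
Definition nrm2 x := x.1 ^+ 2 + x.2 ^+ 2.
Definition gauss2 a x := expR (- (a * nrm2 x)).

Lemma nrm2_ge0 x : 0 <= nrm2 x. Proof. by rewrite addr_ge0 ?sqr_ge0. Qed.

Lemma gauss2E a x : gauss2 a x = expR (- (a * x.1 ^+ 2)) * expR (- (a * x.2 ^+ 2)).
Proof. by rewrite /gauss2 -expRD; congr expR; rewrite /nrm2; ring. Qed.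

(** Integrability on the plane is for Fubini; integrability along lines is for integration by parts
    in one coordinate at a time. *)
Lemma integrable_gauss2 a b C (f : R * R -> R) : 0 < a -> measurable_fun setT f ->
  (forall x, `|f x| <= C * expR (b * (`|x.1| + `|x.2|)) * gauss2 a x) ->
  [/\ mu2.-integrable setT (EFin \o f),
    (forall y, mu.-integrable setT (EFin \o (fun t => f (t, y)))) &
    (forall y, mu.-integrable setT (EFin \o (fun t => f (y, t))))].
Proof.
move=> a0 mf fle.
pose g t := expR (b * `|t|) * expR (- (a * t ^+ 2)).
have mg : measurable_fun setT g by rewrite /g; meas.
have g0 t : 0 <= g t by rewrite mulr_ge0 ?expR_ge0.
have fg x : `|f x| <= C * g x.1 * g x.2.
  apply: (le_trans (fle x)); rewrite gauss2E /g mulrDr expRD le_eqVlt; apply/orP; left.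
  by apply/eqP; ring.
have ig : mu.-integrable setT (EFin \o g).
  by apply: (@integrable_gauss_le _ a b 1) => // t; rewrite mul1r ger0_norm.
split.
- refine (@integrable_prod_le _ _ _ _ _ mu mu f (fun t => C * g t) g mf _ ig _).
    exact: integrable_rZl.
  by move=> x y; exact: fg.
- move=> y; apply: (@integrable_gauss_le _ a b (C * g y)) => //.
    by apply: (measurable_fcomp mf); meas.
  by move=> t; apply: (le_trans (fg _)); rewrite /= /g le_eqVlt; apply/orP; left; apply/eqP; ring.
- move=> y; apply: (@integrable_gauss_le _ a b (C * g y)) => //.
  by apply: (measurable_fcomp mf); meas.
Qed.

Lemma expR_normD (n m : nat) x : (n <= m)%N ->
  (`|x.1| + `|x.2|) ^+ n <= expR (m%:R * (`|x.1| + `|x.2|)).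
Proof.
move=> nm; set s := `|x.1| + `|x.2|.
have s0 : 0 <= s by rewrite addr_ge0.
rewrite expRM_natl; apply: (@le_trans _ _ (expR s ^+ n)).
  apply: lerXn2r; rewrite ?nnegrE ?expR_ge0//.
  by apply: le_trans (expR_ge1Dx _); rewrite lerDr.
by apply: ler_weXn2l => //; apply: le_trans (expR_ge1Dx s); rewrite lerDl.
Qed.

Lemma Rintegral_gauss_sin0 a (x : R) : 0 < a ->
  \int[mu]_t (expR (- (a * t ^+ 2)) * sin (x * t)) = 0.
Proof.
move=> a0; set f := fun t => _.
have mf : measurable_fun setT f by rewrite /f; meas.
have if_ : mu.-integrable setT (EFin \o f).
  apply: (@integrable_gauss_le _ a 0 1) => // t.
  rewrite mul0r expR0 !mul1r normrM (ger0_norm (expR_ge0 _)).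
  by rewrite ler_piMr ?expR_ge0 ?normr_sin_le1.
have := @Rintegral_preserve R _ _ mu _ (measurable_reflect1 0) (@lebesgue_reflect R 0) f mf.
rewrite (_ : (fun t => f (0 - t)) = (fun t => (-1) * f t)).
  by rewrite RintegralZl//; move: (Rintegral mu setT f) => X; clear => h; lra.
by apply/funext => t; rewrite /f sub0r sqrrN mulrN sinN; ring.
Qed.

Lemma Rintegral_prodM (f g : R -> R) : mu.-integrable setT (EFin \o f) ->
  mu.-integrable setT (EFin \o g) ->
  mu2.-integrable setT (EFin \o (fun z : R * R => f z.1 * g z.2)) /\
  \int[mu2]_z (f z.1 * g z.2) = (\int[mu]_t f t) * (\int[mu]_t g t).
Proof.
move=> fi gi.
have mf : measurable_fun setT f by apply/measurable_EFinP; exact: measurable_int fi.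
have mg : measurable_fun setT g by apply/measurable_EFinP; exact: measurable_int gi.
have i2 : mu2.-integrable setT (EFin \o (fun z : R * R => f z.1 * g z.2)).
  have mfg : measurable_fun setT (fun z : R * R => f z.1 * g z.2) by meas.
  refine (@integrable_prod_le _ _ _ _ _ mu mu _ (fun t => `|f t|) (fun t => `|g t|) mfg _ _ _).
  - exact: integrable_norm fi.
  - exact: integrable_norm gi.
  - by move=> x y; rewrite normrM.
split=> //; rewrite -(Rintegral_fubini1 i2) /=.
under eq_Rintegral => t _ do rewrite RintegralZl//.
by rewrite RintegralZr.
Qed.

(** The addition formulas split the integrand into four products of functions of one coordinate;
    every product with a sine factor integrates to 0 by oddness. *)
Lemma Rintegral_gauss_cos a x phi : 0 < a ->
  \int[mu2]_z (gauss2 a z * cos (dot x z + phi)) =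
  pi / a * gauss2 (4 * a)^-1 x * cos phi.
Proof.
move=> a0.
pose e t := expR (- (a * t ^+ 2)).
pose ec (y t : R) := e t * cos (y * t).
pose es (y t : R) := e t * sin (y * t).
have iec y : mu.-integrable setT (EFin \o ec y).
  apply: integrable_rMbd (integrable_gauss a0) _ _ => //; first by meas.
  exact: (fun t => normr_cos_le1 (y * t)).
have ies y : mu.-integrable setT (EFin \o es y).
  apply: integrable_rMbd (integrable_gauss a0) _ _ => //; first by meas.
  exact: (fun t => normr_sin_le1 (y * t)).
have E z : gauss2 a z * cos (dot x z + phi) =
   (cos phi * (ec x.1 z.1 * ec x.2 z.2) + (- cos phi) * (es x.1 z.1 * es x.2 z.2)) +
   ((- sin phi) * (es x.1 z.1 * ec x.2 z.2) + (- sin phi) * (ec x.1 z.1 * es x.2 z.2)).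
  by rewrite gauss2E /dot /ec /es /e !(cosD, sinD); ring.
under eq_Rintegral => z _ do rewrite E.
have [i1 e1] := Rintegral_prodM (iec x.1) (iec x.2).
have [i2 e2] := Rintegral_prodM (ies x.1) (ies x.2).
have [i3 e3] := Rintegral_prodM (ies x.1) (iec x.2).
have [i4 e4] := Rintegral_prodM (iec x.1) (ies x.2).
rewrite RintegralD//; last 2 first.
- by apply: integrable_rD; exact: integrable_rZl.
- by apply: integrable_rD; exact: integrable_rZl.
rewrite RintegralD//; last 2 first.
- exact: (integrable_rZl _ i1).
- exact: (integrable_rZl _ i2).
rewrite RintegralD//; last 2 first.
- exact: (integrable_rZl _ i3).
- exact: (integrable_rZl _ i4).
rewrite !RintegralZl// e1 e2 e3 e4 !Rintegral_gauss_cos0// !Rintegral_gauss_sin0//.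
rewrite gauss2E !(mulrC _^-1) -!/(_ / _).
rewrite -[in RHS](sqr_sqrtr (a := pi / a)); last by rewrite divr_ge0 ?pi_ge0 ?ltW.
ring.
Qed.

Lemma harm_gauss_le k n c1 c2 a (psi : R * R -> R) :
  (forall z, `|psi z| <= (`|z.1| + `|z.2|) ^+ n) ->
  forall z, `|psi z * harm k c1 c2 z * gauss2 a z| <=
    (`|c1| + `|c2|) * expR ((n + k)%:R * (`|z.1| + `|z.2|)) * gauss2 a z.
Proof.
move=> hpsi z; rewrite normrM (ger0_norm (expR_ge0 _)) ler_wpM2r ?expR_ge0//.
rewrite normrM (le_trans (ler_pM _ _ (hpsi z) (harm_le k c1 c2 z)))//.
rewrite mulrCA ler_wpM2l ?addr_ge0// -exprD.
exact: expR_normD.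
Qed.

End harmonic_polynomials.

(** * Hecke's identity for harmonic polynomials times Gaussians *)

Section harm_fourier.
Context {R : realType}.
Local Notation mu := (@lebesgue_measure R).
Implicit Types (a b c t : R) (x z : R * R).

Section integration_by_parts1.
Variables (k : nat) (c1 c2 a phi : R) (x : R * R).
Hypothesis a0 : 0 < a.

(** Real stand-in for the plane wave [e^(i x.z)]: the phase [phi] selects its real part, its
    imaginary part or a rotation of them, and differentiation amounts to a coordinate of [x] and an
    increase of the phase by [pi / 2]. *)
Definition wave z := cos (dot x z + phi).

Lemma measurable_wave : measurable_fun setT wave.
Proof. by rewrite /wave /dot; meas. Qed.

Lemma integrable_harm_wave n (psi : R * R -> R) : measurable_fun setT psi ->
  (forall z, `|psi z| <= (`|z.1| + `|z.2|) ^+ n) ->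
  let f := fun z => psi z * harm k c1 c2 z * gauss2 a z * wave z in
  [/\ mu2.-integrable setT (EFin \o f),
    (forall y, mu.-integrable setT (EFin \o (fun t => f (t, y)))) &
    (forall y, mu.-integrable setT (EFin \o (fun t => f (y, t))))].
Proof.
move=> mpsi hpsi f.
apply: (@integrable_gauss2 _ a (n + k)%:R (`|c1| + `|c2|)) => //.
  rewrite /f; have mh := @measurable_harm R k c1 c2; have mw := measurable_wave.
  by rewrite /gauss2 /nrm2; meas.
move=> z; rewrite /f normrM.
have := @harm_gauss_le R k n c1 c2 a psi hpsi z; apply: le_trans.
by rewrite ler_piMr// normr_cos_le1.
Qed.

End integration_by_parts1.

Section integration_by_parts2.
Variables (k : nat) (c1 c2 a phi : R) (x : R * R).
Hypothesis a0 : 0 < a.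

Let e z := gauss2 a z * wave phi x z.

Lemma wave_shift t : cos (t + (phi + pi / 2)) = - sin (t + phi).
Proof. by rewrite addrA cosDpihalf. Qed.

Lemma integrable_harm0 j d1 d2 psi : let f := fun z => harm j d1 d2 z * gauss2 a z * wave psi x z in
  [/\ mu2.-integrable setT (EFin \o f),
    (forall y, mu.-integrable setT (EFin \o (fun t => f (t, y)))) &
    (forall y, mu.-integrable setT (EFin \o (fun t => f (y, t))))].
Proof.
have := @integrable_harm_wave j d1 d2 a psi x a0 0 (cst 1) (measurable_cst _).
rewrite /=; under eq_fun do rewrite mul1r.
case=> [z|h1 h2 h3]; first by rewrite normr1.
split; first by move: h1; congr (mu2.-integrable setT (EFin \o _)); apply/funext => z; rewrite mul1r.
  by move=> y; move: (h2 y); congr (mu.-integrable setT (EFin \o _)); apply/funext => z; rewrite mul1r.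
by move=> y; move: (h3 y); congr (mu.-integrable setT (EFin \o _)); apply/funext => z; rewrite mul1r.
Qed.

(** The integrand is the derivative of [harm k c1 c2 * gauss2 a * wave phi x] in the first
    coordinate, with one term for each factor, so its integral over every horizontal line is 0. *)
Lemma harm_ibp1 :
  \int[mu2]_z (k%:R * (harm k.-1 c1 c2 z * gauss2 a z * wave phi x z)
   + (- (2 * a) * (z.1 * harm k c1 c2 z * gauss2 a z * wave phi x z)
   + x.1 * (harm k c1 c2 z * gauss2 a z * wave (phi + pi / 2) x z))) = 0.
Proof.
set h := fun z => _.
have [iA iA1 _] := integrable_harm0 k.-1 c1 c2 phi.
have [||iB iB1 _] := @integrable_harm_wave k c1 c2 a phi x a0 1 fst _ _.
- exact: measurable_fst.
- by move=> z; rewrite expr1 lerDl.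
have [iC iC1 _] := integrable_harm0 k c1 c2 (phi + pi / 2).
have [iH iH1 _] := integrable_harm0 k c1 c2 phi.
have ih : mu2.-integrable setT (EFin \o h).
  by apply: integrable_rD; [|apply: integrable_rD]; apply: integrable_rZl.
have inner1 y : \int[mu]_t h (t, y) = 0.
  apply: (@Rintegral_derive R (fun t => harm k c1 c2 (t, y) * gauss2 a (t, y) * wave phi x (t, y)) (fun t => h (t, y))).
  - move=> t; apply/differentiable_continuous/derivable1_diffP.
    rewrite /h /wave /gauss2 /nrm2 /dot /=.
    have h1 := @is_derive_harm1 R k c1 c2 t y.
    have h2 := @is_derive_harm1 R k.-1 c1 c2 t y.
    exact: ex_derive.
  - move=> t; rewrite /h /wave /= wave_shift /wave /gauss2 /nrm2 /dot /=.
    have h1 := @is_derive_harm1 R k c1 c2 t y.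
    apply: is_derive_eq; rewrite /GRing.scale /=; ring.
  - exact: iH1.
  - by apply: integrable_rD; [|apply: integrable_rD]; apply: integrable_rZl => //.
rewrite -[LHS](Rintegral_fubini2 ih).
under eq_Rintegral => y _ do rewrite inner1.
by rewrite Rintegral_cst//= mul0r.
Qed.

Lemma harm_ibp2 :
  \int[mu2]_z (k%:R * (harm k.-1 (- c2) c1 z * gauss2 a z * wave phi x z)
   + (- (2 * a) * (z.2 * harm k c1 c2 z * gauss2 a z * wave phi x z)
   + x.2 * (harm k c1 c2 z * gauss2 a z * wave (phi + pi / 2) x z))) = 0.
Proof.
set h := fun z => _.
have [iA _ iA1] := integrable_harm0 k.-1 (- c2) c1 phi.
have [||iB _ iB1] := @integrable_harm_wave k c1 c2 a phi x a0 1 snd _ _.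
- exact: measurable_snd.
- by move=> z; rewrite expr1 lerDr.
have [iC _ iC1] := integrable_harm0 k c1 c2 (phi + pi / 2).
have [iH _ iH1] := integrable_harm0 k c1 c2 phi.
have ih : mu2.-integrable setT (EFin \o h).
  by apply: integrable_rD; [|apply: integrable_rD]; apply: integrable_rZl.
have inner2 y : \int[mu]_t h (y, t) = 0.
  apply: (@Rintegral_derive R (fun t => harm k c1 c2 (y, t) * gauss2 a (y, t) * wave phi x (y, t)) (fun t => h (y, t))).
  - move=> t; apply/differentiable_continuous/derivable1_diffP.
    rewrite /h /wave /gauss2 /nrm2 /dot /=.
    have h1 := @is_derive_harm2 R k c1 c2 t y.
    have h2 := @is_derive_harm2 R k.-1 (- c2) c1 t y.
    exact: ex_derive.
  - move=> t; rewrite /h /wave /= wave_shift /wave /gauss2 /nrm2 /dot /=.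
    have h1 := @is_derive_harm2 R k c1 c2 t y.
    apply: is_derive_eq; rewrite /GRing.scale /=; ring.
  - exact: iH1.
  - by apply: integrable_rD; [|apply: integrable_rD]; apply: integrable_rZl => //.
rewrite -[LHS](Rintegral_fubini1 ih).
under eq_Rintegral => y _ do rewrite inner2.
by rewrite Rintegral_cst//= mul0r.
Qed.

End integration_by_parts2.

(** Hecke's identity, by induction on the degree. The recursion of [harm] writes the polynomial of
    degree [k.+1] as coordinates times polynomials of degree [k]; the two integrations by parts
    trade each coordinate of [z] for the matching coordinate of [x]. The power [i ^ k] of the
    complex identity appears as the phase [k%:R * (pi / 2)]. *)
Theorem harm_fourier k c1 c2 a phi x : 0 < a ->
  \int[mu2]_z (harm k c1 c2 z * gauss2 a z * wave phi x z) =
  (2 * a) ^- k * (pi / a) * harm k c1 c2 x * gauss2 (4 * a)^-1 x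
    * cos (phi + k%:R * (pi / 2)).
Proof.
move=> a0; elim: k c1 c2 phi => [|k IHk] c1 c2 phi.
  rewrite /wave /=; under eq_Rintegral => z _ do rewrite -mulrA.
  rewrite RintegralZl//; last first.
    have [+ _ _] := @integrable_harm0 a x a0 0 1 1 phi.
    by rewrite /wave; congr (mu2.-integrable setT (EFin \o _)); apply/funext => z; rewrite mul1r.
  by rewrite Rintegral_gauss_cos// expr0 invr1 mul0r addr0; ring.
have I1 := @harm_ibp1 k c1 c2 a phi x a0.
have I2 := @harm_ibp2 k (- c2) c1 a phi x a0.
have [iA _ _] := @integrable_harm0 a x a0 k.-1 c1 c2 phi.
have [iA' _ _] := @integrable_harm0 a x a0 k.-1 (- c1) (- c2) phi.
have [||iB _ _] := @integrable_harm_wave k c1 c2 a phi x a0 1 fst _ _.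
- exact: measurable_fst.
- by move=> z; rewrite expr1 lerDl.
have [||iB' _ _] := @integrable_harm_wave k (- c2) c1 a phi x a0 1 snd _ _.
- exact: measurable_snd.
- by move=> z; rewrite expr1 lerDr.
have [iC _ _] := @integrable_harm0 a x a0 k c1 c2 (phi + pi / 2).
have [iC' _ _] := @integrable_harm0 a x a0 k (- c2) c1 (phi + pi / 2).
move: I1; rewrite RintegralD//; last 2 first.
- exact: (integrable_rZl _ iA).
- by apply: integrable_rD; exact: integrable_rZl.
rewrite RintegralD//; last 2 first.
- exact: (integrable_rZl _ iB).
- exact: (integrable_rZl _ iC).
rewrite !RintegralZl// IHk => I1.
move: I2; rewrite RintegralD//; last 2 first.
- exact: (integrable_rZl _ iA').
- by apply: integrable_rD; exact: integrable_rZl.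
rewrite RintegralD//; last 2 first.
- exact: (integrable_rZl _ iB').
- exact: (integrable_rZl _ iC').
rewrite !RintegralZl// IHk => I2.
have -> : \int[mu2]_z (harm k.+1 c1 c2 z * gauss2 a z * wave phi x z) =
  \int[mu2]_z (z.1 * harm k c1 c2 z * gauss2 a z * wave phi x z) +
  \int[mu2]_z (z.2 * harm k (- c2) c1 z * gauss2 a z * wave phi x z).
  by rewrite -RintegralD//; apply: eq_Rintegral => z _ /=; ring.
(* The derivatives falling on the polynomials are opposite in the two identities, by the
   Cauchy-Riemann relation, and cancel in the sum. *)
have A' : \int[mu2]_z (harm k.-1 (- c1) (- c2) z * gauss2 a z * wave phi x z) =
  - \int[mu2]_z (harm k.-1 c1 c2 z * gauss2 a z * wave phi x z).
  rewrite -[RHS]mulN1r -(RintegralZl (-1) measurableT iA); apply: eq_Rintegral => z _.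
  by rewrite harmN; ring.
rewrite A' in I2.
have arg : phi + pi / 2 + k%:R * (pi / 2) = phi + k.+1%:R * (pi / 2).
  by rewrite -natr1; ring.
rewrite arg in I1 I2.
apply: (mulfI (x := 2 * a)); first by rewrite mulf_neq0// gt_eqF.
rewrite [in RHS]exprS invfM /=.
have -> : 2 * a * ((2 * a)^-1 * (2 * a) ^- k * (pi / a) * (x.1 * harm k c1 c2 x + x.2 * harm k (- c2) c1 x) *
   gauss2 (4 * a)^-1 x * cos (phi + k.+1%:R * (pi / 2))) =
  (2 * a) ^- k * (pi / a) * (x.1 * harm k c1 c2 x + x.2 * harm k (- c2) c1 x) *
   gauss2 (4 * a)^-1 x * cos (phi + k.+1%:R * (pi / 2)).
  by rewrite !mulrA mulfV ?mul1r// mulf_neq0// gt_eqF.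
move: I1 I2; clear.
set A := Rintegral _ _ _; set B := Rintegral _ _ _; set C := Rintegral _ _ _.
move: A B C (gauss2 _ _) (cos _) ((2 * a) ^- k) (harm _ _ _ _) (harm _ _ _ _) (pi / a) => A B C *; lra.
Qed.

End harm_fourier.

(** * An L^2 bound for Fourier transforms *)

Lemma fatou_le d (T : measurableType d) (R : realType)
    (m : {measure set T -> \bar R}) (f : T -> \bar R) (g : nat -> T -> \bar R) B :
  (forall n, measurable_fun setT (g n)) -> (forall n x, 0 <= g n x)%E ->
  (forall x, 0 <= f x)%E -> (forall x, f x <= limn_einf (g ^~ x))%E ->
  (forall n, \int[m]_x g n x <= B)%E -> (\int[m]_x f x <= B)%E.
Proof.
move=> mg g0 f0 fg gB; apply: (le_trans (le_integral_any m f0 fg)).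
apply: (le_trans (fatou m measurableT mg (fun n x _ => g0 n x))).
rewrite limn_einf_lim; apply: lime_le; first exact: is_cvg_einfs.
apply: nearW => n; apply: le_trans (gB n).
by apply: ereal_inf_lbound; exists n => //=.
Qed.

Lemma le_normr_RintegralE d (T : measurableType d) (R : realType)
    (m : {measure set T -> \bar R}) (f : T -> R) : measurable_fun setT f ->
  (`|\int[m]_x f x|%:E <= \int[m]_x `|f x|%:E)%E.
Proof.
move=> mf; have mfe : measurable_fun setT (EFin \o f) by exact/measurable_EFinP.
apply: le_trans (le_abse_integral m measurableT mfe).
rewrite /Rintegral; case: integral => [r| |] //=.
by rewrite normr0 leey.
by rewrite normr0 leey.
Qed.

Lemma young_aux (R : realFieldType) (u v g G : R) : 0 <= g * (u - v) ^+ 2 ->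
  u * v * G <= u * v * g -> u * v * G <= 2^-1 * (u ^+ 2 * g) + 2^-1 * (v ^+ 2 * g).
Proof. by move=> h1 h2; nra. Qed.

Section bessel.
Context {R : realType}.
Local Notation mu := (@lebesgue_measure R).
Implicit Types (x y z : R * R).

Lemma measurable_wave2 d (T : measurableType d) th (g h : T -> R * R) :
  measurable_fun setT g -> measurable_fun setT h ->
  measurable_fun setT (fun t => wave th (g t) (h t)).
Proof. by move=> mg mh; rewrite /wave /dot; meas. Qed.

Lemma measurable_gauss2 d (T : measurableType d) (a : R) (g : T -> R * R) :
  measurable_fun setT g -> measurable_fun setT (fun t => gauss2 a (g t)).
Proof. by move=> mg; rewrite /gauss2 /nrm2; meas. Qed.

Lemma gauss2_ge0 (a : R) z : 0 <= gauss2 a z. Proof. exact: expR_ge0. Qed.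

Lemma integrable_gauss2T (a : R) : 0 < a -> mu2.-integrable setT (EFin \o gauss2 a).
Proof.
move=> a0; have [||] // := @integrable_gauss2 R a 0 1 (gauss2 a) a0.
  by apply: measurable_gauss2; exact: measurable_id.
by move=> x; rewrite mul0r expR0 !mul1r ger0_norm ?expR_ge0.
Qed.

Lemma integral_gauss2 (a : R) : 0 < a ->
  (\int[mu2]_z (gauss2 a z)%:E = (pi / a)%:E)%E.
Proof.
move=> a0; have := @Rintegral_gauss_cos R a 0 0 a0.
under eq_Rintegral => z _ do rewrite /dot /= !mul0r !addr0 cos0 mulr1.
rewrite cos0 /gauss2 {2}/nrm2 /= expr0n addr0 mulr0 oppr0 expR0 !mulr1 => <-.
rewrite /Rintegral fineK//; apply: integrable_fin_num => //.
exact: integrable_gauss2T.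
Qed.

Lemma integral_gauss2_shift (a : R) (x : R * R) : 0 < a ->
  (\int[mu2]_z (gauss2 a (x - z))%:E = (pi / a)%:E)%E.
Proof.
move=> a0; rewrite -integral_gauss2//.
refine (@ge0_integral_preserve R _ _ mu2 _ (measurable_reflect x) (@leb2_reflect R x) (EFin \o gauss2 a) _ _).
  by apply/measurable_EFinP; apply: measurable_gauss2; exact: measurable_id.
by move=> z; rewrite lee_fin expR_ge0.
Qed.

(** The exponent has no factor [2 * pi], so the Plancherel constant in the plane is the square of
    [2 * pi]; this is the [4 * pi ^+ 2] of the bounds below. *)
Definition fouriercos (F : R * R -> R) th z := \int[mu2]_x (F x * wave th z x).

Section cosine_transform.
Variables (F : R * R -> R) (th : R).
Hypothesis iF : mu2.-integrable setT (EFin \o F).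

Let mF : measurable_fun setT F.
Proof. by apply/measurable_EFinP; exact: measurable_int iF. Qed.

Lemma integrable_fouriercos z : mu2.-integrable setT (EFin \o (fun x => F x * wave th z x)).
Proof.
apply: (integrable_rMbd (C := 1)) => //; last by move=> x; exact: normr_cos_le1.
by apply: measurable_wave2; meas.
Qed.

Lemma measurable_fouriercos : measurable_fun setT (fouriercos F th).
Proof.
apply: (@measurable_Rintegral _ _ (R * R)%type _ R mu2 (fun p : (R * R) * (R * R) => F p.2 * wave th p.1 p.2)).
by apply: measurable_funM; [meas|apply: measurable_wave2; meas].
Qed.

Lemma fouriercos_le z : `|fouriercos F th z| <= \int[mu2]_x `|F x|.
Proof.
apply: (le_trans (le_normr_Rintegral measurableT (integrable_fouriercos z))).
apply: le_Rintegral => //.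
- exact: integrable_norm (integrable_fouriercos z).
- exact: integrable_norm.
- by move=> x _; rewrite normrM ler_piMr// normr_cos_le1.
Qed.

Section gaussian_weight.
Variable a : R.
Hypothesis a0 : 0 < a.

(** Kernel obtained by composing the transposed transform, the Gaussian weight and the transform.
    The product formula for cosines bounds it by [gam], a sum of Gaussians in [x - y] and [- x - y]
    whose integral is [4 * pi ^+ 2] for every [a]. *)
Let Gam x y := \int[mu2]_z (wave th z x * wave th z y * gauss2 a z).
Let gam x y := 2^-1 * (pi / a) * (gauss2 (4 * a)^-1 (x - y) + gauss2 (4 * a)^-1 (- x - y)).

Let Gam_le x y : `|Gam x y| <= gam x y.
Proof.
have E z : wave th z x * wave th z y * gauss2 a z =
   2^-1 * (gauss2 a z * cos (dot (x - y) z + 0)) +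
   2^-1 * (gauss2 a z * cos (dot (- x - y) z + (- (th + th)))).
  rewrite /wave -[cos (dot (- x - y) z + _)]cosN.
  have -> : dot (x - y) z + 0 = (dot z x + th) - (dot z y + th).
    by rewrite /dot /=; ring.
  have -> : - (dot (- x - y) z + - (th + th)) = (dot z x + th) + (dot z y + th).
    by rewrite /dot /=; ring.
  by move: (dot z x + th) (dot z y + th) => X Y; rewrite cosB cosD; field.
have ig b w : mu2.-integrable setT (EFin \o (fun z => gauss2 a z * cos (dot w z + b))).
  apply: (integrable_rMbd (C := 1)); first exact: integrable_gauss2T.
    by rewrite /dot; meas.
  by move=> z; exact: normr_cos_le1.
rewrite /Gam; under eq_Rintegral => z _ do rewrite E.
rewrite RintegralD//; last 2 first.
- exact: (integrable_rZl _ (ig _ _)).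
- exact: (integrable_rZl _ (ig _ _)).
rewrite !RintegralZl// !Rintegral_gauss_cos// cos0 mulr1.
have p0 : 0 <= pi / a :> R by rewrite divr_ge0 ?pi_ge0 ?ltW.
have g1 := gauss2_ge0 (4 * a)^-1 (x - y); have g2 := gauss2_ge0 (4 * a)^-1 (- x - y).
rewrite /gam; move: (pi / a) p0 => p p0.
apply: (le_trans (ler_normD _ _)); rewrite mulrDr !normrM.
rewrite (ger0_norm p0) (ger0_norm g1) (ger0_norm g2) (@ger0_norm _ 2^-1) ?invr_ge0//.
rewrite !mulrA lerD2l ler_piMr ?normr_cos_le1//.
by rewrite !mulr_ge0// invr_ge0.
Qed.

Let gam_ge0 x y : 0 <= gam x y.
Proof. exact: le_trans (Gam_le x y). Qed.

Let gamC x y : gam x y = gam y x.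
Proof.
by rewrite /gam /gauss2 /nrm2 /=; congr (_ * (expR (- (_ * _)) + expR (- (_ * _)))); ring.
Qed.

Let mgam : measurable_fun setT (fun p : (R * R) * (R * R) => gam p.1 p.2).
Proof. by rewrite /gam /gauss2 /nrm2; meas. Qed.

Let int_gam x : (\int[mu2]_y (gam x y)%:E = (4 * pi ^+ 2)%:E)%E.
Proof.
have a4 : 0 < (4 * a)^-1 by rewrite invr_gt0 mulr_gt0.
have p0 : 0 <= pi / a :> R by rewrite divr_ge0 ?pi_ge0 ?ltW.
have mg w : measurable_fun setT (fun y => gauss2 (4 * a)^-1 (w - y)).
  by apply: measurable_gauss2; meas.
rewrite /gam ge0_integralZ; [|by rewrite mulr_ge0// invr_ge0|by apply: measurable_funD; exact: mg|
  by move=> y; rewrite addr_ge0 ?gauss2_ge0].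
under eq_integral => y _ do rewrite EFinD.
rewrite ge0_integralD//.
- rewrite !integral_gauss2_shift// -EFinD -EFinM; congr EFin.
  by field; rewrite gt_eqF.
- by move=> y _; rewrite lee_fin gauss2_ge0.
- by apply/measurable_EFinP; exact: mg.
- by move=> y _; rewrite lee_fin gauss2_ge0.
- by apply/measurable_EFinP; exact: mg.
Qed.

(** Schur's test. By Fubini the left side is the double integral of [F x * F y * Gam x y]; then
    [|F x * F y|] is at most half the sum of the squares, and each half is integrated against the
    symmetric kernel [gam] of constant mass. The Gaussian weight makes the double integrals converge
    absolutely for an integrable [F]. *)
Lemma bessel_gauss :
  (\int[mu2]_z (fouriercos F th z ^+ 2 * gauss2 a z)%:E <=
   (4 * pi ^+ 2)%:E * \int[mu2]_x (F x ^+ 2)%:E)%E.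
Proof.
pose M := \int[mu2]_x `|F x|.
have mFh := measurable_fouriercos.
have mg2 : measurable_fun setT (gauss2 a) by apply: measurable_gauss2; exact: measurable_id.
have mw2 : measurable_fun setT (fun p : (R * R) * (R * R) => wave th p.1 p.2).
  by apply: measurable_wave2; meas.
have FM z : `|fouriercos F th z| <= M := fouriercos_le z.
have Fg : mu2.-integrable setT (EFin \o (fun z => M * gauss2 a z)).
  by apply: integrable_rZl; exact: integrable_gauss2T.
have Fa := integrable_norm iF.
have M0 : 0 <= M by apply: Rintegral_ge0.
pose f1 (p : (R * R) * (R * R)) := F p.2 * wave th p.1 p.2 * (fouriercos F th p.1 * gauss2 a p.1).
have mf1 : measurable_fun setT f1 by rewrite /f1; meas.
have if1 : (prodm mu2 mu2).-integrable setT (EFin \o f1).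
  refine (@integrable_prod_le _ _ _ _ _ mu2 mu2 f1 _ _ mf1 Fg Fa _) => z x.
  rewrite /f1 /= !normrM mulrC (ger0_norm (gauss2_ge0 _ _)).
  apply: ler_pM => //; first by rewrite mulr_ge0// gauss2_ge0.
    by rewrite ler_wpM2r ?gauss2_ge0.
  by rewrite ler_piMr// normr_cos_le1.
have S1 : \int[mu2]_z (fouriercos F th z ^+ 2 * gauss2 a z) =
    \int[mu2]_x (F x * \int[mu2]_z (wave th z x * (fouriercos F th z * gauss2 a z))).
  transitivity (\int[mu2]_z \int[mu2]_x f1 (z, x)).
    apply: eq_Rintegral => z _; rewrite /f1 /=.
    by rewrite RintegralZr//; [rewrite -/(fouriercos F th z) expr2 mulrA|exact: integrable_fouriercos].
  rewrite (Rintegral_fubini if1); apply: eq_Rintegral => x _; rewrite /f1 /=.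
  under eq_Rintegral => z _ do rewrite -mulrA.
  rewrite RintegralZl//.
  refine (@integrable_le _ _ _ mu2 _ (fun z => M * gauss2 a z) _ _ _) => //.
    by apply: measurable_funM; [apply: measurable_wave2|]; meas.
  move=> z; rewrite !normrM (ger0_norm (gauss2_ge0 _ _)) -[leRHS]mul1r.
  apply: ler_pM => //; first by rewrite mulr_ge0// gauss2_ge0.
    exact: normr_cos_le1.
  by rewrite ler_wpM2r ?gauss2_ge0.
have S2 x : \int[mu2]_z (wave th z x * (fouriercos F th z * gauss2 a z)) =
    \int[mu2]_y (F y * Gam x y).
  pose f2 (p : (R * R) * (R * R)) := F p.2 * wave th p.1 p.2 * (wave th p.1 x * gauss2 a p.1).
  have mwx : measurable_fun setT (fun p : (R * R) * (R * R) => wave th p.1 x).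
    by apply: measurable_wave2; meas.
  have mf2 : measurable_fun setT f2 by rewrite /f2; meas.
  have if2 : (prodm mu2 mu2).-integrable setT (EFin \o f2).
    refine (@integrable_prod_le _ _ _ _ _ mu2 mu2 f2 _ _ mf2 (integrable_gauss2T a0) Fa _) => z y.
    rewrite /f2 /= !normrM mulrC (ger0_norm (gauss2_ge0 _ _)).
    apply: ler_pM => //; first by rewrite mulr_ge0// gauss2_ge0.
      by rewrite ler_piMl ?gauss2_ge0// normr_cos_le1.
    by rewrite ler_piMr// normr_cos_le1.
  transitivity (\int[mu2]_z \int[mu2]_y f2 (z, y)).
    apply: eq_Rintegral => z _; rewrite /f2 /=.
    rewrite RintegralZr//; last exact: integrable_fouriercos.
    by rewrite -/(fouriercos F th z); ring.
  rewrite (Rintegral_fubini if2); apply: eq_Rintegral => y _; rewrite /f2 /= /Gam.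
  rewrite -RintegralZl//.
    by apply: eq_Rintegral => z _; ring.
  refine (@integrable_le _ _ _ mu2 _ (gauss2 a) _ _ _); last 2 first.
  - exact: integrable_gauss2T.
  - move=> z; rewrite !normrM (ger0_norm (gauss2_ge0 _ _)) ler_piMl ?gauss2_ge0//.
    by rewrite mulr_ile1 ?normr_cos_le1.
  by apply: measurable_funM => //; apply: measurable_funM; apply: measurable_wave2; meas.
have sq_fin : (\int[mu2]_z (fouriercos F th z ^+ 2 * gauss2 a z)%:E)%E =
   (\int[mu2]_z (fouriercos F th z ^+ 2 * gauss2 a z))%:E.
  rewrite /Rintegral fineK//; apply: integrable_fin_num => //.
  refine (@integrable_le _ _ _ mu2 _ (fun z => M * (M * gauss2 a z)) _ _ _).
  - by meas.
  - exact: integrable_rZl.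
  - move=> z; rewrite expr2 !normrM (ger0_norm (gauss2_ge0 _ _)) -mulrA.
    apply: ler_pM => //; first by rewrite mulr_ge0// gauss2_ge0.
    by rewrite ler_wpM2r ?gauss2_ge0.
have mGam : measurable_fun setT (fun p : (R * R) * (R * R) => Gam p.1 p.2).
  pose G3 (q : ((R * R) * (R * R)) * (R * R)) := wave th q.2 q.1.1 * wave th q.2 q.1.2 * gauss2 a q.2.
  apply: (@measurable_Rintegral _ _ _ _ R mu2 G3); rewrite /G3.
  apply: measurable_funM; last by meas.
  by apply: measurable_funM; apply: measurable_wave2; meas.
have mG1 x : measurable_fun setT (Gam x).
  by apply: (measurable_fcomp (f := fun p : (R * R) * (R * R) => Gam p.1 p.2) (g := fun y => (x, y))) => //; meas.
pose h (p : (R * R) * (R * R)) := 2^-1 * (F p.1 ^+ 2 * gam p.1 p.2) + 2^-1 * (F p.2 ^+ 2 * gam p.2 p.1).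
have mgam' : measurable_fun setT (fun p : (R * R) * (R * R) => gam p.2 p.1).
  by under eq_fun do rewrite gamC.
have mA : measurable_fun setT (fun p : (R * R) * (R * R) => F p.1 ^+ 2 * gam p.1 p.2) by meas.
have mB : measurable_fun setT (fun p : (R * R) * (R * R) => F p.2 ^+ 2 * gam p.2 p.1) by meas.
have mgam1 x : measurable_fun setT (gam x).
  by apply: (measurable_fcomp (f := fun p : (R * R) * (R * R) => gam p.1 p.2) (g := fun y => (x, y))) => //; meas.
have A0 p : 0 <= F p.1 ^+ 2 * gam p.1 p.2 by rewrite mulr_ge0 ?sqr_ge0.
have B0 p : 0 <= F p.2 ^+ 2 * gam p.2 p.1 by rewrite mulr_ge0 ?sqr_ge0.
have AE : (\int[mu2]_x \int[mu2]_y (F x ^+ 2 * gam x y)%:E = (4 * pi ^+ 2)%:E * \int[mu2]_x (F x ^+ 2)%:E)%E.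
  have inner x : (\int[mu2]_y (F x ^+ 2 * gam x y)%:E = (4 * pi ^+ 2 * F x ^+ 2)%:E)%E.
    rewrite ge0_integralZ; [|exact: sqr_ge0|exact: mgam1|exact: gam_ge0].
    by rewrite int_gam -EFinM mulrC.
  under eq_integral => x _ do rewrite inner.
  rewrite ge0_integralZ//; [by rewrite mulr_ge0 ?sqr_ge0|by apply: measurable_funX; exact: mF|].
  by move=> x; exact: sqr_ge0.
have mA' : measurable_fun setT (fun p : (R * R) * (R * R) => 2^-1 * (F p.1 ^+ 2 * gam p.1 p.2)).
  by apply: measurable_funM.
have mB' : measurable_fun setT (fun p : (R * R) * (R * R) => 2^-1 * (F p.2 ^+ 2 * gam p.2 p.1)).
  by apply: measurable_funM.
have h0 p : 0 <= h p by rewrite /h addr_ge0// mulr_ge0// invr_ge0.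
have mh : measurable_fun setT h by exact: measurable_funD.
have hE : (\int[mu2]_x \int[mu2]_y (h (x, y))%:E = (4 * pi ^+ 2)%:E * \int[mu2]_x (F x ^+ 2)%:E)%E.
  rewrite -(@tonelli1 _ _ _ _ R mu2 mu2 h mh h0) /h.
  rewrite ge0_integral_rD; [|exact: mA'|exact: mB'|by move=> p; rewrite mulr_ge0// invr_ge0|by move=> p; rewrite mulr_ge0// invr_ge0].
  rewrite ge0_integralZ; [|by rewrite invr_ge0|exact: mA|exact: A0].
  rewrite ge0_integralZ; [|by rewrite invr_ge0|exact: mB|exact: B0].
  have := @tonelli1 _ _ _ _ R mu2 mu2 _ mA A0; rewrite /= AE => ->.
  have := @tonelli2 _ _ _ _ R mu2 mu2 _ mB B0; rewrite /= AE => ->.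
  rewrite -ge0_muleDl// ?lee_fin ?invr_ge0// -EFinD.
  by rewrite (_ : 2^-1 + 2^-1 = 1) ?mul1e//; field.
have mFG : measurable_fun setT (fun p : (R * R) * (R * R) => F p.2 * Gam p.1 p.2) by meas.
rewrite sq_fin S1 -hE; under eq_Rintegral => x _ do rewrite S2.
apply: (@le_trans _ _ (\int[mu2]_x `|F x * \int[mu2]_y (F y * Gam x y)|%:E)%E).
  apply: le_trans (le_normr_RintegralE _ _).
    by rewrite lee_fin ler_norm.
  apply: measurable_funM; first exact: mF.
  exact: (@measurable_Rintegral _ _ _ _ R mu2 _ mFG).
apply: le_integral_any => x; first by rewrite lee_fin.
have mFG1 : measurable_fun setT (fun y => F y * Gam x y) by apply: measurable_funM; [exact: mF|exact: mG1].
rewrite normrM EFinM.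
apply: (@le_trans _ _ (`|F x|%:E * \int[mu2]_y `|F y * Gam x y|%:E)%E).
  by rewrite lee_wpmul2l// ?lee_fin// le_normr_RintegralE.
rewrite -ge0_integralZ//; last exact: measurableT_comp.
apply: le_integral_any => y; rewrite lee_fin ?mulr_ge0//.
rewrite /h /= [gam y x]gamC normrM mulrA.
have := ler_wpM2l (mulr_ge0 (normr_ge0 (F x)) (normr_ge0 (F y))) (Gam_le x y).
have : 0 <= gam x y * (`|F x| - `|F y|) ^+ 2 by rewrite mulr_ge0// sqr_ge0.
rewrite -(real_normK (num_real (F x))) -(real_normK (num_real (F y))).
exact: young_aux.
Qed.

End gaussian_weight.

(** The weighted bound does not depend on the width of the weight, so the weight can tend to 1 under
    Fatou's lemma. *)
Lemma bessel :
  (\int[mu2]_z (fouriercos F th z ^+ 2)%:E <=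
   (4 * pi ^+ 2)%:E * \int[mu2]_x (F x ^+ 2)%:E)%E.
Proof.
pose g n z := (fouriercos F th z ^+ 2 * gauss2 (n.+1%:R)^-1 z)%:E.
have mFh := measurable_fouriercos.
apply: (@fatou_le _ _ _ mu2 _ g) => //.
- move=> n; apply/measurable_EFinP; apply: measurable_funM; first exact: measurable_funX.
  by apply: measurable_gauss2; meas.
- by move=> n z; rewrite lee_fin mulr_ge0 ?sqr_ge0// gauss2_ge0.
- by move=> z; rewrite lee_fin sqr_ge0.
- move=> z; suff /cvg_limn_einf_sup[-> _] : g n z @[n --> \oo] --> (fouriercos F th z ^+ 2)%:E by [].
  apply: cvg_EFin; first exact: nearW.
  rewrite -[X in _ --> X]mulr1; apply: cvgM; first exact: cvg_cst.
  rewrite /gauss2 -[X in _ --> X]expR0; apply: continuous_cvg; first exact: continuous_expR.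
  rewrite -[X in _ --> X]oppr0; apply: cvgN.
  rewrite -[X in _ --> X](mul0r (nrm2 z)); apply: cvgM; last exact: cvg_cst.
  exact: cvg_harmonic.
- by move=> n; apply: bessel_gauss; rewrite invr_gt0.
Qed.

End cosine_transform.
End bessel.

(** * The regularised kernel and its L^2 bound *)

Section mellin.
Context {R : realType}.
Local Notation mu := (@lebesgue_measure R).
Implicit Types (t s : R).

(* [\int u^(k - 1) e^(- u^2) du] in the variable [u = e^t]. *)
Definition mexp (k : nat) t : R := expR (k%:R * t - expR (2 * t)).
Definition mellin k : R := \int[mu]_t mexp k t.

Lemma measurable_mexp k : measurable_fun setT (mexp k).
Proof. by rewrite /mexp; meas. Qed.

Lemma mexp_ge0 k t : 0 <= mexp k t. Proof. exact: expR_ge0. Qed.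

Lemma expR_sqr t : expR (2 * t) = expR t ^+ 2.
Proof. by rewrite -expRM_natl. Qed.

(** For [t >= 0], [e^(2 t)] exceeds [t ^ 2], and [(k + 1) * t - t ^ 2] is at most [(k + 1) ^ 2 / 4];
    for [t < 0], [e^(k t)] already decays at least like [e^t]. The majorant is a two-sided
    exponential density. *)
Lemma mexp_le k t : (1 <= k)%N ->
  mexp k t <= expR ((k.+1%:R) ^+ 2 / 4) * (exponential_pdf 1 t + exponential_pdf 1 (0 - t)).
Proof.
move=> k1; have e0 (x : R) : 0 <= exponential_pdf 1 x by apply: exponential_pdf_ge0; exact: ler01.
have [t0|t0] := leP 0 t.
  rewrite (@le_trans _ _ (expR (k.+1%:R ^+ 2 / 4) * exponential_pdf 1 t))//; last first.
    by rewrite ler_wpM2l ?expR_ge0// lerDl.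
  rewrite exponential_pdfE//= mul1r -expRD ler_expR expR_sqr -natr1.
  have := expR_ge1Dx t; have := sqr_ge0 (k%:R + 1 - 2 * t).
  have : 1 + t <= expR t -> (1 + t) ^+ 2 <= expR t ^+ 2.
    by move=> h; apply: lerXn2r; rewrite ?nnegrE ?expR_ge0 ?addr_ge0.
  move: (expR t) (k%:R : R) => e K h1 h2 h3; have := h1 h3; nra.
rewrite (@le_trans _ _ (exponential_pdf 1 (0 - t)))//; last first.
  rewrite -[leLHS]mul1r ler_pM// ?lerDr//.
  by apply: le_trans (expR_ge1Dx _); rewrite lerDl mulr_ge0// ?invr_ge0// sqr_ge0.
have t0' : 0 <= 0 - t by rewrite sub0r oppr_ge0 ltW.
rewrite /mexp (exponential_pdfE _ t0') /= mul1r ler_expR mulN1r sub0r opprK.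
have := expR_ge0 (2 * t); have : (1 : R) <= k%:R by rewrite ler1n.
by move: (k%:R : R) (expR _) => K e; nra.
Qed.

Lemma integrable_mexp k : (1 <= k)%N -> mu.-integrable setT (EFin \o mexp k).
Proof.
move=> k1.
have i1 := @integrable_exponential_pdf R 1 ltr01.
have i2 := @integrable_preserve R _ _ mu _ (measurable_reflect1 0) (@lebesgue_reflect R 0) _ i1.
refine (@integrable_le _ _ _ mu _ (fun t => expR ((k.+1%:R) ^+ 2 / 4) * (exponential_pdf 1 t + exponential_pdf 1 (0 - t))) (@measurable_mexp k) _ _); last first.
  by move=> t; rewrite ger0_norm ?mexp_ge0//; exact: mexp_le.
by apply: integrable_rZl; apply: integrable_rD i2.
Qed.

Lemma mellin_gt0 k : (1 <= k)%N -> 0 < mellin k.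
Proof.
move=> k1; pose c : R := expR (- expR 2).
apply: (@lt_le_trans _ _ c); first exact: expR_gt0.
have -> : c = \int[mu]_t (c * \1_`[0, 1] t).
  rewrite RintegralZl//; last exact: integrable_indic_itv.
  rewrite /Rintegral integral_indic//= setIT lebesgue_measure_itv/= lte_fin ltr01.
  by rewrite oppr0 adde0 /= mulr1.
apply: le_Rintegral => //.
- by apply: integrable_rZl; exact: integrable_indic_itv.
- exact: integrable_mexp.
- move=> t _; rewrite indicE; case: (boolP (t \in _)) => [|_]; last by rewrite mulr0 mexp_ge0.
  rewrite inE /= in_itv/= => /andP[t0 t1]; rewrite mulr1 ler_expR.
  have : expR (2 * t) <= expR 2 :> R by rewrite ler_expR; lra.
  have : 0 <= k%:R * t by rewrite mulr_ge0.
  lra.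
Qed.

(** Functional equation of the Gamma function, since [mellin k] is half of Gamma at [k / 2]; it
    comes from integrating the derivative of [mexp k]. The factor [k%:R / 2] is what later cancels
    the growth of the kernel in [k]. *)
Lemma mellinS k : (1 <= k)%N -> mellin k.+2 = k%:R / 2 * mellin k.
Proof.
move=> k1; pose h t := k%:R * mexp k t + (- 2) * mexp k.+2 t.
have mS t : mexp k.+2 t = expR (2 * t) * mexp k t.
  by rewrite /mexp -expRD -addn2 natrD; congr expR; ring.
have dH t : is_derive t (1:R) (mexp k) (h t).
  rewrite /h mS /mexp; apply: is_derive_eq; rewrite /GRing.scale /=.
  by ring.
have i1 := integrable_mexp k1.
have i2 := @integrable_mexp k.+2 isT.
have ih : mu.-integrable setT (EFin \o h).
  by apply: integrable_rD; exact: integrable_rZl.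
have ch : continuous h.
  by move=> t; apply/differentiable_continuous/derivable1_diffP; rewrite /h /mexp; exact: ex_derive.
have := Rintegral_derive ch dH i1 ih; rewrite /h.
rewrite RintegralD//; last 2 first.
- exact: (integrable_rZl _ i1).
- exact: (integrable_rZl _ i2).
rewrite !RintegralZl// -/(mellin k) -/(mellin k.+2); move: (mellin k) (mellin k.+2) => A B; clear.
lra.
Qed.

(** Scaling by [s] is a translation by [ln s] in the variable [t]. *)
Lemma mellin_scale k s : (1 <= k)%N -> 0 < s ->
  mu.-integrable setT (EFin \o (fun t => expR (k%:R * t) * expR (- (s ^+ 2 * expR (2 * t))))) /\
  \int[mu]_t (expR (k%:R * t) * expR (- (s ^+ 2 * expR (2 * t)))) = s^-1 ^+ k * mellin k.
Proof.
move=> k1 s0.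
have E t : expR (k%:R * t) * expR (- (s ^+ 2 * expR (2 * t))) = s^-1 ^+ k * mexp k (t + ln s).
  have -> : mexp k (t + ln s) = expR (k%:R * t) * s ^+ k * expR (- (s ^+ 2 * expR (2 * t))).
    rewrite /mexp expRD mulrDr expRD (expRM_natl _ (ln s)) lnK ?posrE//.
    by rewrite mulrDr expRD (expRM_natl _ (ln s)) lnK ?posrE// [s ^+ 2 * _]mulrC.
  by rewrite exprVn; field; rewrite expf_neq0// gt_eqF.
have i := @integrable_preserve R _ _ mu _ (measurable_shift1 (ln s)) (@lebesgue_shift R (ln s)) _ (integrable_mexp k1).
have -> : (fun t => expR (k%:R * t) * expR (- (s ^+ 2 * expR (2 * t)))) =
   (fun t => s^-1 ^+ k * mexp k (t + ln s)) by apply/funext.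
split; first exact: (integrable_rZl _ i).
have e := RintegralZl (s^-1 ^+ k) measurableT i.
rewrite e; apply: (congr1 (fun x => s^-1 ^+ k * x)).
exact: (@Rintegral_preserve R _ _ mu _ (measurable_shift1 (ln s)) (@lebesgue_shift R (ln s)) _ (@measurable_mexp k)).
Qed.

Lemma mellin_scaleN k s : (1 <= k)%N -> 0 < s ->
  mu.-integrable setT (EFin \o (fun t => expR (- (k%:R * t)) * expR (- (s ^+ 2 * expR (- (2 * t)))))) /\
  \int[mu]_t (expR (- (k%:R * t)) * expR (- (s ^+ 2 * expR (- (2 * t))))) = s^-1 ^+ k * mellin k.
Proof.
move=> k1 s0; have [i <-] := mellin_scale k1 s0.
have := @integrable_preserve R _ _ mu _ (measurable_reflect1 0) (@lebesgue_reflect R 0) _ i.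
have mf : measurable_fun setT (fun t => expR (k%:R * t) * expR (- (s ^+ 2 * expR (2 * t)))) by meas.
have := @Rintegral_preserve R _ _ mu _ (measurable_reflect1 0) (@lebesgue_reflect R 0) _ mf.
have -> : (fun t => expR (- (k%:R * t)) * expR (- (s ^+ 2 * expR (- (2 * t))))) =
   (fun t => expR (k%:R * (0 - t)) * expR (- (s ^+ 2 * expR (2 * (0 - t))))).
  by apply/funext => t; rewrite sub0r !mulrN.
by move=> <-.
Qed.

End mellin.

Lemma damped_le (R : realFieldType) (A L H G : R) :
  0 <= A -> 0 <= H -> 0 <= G -> L <= 1 -> A * L * H * G <= H * (A * G).
Proof.
move=> A0 H0 G0 L1; rewrite (_ : A * L * H * G = (A * H * G) * L); last by ring.
by rewrite [leRHS](_ : _ = (A * H * G) * 1) ?ler_wpM2l ?mulr_ge0//; ring.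
Qed.

Lemma sqr_sum_le (R : realFieldType) (c u v : R) :
  (c * (u + v)) ^+ 2 <= 2 * c ^+ 2 * (u ^+ 2 + v ^+ 2).
Proof. have := sqr_ge0 (c * (u - v)); nra. Qed.

Lemma eq_ereal_le (R : realDomainType) (x y : \bar R) : x = y -> (x <= y)%E.
Proof. by move=> ->. Qed.

(** * Fourier representation of the regularised kernel *)

Section kernel.
Context {R : realType}.
Local Notation mu := (@lebesgue_measure R).
Implicit Types (t s : R) (x y z : R * R).

Lemma harm_sqr k (c1 c2 : R) x :
  harm k c1 c2 x ^+ 2 + harm k (- c2) c1 x ^+ 2 = (c1 ^+ 2 + c2 ^+ 2) * nrm2 x ^+ k.
Proof.
elim: k c1 c2 => [|k IHk] c1 c2 /=; first by rewrite expr0 mulr1 sqrrN addrC.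
rewrite harmN (exprS (nrm2 x)) mulrCA -IHk /nrm2; ring.
Qed.

Lemma normr_harm_le k (c1 c2 : R) x :
  `|harm k c1 c2 x| <= Num.sqrt (c1 ^+ 2 + c2 ^+ 2) * Num.sqrt (nrm2 x) ^+ k.
Proof.
have c0 : 0 <= c1 ^+ 2 + c2 ^+ 2 by rewrite addr_ge0 ?sqr_ge0.
have -> : Num.sqrt (c1 ^+ 2 + c2 ^+ 2) * Num.sqrt (nrm2 x) ^+ k =
    Num.sqrt ((c1 ^+ 2 + c2 ^+ 2) * nrm2 x ^+ k).
  rewrite sqrtrM//; congr (_ * _); rewrite -[in RHS](sqr_sqrtr (nrm2_ge0 x)).
  by rewrite -exprM mulnC exprM sqrtr_sqr ger0_norm// exprn_ge0// sqrtr_ge0.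
rewrite -sqrtr_sqr; apply: ler_wsqrtr.
by rewrite -harm_sqr lerDl sqr_ge0.
Qed.

(* Up to the factor [i^k], the kernel of R^k regularised by replacing [|z|^2] with
   [|z|^2 + dl]; [c1, c2] select its real or imaginary part. *)
Definition kern k (c1 c2 dl : R) z :=
  k%:R / (2 * pi) * (harm k c1 c2 z * (Num.sqrt (nrm2 z + dl))^-1 ^+ k.+2).

Lemma measurable_kern k (c1 c2 dl : R) : measurable_fun setT (kern k c1 c2 dl).
Proof.
have mh := @measurable_harm R k c1 c2.
by rewrite /kern /nrm2; meas.
Qed.

Section representation.
Variables (k : nat) (c1 c2 dl : R).
Hypothesis (k1 : (1 <= k)%N) (dl0 : 0 < dl).

(* Subordination: [s^(-k-2)] is a Mellin transform of Gaussians [e^(-s^2 e^(2t))], each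
   of which is a Fourier transform; integrating in [t] first leaves a bounded multiplier. *)
Let w (p : R * (R * R)) := (4 * pi * 2 ^+ k)^-1 *
  (expR (- (k%:R * p.1)) * expR (- (dl * expR (2 * p.1))) * harm k c1 c2 p.2
    * gauss2 (expR (- (2 * p.1)) / 4) p.2).
Let phi : R := - (k%:R * (pi / 2)).

Let mw : measurable_fun setT w.
Proof.
have mh := @measurable_harm R k c1 c2.
by rewrite /w /gauss2 /nrm2; meas.
Qed.

(** Hecke's identity at [a = e^(-2 t) / 4], whose dual Gaussian has parameter [e^(2 t)]. The
    constant [(4 * pi * 2 ^+ k)^-1] in [w] absorbs the factor [(2 * a) ^- k * (pi / a)] up to a
    power of [e^t], and the phase [phi] cancels the rotation by [i ^ k]. *)
Let w_wave t z : \int[mu2]_x (w (t, x) * wave phi z x) =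
  harm k c1 c2 z * (expR (k.+2%:R * t) * expR (- ((nrm2 z + dl) * expR (2 * t)))).
Proof.
set E := expR (2 * t).
have E0 : 0 < E by exact: expR_gt0.
have En : E != 0 by rewrite gt_eqF.
have a0 : 0 < expR (- (2 * t)) / 4 by rewrite divr_gt0// expR_gt0.
have aE : expR (- (2 * t)) = E^-1 by rewrite expRN.
pose C := (4 * pi * 2 ^+ k)^-1 * (expR (- (k%:R * t)) * expR (- (dl * E))).
transitivity (\int[mu2]_x (C * (harm k c1 c2 x * gauss2 (expR (- (2 * t)) / 4) x * wave phi z x))).
  by apply: eq_Rintegral => x _; rewrite /w /C /=; ring.
rewrite RintegralZl//; last first.
  by have [] := @integrable_harm0 R (expR (- (2 * t)) / 4) z a0 k c1 c2 phi.
rewrite harm_fourier// /phi addNr cos0 mulr1 aE.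
have -> : (4 * (E^-1 / 4))^-1 = E by field.
have -> : 2 * (E^-1 / 4) = (2 * E)^-1 by field.
have -> : pi / (E^-1 / 4) = 4 * pi * E by field.
rewrite exprVn invrK exprMn /gauss2 /C.
have -> : expR (- ((nrm2 z + dl) * E)) = expR (- (dl * E)) * expR (- (E * nrm2 z)).
  by rewrite -expRD; congr expR; ring.
have -> : expR (k.+2%:R * t) = expR (- (k%:R * t)) * (E ^+ k * E).
  rewrite /E -expRM_natl -!expRD; congr expR.
  by rewrite -addn2 natrD; ring.
have p0 : pi != 0 :> R by rewrite gt_eqF// pi_gt0.
have k0 : 2 ^+ k != 0 :> R by rewrite expf_neq0.
move: (pi : R) p0 => p p0; field; by rewrite k0 p0.
Qed.

(** In the rescaled variable [u = e^(- t) * x] half of the Gaussian absorbs the polynomial. The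
    constant depends on [k], but only integrability of [w] is drawn from it. *)
Let w_le : exists C, 0 <= C /\ forall t x,
  `|w (t, x)| <= C * (expR (- (dl * expR (2 * t))) * gauss2 (expR (- (2 * t)) / 8) x).
Proof.
exists ((4 * pi * 2 ^+ k)^-1 * ((`|c1| + `|c2|) * (expR (k%:R ^+ 2 / (2 * (1 / 4))) ^+ 2))).
have D0 : 0 <= (4 * pi * 2 ^+ k)^-1 :> R.
  by rewrite invr_ge0 !mulr_ge0 ?pi_ge0 ?exprn_ge0.
split=> [|t x].
  by rewrite mulr_ge0// mulr_ge0 ?addr_ge0// sqr_ge0.
rewrite /w /= normrM (ger0_norm D0) -[leRHS]mulrA ler_wpM2l//.
rewrite !normrM (ger0_norm (gauss2_ge0 _ _)) (ger0_norm (expR_ge0 _)) (ger0_norm (expR_ge0 _)).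
pose e := expR (- t).
have ek : expR (- (k%:R * t)) = e ^+ k by rewrite -mulrN expRM_natl.
have e2 : expR (- (2 * t)) = e ^+ 2 by rewrite -mulrN expRM_natl.
rewrite ek e2.
set u := (e * x.1, e * x.2).
have h1 : e ^+ k * `|harm k c1 c2 x| <= (`|c1| + `|c2|) * expR (k%:R * (`|u.1| + `|u.2|)).
  rewrite (@le_trans _ _ (e ^+ k * ((`|c1| + `|c2|) * (`|x.1| + `|x.2|) ^+ k)))//.
    by rewrite ler_wpM2l ?exprn_ge0 ?expR_ge0// harm_le.
  rewrite mulrCA -exprMn ler_wpM2l ?addr_ge0//.
  have -> : e * (`|x.1| + `|x.2|) = `|u.1| + `|u.2|.
    by rewrite /u /= !normrM (@ger0_norm _ e) ?expR_ge0//; ring.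
  exact: expR_normD.
have g4 : gauss2 (e ^+ 2 / 4) x = expR (- (1 / 4 * u.1 ^+ 2)) * expR (- (1 / 4 * u.2 ^+ 2)).
  by rewrite gauss2E; congr (expR (- _) * expR (- _)); rewrite /u /=; field.
have g8 : gauss2 (e ^+ 2 / 8) x = expR (- (1 / 4 / 2 * u.1 ^+ 2)) * expR (- (1 / 4 / 2 * u.2 ^+ 2)).
  by rewrite gauss2E; congr (expR (- _) * expR (- _)); rewrite /u /=; field.
have q0 : 0 < 1 / 4 :> R by rewrite divr_gt0.
have l1 := @expR_gauss_le R (1 / 4) k%:R u.1 q0.
have l2 := @expR_gauss_le R (1 / 4) k%:R u.2 q0.
have l12 := ler_pM (mulr_ge0 (expR_ge0 _) (expR_ge0 _)) (mulr_ge0 (expR_ge0 _) (expR_ge0 _)) l1 l2.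
rewrite [leLHS](_ : _ = expR (- (dl * expR (2 * t))) * ((e ^+ k * `|harm k c1 c2 x|) * gauss2 (e ^+ 2 / 4) x)); last by ring.
rewrite [leRHS](_ : _ = expR (- (dl * expR (2 * t))) * ((`|c1| + `|c2|) * (expR (k%:R ^+ 2 / (2 * (1 / 4))) ^+ 2 * gauss2 (e ^+ 2 / 8) x))); last by ring.
rewrite ler_wpM2l ?expR_ge0//.
rewrite (@le_trans _ _ ((`|c1| + `|c2|) * expR (k%:R * (`|u.1| + `|u.2|)) * gauss2 (e ^+ 2 / 4) x))//.
  by rewrite ler_wpM2r// expR_ge0.
rewrite -mulrA ler_wpM2l ?addr_ge0// g4 g8 mulrDr expRD.
by move: l12; rewrite mulrACA [leRHS]mulrACA -expr2.
Qed.

Let iw : (prodm mu mu2).-integrable setT (EFin \o w).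
Proof.
have mwe : measurable_fun setT (EFin \o w) by exact/measurable_EFinP.
apply: (proj2 (@integrable12ltyP _ _ _ _ _ mu mu2 _ mwe)) => /=.
have [C [C0 wC]] := w_le.
have s0 : 0 < Num.sqrt dl by rewrite sqrtr_gt0.
have [im _] := @mellin_scale R 2 (Num.sqrt dl) isT s0.
rewrite sqr_sqrtr ?ltW// in im.
have inner t : (\int[mu2]_x (C * (expR (- (dl * expR (2 * t))) * gauss2 (expR (- (2 * t)) / 8) x))%:E
   = (C * (8 * pi) * (expR (2 * t) * expR (- (dl * expR (2 * t)))))%:E)%E.
  have mg : measurable_fun setT (gauss2 (expR (- (2 * t)) / 8) : R * R -> R).
    by apply: measurable_gauss2; exact: measurable_id.
  under eq_integral => x _ do rewrite mulrA.
  rewrite ge0_integralZ; [|by rewrite mulr_ge0 ?expR_ge0|exact: mg|by move=> x; exact: expR_ge0].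
  rewrite integral_gauss2; last by rewrite divr_gt0// expR_gt0.
  have -> : pi / (expR (- (2 * t)) / 8) = 8 * pi * expR (2 * t).
    by rewrite expRN; move: (pi : R) => p; field; rewrite gt_eqF// expR_gt0.
  by rewrite -EFinM; congr EFin; move: (pi : R) => p; ring.
apply: (@le_lt_trans _ _ (\int[mu]_t (C * (8 * pi) * (expR (2 * t) * expR (- (dl * expR (2 * t)))))%:E)%E).
  apply: le_integral_any => t; first exact: integral_ge0.
  rewrite -inner; apply: le_integral_any => x; first by rewrite lee_fin.
  by rewrite lee_fin.
have := integrable_rZl (C * (8 * pi)) im => /integrableP[_].
apply: le_lt_trans; apply: le_integral_any => t.
  by rewrite lee_fin !mulr_ge0 ?expR_ge0 ?pi_ge0.
by rewrite /= lee_fin ler_norm.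
Qed.

Let m x := \int[mu]_t w (t, x).

Let im : mu2.-integrable setT (EFin \o m).
Proof.
have := integrable_fubini_G iw => /integrableP[mG G].
apply: le_integrable (integrable_fubini_G iw) => //.
  apply/measurable_EFinP.
  apply: (@measurable_Rintegral _ _ (R * R)%type _ R mu (fun q => w (q.2, q.1))).
  by apply: (measurable_fcomp mw); meas.
move=> x _; rewrite /= /fubini_G /m /Rintegral.
by case: integral => [r| |] /=; rewrite ?leey ?lexx.
Qed.

(** Bounding [exp (- dl * e^(2 t))] by 1 leaves a scale invariant integral, [mellin k] times the
    power [- k] of half the modulus of [x]. This power cancels that of the harmonic polynomial, so
    the bound depends neither on [x] nor on [dl]. At the origin the polynomial vanishes because
    [k >= 1]. *)
Let m_le x : mu.-integrable setT (EFin \o (fun t => w (t, x))) /\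
  `|m x| <= mellin k / (4 * pi) * Num.sqrt (c1 ^+ 2 + c2 ^+ 2).
Proof.
have pi0 := @pi_gt0 R.
have M0 : 0 < mellin k :> R := mellin_gt0 k1.
have rhs0 : 0 <= mellin k / (4 * pi) * Num.sqrt (c1 ^+ 2 + c2 ^+ 2).
  apply: mulr_ge0; last exact: sqrtr_ge0.
  by apply: divr_ge0; [exact: ltW M0|rewrite mulr_ge0// (ltW pi0)].
set r := Num.sqrt (nrm2 x).
have hr := @normr_harm_le k c1 c2 x.
have [r0|r0] := leP r 0.
  have r00 : r = 0 by apply/eqP; rewrite eq_le r0 sqrtr_ge0.
  have h0 : harm k c1 c2 x = 0.
    apply/eqP; rewrite -normr_le0 (le_trans hr)// -/r r00 expr0n.
    by case: k k1 => // n _; rewrite mulr0.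
  have w0 : (fun t => w (t, x)) = cst 0.
    by apply/funext => t; rewrite /w /= h0 mulr0 mul0r mulr0.
  rewrite /m w0 Rintegral_cst//= mul0r normr0; split=> //.
  exact: integrable0.
have r2 : 0 < r / 2 by rewrite divr_gt0.
have [ie ee] := mellin_scaleN k1 r2.
have D0 : 0 <= (4 * pi * 2 ^+ k)^-1 :> R.
  by rewrite invr_ge0 !mulr_ge0 ?pi_ge0 ?exprn_ge0.
pose c := (4 * pi * 2 ^+ k)^-1 * `|harm k c1 c2 x|.
have wle t : `|w (t, x)| <= c * (expR (- (k%:R * t)) * expR (- ((r / 2) ^+ 2 * expR (- (2 * t))))).
  rewrite /w /c /= normrM (ger0_norm D0) -[leRHS]mulrA ler_wpM2l//.
  rewrite !normrM (ger0_norm (gauss2_ge0 _ _)) !(ger0_norm (expR_ge0 _)).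
  have -> : gauss2 (expR (- (2 * t)) / 4) x = expR (- ((r / 2) ^+ 2 * expR (- (2 * t)))).
    rewrite /gauss2; congr (expR (- _)).
    by rewrite exprMn sqr_sqrtr ?nrm2_ge0//; field.
  apply: damped_le; rewrite ?mulr_ge0 ?expR_ge0//.
  by rewrite -expR0 ler_expR oppr_le0 mulr_ge0 ?expR_ge0// ltW.
have mwx : measurable_fun setT (fun t => w (t, x)) by apply: (measurable_fcomp mw); meas.
have icx := integrable_rZl c ie.
have iwx := @integrable_le _ _ _ mu _ _ mwx icx wle.
split; first exact: iwx.
apply: (le_trans (le_normr_Rintegral measurableT iwx)).
apply: (@le_trans _ _ (c * ((r / 2)^-1 ^+ k * mellin k))).
  rewrite -ee -(RintegralZl c measurableT ie); apply: le_Rintegral => //.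
    exact: integrable_norm iwx.
apply: (@le_trans _ _ ((4 * pi * 2 ^+ k)^-1 * (Num.sqrt (c1 ^+ 2 + c2 ^+ 2) * r ^+ k) * ((r / 2)^-1 ^+ k * mellin k))).
  rewrite ler_wpM2r ?ler_wpM2l//.
  by rewrite mulr_ge0 ?exprn_ge0 ?invr_ge0 ?(ltW r2) ?(ltW M0).
rewrite exprVn exprMn exprVn le_eqVlt; apply/orP; left; apply/eqP.
have p0 := lt0r_neq0 pi0; have rk : r ^+ k != 0 by rewrite expf_neq0// gt_eqF.
have k0 : 2 ^+ k != 0 :> R by rewrite expf_neq0.
move: (pi : R) p0 (mellin k) (Num.sqrt (_ + _)) (r ^+ k) rk (2 ^+ k) k0 => p p0 M S u u0 v v0.
by field; rewrite p0 u0 v0.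
Qed.

Let kern_repr z : fouriercos m phi z =
  harm k c1 c2 z * ((Num.sqrt (nrm2 z + dl))^-1 ^+ k.+2 * mellin k.+2).
Proof.
have s0 : 0 < nrm2 z + dl by rewrite ltr_wpDl// nrm2_ge0.
have ss0 : 0 < Num.sqrt (nrm2 z + dl) by rewrite sqrtr_gt0.
have [ie <-] := @mellin_scale R k.+2 _ isT ss0.
rewrite sqr_sqrtr in ie *; last exact: ltW.
rewrite -(RintegralZl _ measurableT ie); under [RHS]eq_Rintegral => t _ do rewrite -w_wave.
pose f (p : R * (R * R)) := w p * wave phi z p.2.
have mwv : measurable_fun setT (fun p : R * (R * R) => wave phi z p.2).
  by apply: measurable_wave2; meas.
have if_ : (prodm mu mu2).-integrable setT (EFin \o f).
  by apply: (integrable_rMbd (C := 1) iw) => // p; exact: normr_cos_le1.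
have := Rintegral_fubini if_; rewrite /f /= => ->.
rewrite /fouriercos; apply: eq_Rintegral => x _.
by rewrite RintegralZr//; have [] := m_le x.
Qed.

(** The convolution becomes a multiplication: the formula for the cosine of a difference writes it
    as two cosine transforms of [m] times transforms of [g], and Bessel's inequality is applied on
    both sides of [m]. By [mellinS], [c * Mu] is [4^-1 / pi ^+ 2] times the length of the vector of
    [c1, c2]; its square cancels the two Bessel constants, and the remaining 4 is the price of
    having two terms. *)
Lemma kern_L2 (g : R * R -> R) : mu2.-integrable setT (EFin \o g) ->
  (\int[mu2]_z ((\int[mu2]_y (kern k c1 c2 dl (z - y) * g y)) ^+ 2)%:E <=
   (4 * (c1 ^+ 2 + c2 ^+ 2))%:E * \int[mu2]_y (g y ^+ 2)%:E)%E.
Proof.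
move=> ig.
have pi0 := @pi_gt0 R.
have M0 : 0 < mellin k :> R := mellin_gt0 k1.
have M2 : 0 < mellin k.+2 :> R := @mellin_gt0 R k.+2 isT.
have mg : measurable_fun setT g by apply/measurable_EFinP; exact: measurable_int ig.
have mm : measurable_fun setT m by apply/measurable_EFinP; exact: measurable_int im.
pose c : R := k%:R / (2 * pi) / mellin k.+2.
have kernE z : kern k c1 c2 dl z = c * fouriercos m phi z.
  rewrite kern_repr /kern /c; move: (k%:R / (2 * pi)) (mellin k.+2) (lt0r_neq0 M2) => q M Mn.
  by field; rewrite Mn.
pose A x := fouriercos g 0 x.
pose B x := fouriercos g (- (pi / 2)) x.
have mA : measurable_fun setT A by exact: measurable_fouriercos.
have mB : measurable_fun setT B by exact: measurable_fouriercos.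
have imA : mu2.-integrable setT (EFin \o (fun x => m x * A x)).
  by apply: (integrable_rMbd im mA) => x; exact: (fouriercos_le _ ig).
have imB : mu2.-integrable setT (EFin \o (fun x => m x * B x)).
  by apply: (integrable_rMbd im mB) => x; exact: (fouriercos_le _ ig).
have TE z : \int[mu2]_y (kern k c1 c2 dl (z - y) * g y) =
  c * (fouriercos (fun x => m x * A x) phi z + fouriercos (fun x => m x * B x) (phi - pi / 2) z).
  pose f (p : (R * R) * (R * R)) := g p.1 * (m p.2 * wave phi (z - p.1) p.2).
  have mf : measurable_fun setT f.
    rewrite /f; apply: measurable_funM; first by meas.
    by apply: measurable_funM; [meas|apply: measurable_wave2; meas].
  have if_ : (prodm mu2 mu2).-integrable setT (EFin \o f).
    refine (@integrable_prod_le _ _ _ _ _ mu2 mu2 f _ _ mf (integrable_norm ig) (integrable_norm im) _) => y x.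
    by rewrite /f /= !normrM mulrA ler_piMr ?mulr_ge0// normr_cos_le1.
  transitivity (c * \int[mu2]_y \int[mu2]_x f (y, x)).
    rewrite -RintegralZl//; last exact: (integrable_Rintegral if_).
    apply: eq_Rintegral => y _; rewrite kernE /f /= RintegralZl//.
      by rewrite -/(fouriercos m phi (z - y)); ring.
    exact: integrable_fouriercos.
  congr (c * _); rewrite (Rintegral_fubini if_) /f /= /fouriercos -RintegralD//; last 2 first.
  - exact: (integrable_fouriercos _ imA).
  - exact: (integrable_fouriercos _ imB).
  apply: eq_Rintegral => x _.
  have E y : g y * (m x * wave phi (z - y) x) =
     m x * wave phi z x * (g y * wave 0 x y) + m x * wave (phi - pi / 2) z x * (g y * wave (- (pi / 2)) x y).
    rewrite /wave addr0.
    have -> : dot (z - y) x + phi = (dot z x + phi) - dot x y by rewrite /dot /=; ring.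
    have cs (t : R) : cos (t - pi / 2) = sin t.
      by rewrite cosB cos_pihalf sin_pihalf mulr0 add0r mulr1.
    rewrite cosB addrA !cs; ring.
  under eq_Rintegral => y _ do rewrite E.
  have i1 := @integrable_fouriercos R g 0 ig x.
  have i2 := @integrable_fouriercos R g (- (pi / 2)) ig x.
  rewrite RintegralD//; last 2 first.
  - exact: (integrable_rZl _ i1).
  - exact: (integrable_rZl _ i2).
  rewrite !RintegralZl// -/(fouriercos g 0 x) -/(fouriercos g (- (pi / 2)) x) -/(A x) -/(B x).
  ring.
pose Mu : R := mellin k / (4 * pi) * Num.sqrt (c1 ^+ 2 + c2 ^+ 2).
pose G := (\int[mu2]_y (g y ^+ 2)%:E)%E.
have G0 : (0 <= G)%E by apply: integral_ge0 => y _; rewrite lee_fin sqr_ge0.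
pose u z := fouriercos (fun x => m x * A x) phi z.
pose v z := fouriercos (fun x => m x * B x) (phi - pi / 2) z.
have mu_ : measurable_fun setT u by exact: measurable_fouriercos.
have mv_ : measurable_fun setT v by exact: measurable_fouriercos.
have p24 : (0 <= (4 * pi ^+ 2)%:E :> \bar R)%E by rewrite lee_fin mulr_ge0// sqr_ge0.
have step psi (F : R * R -> R) th : F = fouriercos g th -> measurable_fun setT F ->
    mu2.-integrable setT (EFin \o (fun x => m x * F x)) ->
   (\int[mu2]_z (fouriercos (fun x => (m x * F x)%R) psi z ^+ 2)%:E <=
     (4 * pi ^+ 2 * (Mu ^+ 2 * (4 * pi ^+ 2)))%:E * G)%E.
  move=> FE mF imF; apply: (le_trans (bessel _ imF)).
  rewrite (EFinM (4 * pi ^+ 2) (Mu ^+ 2 * _)) -[leRHS]muleA lee_wpmul2l//.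
  apply: (@le_trans _ _ ((Mu ^+ 2)%:E * \int[mu2]_x (F x ^+ 2)%:E)%E).
    rewrite -ge0_integralZ; [|exact: sqr_ge0|by apply: measurable_funX; exact: mF|by move=> x; exact: sqr_ge0].
    apply: le_integral_any => x; rewrite lee_fin ?sqr_ge0// exprMn ler_wpM2r ?sqr_ge0//.
    have [_ h] := m_le x.
    by rewrite -[m x ^+ 2]real_normK ?num_real// lerXn2r ?nnegrE// (le_trans _ h).
  rewrite (EFinM (Mu ^+ 2)) -[leRHS]muleA lee_wpmul2l ?lee_fin ?sqr_ge0// FE.
  exact: bessel.
have s1 := step phi A 0 erefl mA imA.
have s2 := step (phi - pi / 2) B (- (pi / 2)) erefl mB imB.
apply: (@le_trans _ _ (\int[mu2]_z (2 * c ^+ 2 * (u z ^+ 2 + v z ^+ 2))%:E)%E).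
  apply: le_integral_any => z; rewrite lee_fin ?sqr_ge0// TE -/(u z) -/(v z).
  exact: sqr_sum_le.
rewrite ge0_integralZ; [|by rewrite mulr_ge0// sqr_ge0|by meas|by move=> z; rewrite addr_ge0 ?sqr_ge0].
rewrite ge0_integral_rD; [|by apply: measurable_funX; exact: mu_|by apply: measurable_funX; exact: mv_|by move=> z; rewrite sqr_ge0|by move=> z; rewrite sqr_ge0].
apply: (@le_trans _ _ ((2 * c ^+ 2)%:E * ((4 * pi ^+ 2 * (Mu ^+ 2 * (4 * pi ^+ 2)))%:E * G + (4 * pi ^+ 2 * (Mu ^+ 2 * (4 * pi ^+ 2)))%:E * G))%E).
  by apply: lee_wpmul2l; [rewrite lee_fin mulr_ge0// sqr_ge0|exact: leeD s1 s2].
have BB0 : (0 <= (4 * pi ^+ 2 * (Mu ^+ 2 * (4 * pi ^+ 2)))%:E :> \bar R)%E.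
  by rewrite lee_fin; apply: mulr_ge0; [|apply: mulr_ge0; [exact: sqr_ge0|]];
    (apply: mulr_ge0 => //; exact: sqr_ge0).
rewrite -(ge0_muleDl _ BB0 BB0).
rewrite muleA -EFinD -EFinM -/G; apply: eq_ereal_le; congr ((_)%:E * _)%E.
have c0 : 0 <= c1 ^+ 2 + c2 ^+ 2 by rewrite addr_ge0 ?sqr_ge0.
rewrite /c /Mu (mellinS k1) [(mellin k / (4 * pi) * _) ^+ 2]exprMn sqr_sqrtr//.
have p0 := lt0r_neq0 pi0; have MM := lt0r_neq0 M0.
have kn : k%:R != 0 :> R by rewrite pnatr_eq0 -lt0n.
move: (pi : R) p0 (mellin k) MM (k%:R : R) kn (c1 ^+ 2 + c2 ^+ 2) => p p0 M Mn K Kn S.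
by field; rewrite p0 Mn Kn.
Qed.

End representation.

End kernel.

(** * A weak type bound with linear dependence on the dilation factor *)

(** The case [t = N] is included: [find] returns the length of the list when no index qualifies. *)
Lemma find_iota (a : pred nat) N t : (t <= N)%N ->
  (forall i, (i < t)%N -> ~~ a i) -> ((t < N)%N -> a t) -> find a (iota 0 N) = t.
Proof.
move=> tN h1 h2; apply/eqP; rewrite eqn_leq; apply/andP; split.
  rewrite leqNgt; apply/negP => lt.
  have tN' : (t < N)%N by rewrite (leq_trans lt)// -[leqRHS](size_iota 0) find_size.
  have := before_find 0 lt; rewrite nth_iota// add0n => /negbT/negP; apply; exact: h2.
rewrite leqNgt; apply/negP => lt; have lN := leq_trans lt tN.
have ha : has a (iota 0 N) by rewrite has_find size_iota.
by have := nth_find 0 ha; rewrite nth_iota// add0n; apply/negP; exact: h1.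
Qed.

Lemma measurable_fun_select d d' (T : measurableType d) (T' : measurableType d')
    (tau : T -> nat) (G : nat -> T -> T') :
  measurable_fun setT tau -> (forall j, measurable_fun setT (G j)) ->
  measurable_fun setT (fun x => G (tau x) x).
Proof.
move=> mtau mG _ Y mY; rewrite setTI.
have -> : (fun x => G (tau x) x) @^-1` Y =
    \bigcup_j ((tau @^-1` [set j]) `&` (G j @^-1` Y)).
  apply/seteqP; split => x /=; first by move=> h; exists (tau x).
  by case=> j _ [/= <-].
apply: bigcupT_measurable => j; apply: measurableI.
  by rewrite -[X in measurable X]setTI; exact: mtau.
by rewrite -[X in measurable X]setTI; exact: mG.
Qed.

Lemma measurable_find d (T : measurableType d) (a : nat -> T -> bool) (s : seq nat) :
  (forall j, measurable_fun setT (a j)) ->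
  measurable_fun setT (fun x => find (a^~ x) s).
Proof.
move=> ma; elim: s => [|i s IHs] /=; first exact: measurable_cst.
apply: measurable_fun_ifT => //; exact: (measurable_fcomp (f := S)).
Qed.

Lemma chebyshev_le d (T : measurableType d) (R : realType)
    (m : {measure set T -> \bar R}) (h : T -> \bar R) (c : R) (A : set T) :
  measurable A -> 0 < c -> (forall z, 0 <= h z)%E -> (forall z, A z -> c%:E <= h z)%E ->
  (m A <= (c^-1)%:E * \int[m]_z h z)%E.
Proof.
move=> mA c0 h0 Ah; rewrite -[leLHS]mul1e -(mulVf (lt0r_neq0 c0)) EFinM -muleA.
rewrite lee_wpmul2l ?lee_fin ?invr_ge0 ?(ltW c0)//.
have -> : (c%:E * m A = \int[m]_z (c * \1_A z)%:E)%E.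
  rewrite ge0_integralZ; [|exact: ltW|exact: measurable_indic|by []].
  by rewrite integral_indic// setIT.
apply: le_integral_any => z; first by rewrite lee_fin mulr_ge0// ltW.
rewrite indicE; case: (boolP (z \in A)) => [|_]; last by rewrite mulr0 h0.
by rewrite inE mulr1 => /Ah.
Qed.

(** * Sup norm and dyadic cells of the plane *)

Section plane.
Context {R : realType}.
Local Notation mu := (@lebesgue_measure R).
Implicit Types (x y z w : R * R).

(** Its balls are squares, of the same shape as the dyadic cells and with an exact area. *)
Definition supn x : R := Num.max `|x.1| `|x.2|.

Lemma supn_le x (r : R) : (supn x <= r) = (`|x.1| <= r) && (`|x.2| <= r).
Proof. by rewrite /supn ge_max. Qed.

Lemma supn_ge0 x : 0 <= supn x. Proof. by rewrite /supn le_max normr_ge0. Qed.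

Lemma supnD x y : supn (x + y) <= supn x + supn y.
Proof.
have := lexx (supn x); rewrite supn_le => /andP[x1 x2].
have := lexx (supn y); rewrite supn_le => /andP[y1 y2].
rewrite supn_le /=; apply/andP; split; apply: (le_trans (ler_normD _ _)); exact: lerD.
Qed.

Lemma supnB x y : supn (x - y) = supn (y - x).
Proof. by rewrite /supn /= (distrC x.1) (distrC x.2). Qed.

Lemma measurable_supn d (T : measurableType d) (g : T -> R * R) :
  measurable_fun setT g -> measurable_fun setT (fun t => supn (g t)).
Proof. by move=> mg; rewrite /supn; meas. Qed.

Lemma ge0_integral_shift2 (g : R * R -> \bar R) x : measurable_fun setT g ->
  (forall z, 0 <= g z)%E -> (\int[mu2]_z g (z - x)%R = \int[mu2]_z g z)%E.
Proof.
move=> mg g0.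
have mg' : measurable_fun setT (fun w => g (0 - w)).
  by apply: (measurable_fcomp mg); meas.
have h1 := @ge0_integral_preserve R _ _ mu2 _ (measurable_reflect x) (@leb2_reflect R x) _ mg' (fun z => g0 _).
have h2 := @ge0_integral_preserve R _ _ mu2 _ (measurable_reflect 0) (@leb2_reflect R 0) _ mg g0.
rewrite -h2 -h1; apply: eq_integral => z _; congr g.
by rewrite sub0r opprB.
Qed.

Lemma leb2_supn_ball x (r : R) : 0 <= r ->
  mu2 [set z | supn (z - x) <= r] = ((2 * r) ^+ 2)%:E.
Proof.
move=> r0.
have -> : [set z | supn (z - x) <= r] = `[x.1 - r, x.1 + r] `*` `[x.2 - r, x.2 + r].
  apply/seteqP; split => z /=; rewrite supn_le /= !ler_distl !in_itv/=.
    by case/andP.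
  by case=> -> ->.
rewrite /mu2 [LHS]product_measure1E//= !lebesgue_measure_itv/= !lte_fin.
move: r0; rewrite le_eqVlt => /orP[/eqP <-|r0].
  by rewrite !subr0 !addr0 !ltxx mul0e mulr0 expr0n.
have h (t : R) : t - r < t + r by lra.
by rewrite !h -!EFinB -EFinM; congr EFin; ring.
Qed.

Definition fl (t : R) : R := (Num.floor t)%:~R.

Lemma measurable_fl : measurable_fun setT fl.
Proof.
apply: nondecreasing_measurable; first exact: measurableT.
by move=> s t st; rewrite /fl ler_int le_floor.
Qed.

Lemma fl_le (s t : R) : (forall n : int, (n%:~R <= s) = (n%:~R <= t)) -> fl s = fl t.
Proof.
move=> h; congr (_%:~R); apply/eqP; rewrite eq_le !floor_ge_int.
by rewrite -h floor_le h floor_le.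
Qed.

Lemma fl_eqE (s t : R) : (fl s == fl t) = (fl t <= s < fl t + 1).
Proof. by rewrite /fl eqr_int floor_eq intrD. Qed.

(** Nesting of dyadic intervals: an integer [n] lies below [s] exactly when [2 * n] lies below the
    floor of [2 * s], so the finer floor determines the coarser one. *)
Lemma fl_double (s t : R) : fl (2 * s) = fl (2 * t) -> fl s = fl t.
Proof.
move=> /intr_inj e; apply: fl_le => n.
have h (x : R) : (n%:~R <= x) = (2 * n <= Num.floor (2 * x)).
  by rewrite floor_ge_int intrM ler_pM2l.
by rewrite !h e.
Qed.

Lemma lebesgue_cell (l t : R) : 0 < l -> mu [set s | fl (t / l) == fl (s / l)] = l%:E.
Proof.
move=> l0; have -> : [set s | fl (t / l) == fl (s / l)] = `[fl (t / l) * l, (fl (t / l) + 1) * l[%classic.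
  apply/seteqP; split => s /=; rewrite in_itv/= eq_sym fl_eqE ler_pdivlMr// ltr_pdivrMr//.
rewrite lebesgue_measure_itv/= lte_fin ltr_pM2r// ltrDl ltr01 -EFinB; congr EFin; ring.
Qed.

(** Half-open square cells of mesh [l], encoded as an equivalence relation so that arguments refer
    to points instead of to families of cells. *)
Definition same (l : R) x y :=
  (fl (x.1 / l) == fl (y.1 / l)) && (fl (x.2 / l) == fl (y.2 / l)).

Lemma same_sym l x y : same l x y = same l y x.
Proof. by rewrite /same eq_sym [X in _ && X]eq_sym. Qed.

Lemma same_left l x y z : same l x y -> same l x z = same l y z.
Proof. by rewrite /same => /andP[/eqP-> /eqP->]. Qed.

Lemma same_half (l : R) x y : same (l / 2) x y -> same l x y.
Proof.
have h (t : R) : t / (l / 2) = 2 * (t / l) by rewrite invfM invrK; ring.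
by rewrite /same !h => /andP[/eqP/fl_double-> /eqP/fl_double->]; rewrite !eqxx.
Qed.

Lemma same_supn (l : R) x y : 0 < l -> same l x y -> supn (x - y) <= l.
Proof.
move=> l0; have h (s t : R) : fl (s / l) == fl (t / l) -> `|s - t| <= l.
  move=> e; have e2 : fl (t / l) == fl (t / l) by [].
  move: e e2; rewrite !fl_eqE => /andP[a1 a2] /andP[b1 b2].
  have : `|s / l - t / l| <= 1 by rewrite ler_norml; apply/andP; split; lra.
  by rewrite -mulrBl normrM (@ger0_norm _ l^-1) ?invr_ge0 ?(ltW l0)// ler_pdivrMr// mul1r.
by rewrite /same supn_le /= => /andP[/h -> /h ->].
Qed.

Lemma measurable_same d (T : measurableType d) (l : R) (g h : T -> R * R) :
  measurable_fun setT g -> measurable_fun setT h ->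
  measurable_fun setT (fun t => same l (g t) (h t)).
Proof.
move=> mg mh; have mf := measurable_fl.
rewrite /same; apply: measurable_and; apply: measurable_fun_eqr;
  by apply: (measurable_fcomp mf); meas.
Qed.

Lemma integral_same (l : R) x (c : R) : 0 < l -> 0 <= c ->
  (\int[mu2]_y (if same l x y then c else 0)%:E = (c * l ^+ 2)%:E)%E.
Proof.
move=> l0 c0; pose A := [set s | fl (x.1 / l) == fl (s / l)] `*` [set s | fl (x.2 / l) == fl (s / l)].
have mcell (t : R) : measurable [set s : R | fl (t / l) == fl (s / l)].
  have -> : [set s | fl (t / l) == fl (s / l)] = (fun s => fl (t / l) == fl (s / l)) @^-1` [set true].
    by apply/seteqP; split => s /=.
  rewrite -[X in measurable X]setTI.
  have mf := measurable_fl.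
  have : measurable_fun [set: R] (fun s : R => fl (t / l) == fl (s / l)).
    by apply: measurable_fun_eqr; [exact: measurable_cst|apply: (measurable_fcomp mf); meas].
  by apply.
have mA : measurable A by apply: measurableX.
transitivity (\int[mu2]_y (c * \1_A y)%:E)%E.
  apply: eq_integral => y _; rewrite indicE /A; congr EFin.
  have -> : (y \in [set s | fl (x.1 / l) == fl (s / l)] `*` [set s | fl (x.2 / l) == fl (s / l)]) = same l x y.
    by apply/idP/idP; rewrite inE /same /=; [case=> -> ->|move=> /andP[-> ->]].
  by case: ifP => _; rewrite ?mulr1 ?mulr0.
have mI : measurable_fun [set: R * R] (\1_A : R * R -> R) by exact: measurable_indic.
rewrite ge0_integralZ//.
have pE : mu2 A = (mu [set s | fl (x.1 / l) == fl (s / l)] * mu [set s | fl (x.2 / l) == fl (s / l)])%E.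
  by rewrite /mu2 /A [LHS]product_measure1E//; exact: mcell.
rewrite integral_indic// setIT; transitivity (c%:E * mu2 A)%E; first by [].
by rewrite pE (lebesgue_cell x.1 l0) (lebesgue_cell x.2 l0) -!EFinM.
Qed.

End plane.

Lemma leftover_aux (R : realFieldType) (L l M a X : R) : 0 < X ->
  3 * L * l * M <= X * a -> L * (l / X) * M <= a / 3.
Proof.
move=> X0 h; rewrite [leLHS](_ : _ = L * l * M / X); last by ring.
by rewrite ler_pdivrMr//; lra.
Qed.

(** * Calderon-Zygmund decomposition at height [kk * alpha] for an abstract kernel *)

Section calderon_zygmund.
Context {R : realType}.
Implicit Types (x y z w : R * R).
(** [A] and [kk] enter the final constant. [B] and [L], which depend on the regularisation, serve
    integrability and the choice of the last level [N]. *)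
Variables (K : R * R -> R) (B A kk L : R).
Hypothesis mK : measurable_fun setT K.
Hypothesis K_bound : forall w, `|K w| <= B.
Hypothesis A0 : 0 <= A.
Hypothesis kk1 : 1 <= kk.
Hypothesis L0 : 0 <= L.
Hypothesis K_lip : forall w h, `|K w - K (w - h)| <= L * supn h.
Hypothesis K_L2 : forall g : R * R -> R, mu2.-integrable setT (EFin \o g) ->
  (\int[mu2]_z ((\int[mu2]_y (K (z - y)%R * g y)%R) ^+ 2)%:E <=
   A%:E * \int[mu2]_y (g y ^+ 2)%:E)%E.
Hypothesis K_hormander : forall (l : R) (h : R * R), 0 < l -> supn h <= l ->
  (\int[mu2]_w (if (4 * kk * l < supn w)%R then `|K w - K (w - h)%R|%R else 0)%:E
    <= (A * kk)%:E)%E.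

Variables (f : R * R -> R) (alpha : R).
Hypothesis intf : mu2.-integrable setT (EFin \o f).
Hypothesis alpha0 : 0 < alpha.

Let F x := `|f x|.
Let Nf := \int[mu2]_x F x.
Let lam := kk * alpha.
(** Coarsest mesh, large enough that the mean of [F] over any cell of level 0 is at most [lam], so
    no such cell is selected; the [+ 1] keeps the mesh positive when [Nf] is 0. *)
Let l0 := Num.sqrt (Nf / lam) + 1.
Let l (j : nat) := l0 / 2 ^+ j.
(** Chosen, through [n < 2 ^ n], so that [L * l N * Nf <= alpha / 3]: replacing [f] by its means
    over cells of level [N] then moves the convolution by at most a third of [alpha]. *)
Let N := Num.truncn (3 * L * l0 * Nf / alpha).
(** Not normalised: [sel] compares this integral over the cell with [lam] times the area of the
    cell. *)
Let Avg j x := \int[mu2]_y (if same (l j) x y then F y else 0).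
Let sel j x := (lam * l j ^+ 2 < Avg j x)%R.
(* The largest stopping cell around [x]. Points in no cell of a level below [N] have
   [tau x = N] and are treated as if they lay in the cell of level [N], where the
   Lipschitz bound on [K] already suffices. *)
Let tau x := find (sel^~ x) (iota 0 N).
Let S x := sel (tau x) x.
Let len x := l (tau x).
Let P x y := if same (len x) x y then (len x ^+ 2)^-1 else 0.
(* The good function replaces [f] by its mean over each cell; writing the mean as an
   integral against [P] avoids summing over cells. *)
Let g y := \int[mu2]_x (P x y * f x).
Let T (h : R * R -> R) z := \int[mu2]_y (K (z - y) * h y).

Let kk0 : 0 < kk. Proof. exact: lt_le_trans kk1. Qed.
Let lam0 : 0 < lam. Proof. by rewrite mulr_gt0. Qed.
Let mf : measurable_fun setT f.
Proof. by apply/measurable_EFinP; exact: measurable_int intf. Qed.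
Let mF : measurable_fun setT F. Proof. by rewrite /F; meas. Qed.
Let F0 x : 0 <= F x. Proof. exact: normr_ge0. Qed.
Let intF : mu2.-integrable setT (EFin \o F). Proof. exact: integrable_norm. Qed.
Let Nf0 : 0 <= Nf. Proof. by apply: Rintegral_ge0. Qed.
Let NfE : (\int[mu2]_x (F x)%:E = Nf%:E)%E.
Proof. by rewrite /Nf /Rintegral fineK//; exact: integrable_fin_num. Qed.
Let l00 : 0 < l0. Proof. by rewrite ltr_wpDl// sqrtr_ge0. Qed.
Let lj0 j : 0 < l j. Proof. by rewrite divr_gt0// exprn_gt0. Qed.
Let len0 x : 0 < len x. Proof. exact: lj0. Qed.

Let lS j : l j.+1 = l j / 2.
Proof. by rewrite /l exprS invfM mulrCA mulrC. Qed.

Let Nf_le : Nf <= lam * l 0 ^+ 2.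
Proof.
rewrite /l expr0 divr1 mulrC -ler_pdivrMr// -[leLHS]sqr_sqrtr ?divr_ge0 ?(ltW lam0)//.
by apply: lerXn2r; rewrite ?nnegrE ?sqrtr_ge0 ?(ltW l00)// lerDl.
Qed.

Let l_N : L * l N * Nf <= alpha / 3.
Proof.
have X0 : 0 <= 3 * L * l0 * Nf / alpha by rewrite !mulr_ge0 ?invr_ge0 ?(ltW l00) ?(ltW alpha0).
have h : 3 * L * l0 * Nf / alpha <= 2 ^+ N.
  apply: (le_trans (ltW (truncnS_gt _))); rewrite -natrX ler_nat.
  exact: ltn_expl.
move: h; rewrite ler_pdivrMr// /l => h.
have p0 : 0 < 2 ^+ N :> R by rewrite exprn_gt0.
exact: leftover_aux.
Qed.

Let msame_l j : measurable_fun setT (fun q : (R * R) * (R * R) => same (l j) q.1 q.2).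
Proof. by apply: measurable_same; meas. Qed.

Let mAvg j : measurable_fun setT (Avg j).
Proof.
apply: (@measurable_Rintegral _ _ _ _ R mu2 (fun q : (R * R) * (R * R) => if same (l j) q.1 q.2 then F q.2 else 0)).
apply: measurable_fun_ifT; [exact: msame_l| |exact: measurable_cst].
by apply: (measurable_fcomp mF); meas.
Qed.

Let msel j : measurable_fun setT (sel j).
Proof. by rewrite /sel; have h := mAvg j; meas. Qed.

Let mtau : measurable_fun setT tau.
Proof. exact: (measurable_find (a := sel)). Qed.

Let mS : measurable_fun setT S.
Proof. exact: (measurable_fun_select mtau msel). Qed.

Let mlen : measurable_fun setT len.
Proof. exact: (measurable_fun_select (G := fun j _ => l j) mtau (fun j => measurable_cst _)). Qed.

Let mtau1 : measurable_fun setT (fun q : (R * R) * (R * R) => tau q.1).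
Proof. by apply: (measurable_fcomp mtau); meas. Qed.

Let mP : measurable_fun setT (fun q : (R * R) * (R * R) => P q.1 q.2).
Proof.
apply: (measurable_fun_select (G := fun j (q : (R * R) * (R * R)) => if same (l j) q.1 q.2 then (l j ^+ 2)^-1 else 0) mtau1).
by move=> j; apply: measurable_fun_ifT; [exact: msame_l|exact: measurable_cst|exact: measurable_cst].
Qed.

Let P0 x y : 0 <= P x y.
Proof. by rewrite /P; case: ifP => // _; rewrite invr_ge0 sqr_ge0. Qed.

Let tau_le x : (tau x <= N)%N.
Proof. by rewrite -[leqRHS](size_iota 0) find_size. Qed.

Let same_le i j x y : (i <= j)%N -> same (l j) x y -> same (l i) x y.
Proof.
move=> ij; rewrite -(subnK ij); elim: (j - i)%N => [|m IH]//.
by rewrite addSn lS => /same_half.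
Qed.

Let Avg_same j x y : same (l j) x y -> Avg j x = Avg j y.
Proof. by move=> e; apply: eq_Rintegral => w _; rewrite (same_left w e). Qed.

(** Each level up to [tau x] is at least as coarse as the stopping cell of [x], so the selection
    tests at these levels agree at all its points. Hence the stopping cells partition the plane,
    which is what makes [P] symmetric. *)
Let tau_same x y : same (len x) x y -> tau y = tau x.
Proof.
move=> e; have selE i : (i <= tau x)%N -> sel i y = sel i x.
  by move=> ix; rewrite /sel (Avg_same (same_le ix e)).
apply: find_iota; first exact: tau_le.
  move=> i ix; rewrite selE ?(ltnW ix)//.
  by have := before_find 0 ix; rewrite nth_iota ?add0n ?(leq_trans ix)// => /negbT.
move=> xN; rewrite selE//.
have ha : has (sel^~ x) (iota 0 N) by rewrite has_find size_iota.
by have := nth_find 0 ha; rewrite nth_iota// add0n.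
Qed.

Let PC x y : P x y = P y x.
Proof.
rewrite /P; case: ifP => [e|ne].
  have t := tau_same e; rewrite /len t same_sym -/(len x).
  by rewrite e.
case: ifP => // e; have t := tau_same e.
by move: ne; rewrite /len t same_sym -/(len y) e.
Qed.

Let intP x : (\int[mu2]_y (P x y)%:E = 1)%E.
Proof.
rewrite /P integral_same// ?invr_ge0 ?sqr_ge0//.
by rewrite mulVf// expf_neq0// gt_eqF.
Qed.

Let mu4 := prodm (@mu2 R) (@mu2 R).
(** A density on pairs: the mass of [|f|] at [q.1] is coupled with a point [q.2] uniform in its
    stopping cell. Integrals over pairs play the role of the sum over the bad pieces. *)
Let Q (q : (R * R) * (R * R)) := P q.1 q.2 * F q.1.

Let mF1 : measurable_fun setT (fun q : (R * R) * (R * R) => F q.1).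
Proof. by apply: (measurable_fcomp mF); meas. Qed.
Let mQ : measurable_fun setT Q. Proof. by apply: measurable_funM. Qed.
Let Q0 q : 0 <= Q q. Proof. by rewrite mulr_ge0. Qed.

Let intPF x : (\int[mu2]_y (P x y * F x)%:E = (F x)%:E)%E.
Proof.
under eq_integral => y _ do rewrite mulrC.
rewrite ge0_integralZ//; last first.
  by apply: (measurable_fcomp (f := fun q : (R * R) * (R * R) => P q.1 q.2) (g := fun y => (x, y))) => //; meas.
by rewrite intP mule1.
Qed.

Let intQE : (\int[mu4]_q (Q q)%:E = Nf%:E)%E.
Proof.
rewrite tonelli1// -NfE; apply: eq_integral => x _; exact: intPF.
Qed.

Let iQ : mu4.-integrable setT (EFin \o Q).
Proof.
apply: integrable_ltyP => //; under eq_integral => q _ do rewrite ger0_norm//.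
by rewrite intQE ltry.
Qed.

Let iAvg j x : mu2.-integrable setT (EFin \o (fun y => if same (l j) x y then F y else 0)).
Proof.
refine (@integrable_le _ _ _ mu2 _ F _ intF _).
  apply: measurable_fun_ifT; [|exact: mF|exact: measurable_cst].
  by apply: measurable_same; meas.
by move=> y; case: ifP => _; rewrite ?normr0 ?(ger0_norm (F0 y)).
Qed.

Let AvgE j x : (\int[mu2]_y (if same (l j) x y then F y else 0)%:E = (Avg j x)%:E)%E.
Proof. by rewrite /Avg /Rintegral fineK//; apply: integrable_fin_num => //; exact: iAvg. Qed.

Let Avg_le_Nf j x : Avg j x <= Nf.
Proof.
by apply: le_Rintegral => // y _; case: ifP.
Qed.

Let AvgS_le j x : Avg j.+1 x <= Avg j x.
Proof.
apply: le_Rintegral => // y _.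
by case: ifP => [e|_]; [rewrite (same_le (leqnSn j) e)|case: ifP].
Qed.

(** Either the cell itself is not selected, or its parent is not, and the parent has four times the
    area. *)
Let Avg_tau x : Avg (tau x) x <= 4 * lam * len x ^+ 2.
Proof.
have [|] := boolP (sel (tau x) x); last first.
  rewrite /sel -leNgt => /le_trans; apply.
  rewrite -mulrA; apply: ler_peMl; last by rewrite ler1n.
  by rewrite mulr_ge0 ?sqr_ge0 ?(ltW lam0).
rewrite /len; case E : (tau x) => [|j] sj.
  (* A selected cell has a parent: level 0 is excluded by the choice of [l0]. *)
  by move: sj; rewrite /sel ltNge (le_trans (Avg_le_Nf _ _) Nf_le).
have jt : (j < tau x)%N by rewrite E.
have := before_find 0 jt; rewrite nth_iota ?add0n; last first.
  by rewrite (leq_trans jt)// tau_le.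
rewrite /sel => /negbT; rewrite -leNgt => h.
apply: (le_trans (AvgS_le _ _)); apply: (le_trans h).
by rewrite lS le_eqVlt; apply/orP; left; apply/eqP; field.
Qed.

Let mPF y : measurable_fun setT (fun x => P x y * f x).
Proof.
apply: measurable_funM; last exact: mf.
by apply: (measurable_fcomp (f := fun q : (R * R) * (R * R) => P q.1 q.2) (g := fun x => (x, y))) => //; meas.
Qed.

Let g_le y : (`|g y|%:E <= \int[mu2]_x (P x y * F x)%:E)%E.
Proof.
apply: (le_trans (le_normr_RintegralE mu2 (mPF y))).
by apply: le_integral_any => x; rewrite lee_fin// normrM (ger0_norm (P0 _ _)).
Qed.

Let g_bound y : `|g y| <= 4 * lam.
Proof.
rewrite -lee_fin; apply: (le_trans (g_le y)).
have -> : (\int[mu2]_x (P x y * F x)%:E = ((len y ^+ 2)^-1 * Avg (tau y) y)%:E)%E.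
  rewrite EFinM -AvgE -ge0_integralZ//.
  - apply: eq_integral => x _; rewrite PC /P; congr EFin.
    by case: ifP => _; rewrite ?mul0r ?mulr0.
  - by rewrite invr_ge0 sqr_ge0.
  - have /measurable_EFinP := measurable_int _ (iAvg (tau y) y); exact.
  - by move=> x; case: ifP.
rewrite lee_fin mulrC ler_pdivrMr ?exprn_gt0//; exact: Avg_tau.
Qed.

Let mg : measurable_fun setT g.
Proof.
apply: (@measurable_Rintegral _ _ _ _ R mu2 (fun q : (R * R) * (R * R) => P q.2 q.1 * f q.2)).
apply: measurable_funM; last by apply: (measurable_fcomp mf); meas.
by apply: (measurable_fcomp (f := fun q : (R * R) * (R * R) => P q.1 q.2) (g := fun q => (q.2, q.1))) => //; meas.
Qed.

Let int_g : (\int[mu2]_y `|g y|%:E <= Nf%:E)%E.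
Proof.
rewrite -intQE (@tonelli2 _ _ _ _ R mu2 mu2 Q mQ Q0).
refine (@le_integral_any R _ _ mu2 _ _ _ _) => y; [by []|exact: g_le].
Qed.

Let ig : mu2.-integrable setT (EFin \o g).
Proof. by apply: integrable_ltyP => //; rewrite (le_lt_trans int_g)// ltry. Qed.

Let int_g2 : (\int[mu2]_y (g y ^+ 2)%:E <= (4 * lam * Nf)%:E)%E.
Proof.
apply: (@le_trans _ _ (\int[mu2]_y (4 * lam * `|g y|)%:E)%E).
  apply: le_integral_any => y; rewrite lee_fin ?sqr_ge0//.
  by rewrite -real_normK ?num_real// expr2 ler_wpM2r.
rewrite ge0_integralZ//; last 2 first.
- by rewrite mulr_ge0// ltW.
- by apply: measurableT_comp => //; exact: mg.
rewrite (EFinM (4 * lam) Nf); apply: lee_wpmul2l => //.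
by rewrite lee_fin mulr_ge0// ltW.
Qed.

Let len_sup x y : P x y != 0 -> supn (y - x) <= len x.
Proof.
by rewrite /P; case: ifP => [e _|]; [rewrite supnB; exact: same_supn|rewrite eqxx].
Qed.

Let iK (h : R * R -> R) z : mu2.-integrable setT (EFin \o h) ->
  mu2.-integrable setT (EFin \o (fun x => K (z - x) * h x)).
Proof.
move=> ih; have mKz : measurable_fun setT (fun x => K (z - x)).
  by apply: (measurable_fcomp mK); meas.
have := integrable_rMbd ih mKz (fun x => K_bound (z - x)).
by apply: eq_integrable => // x _ /=; rewrite mulrC.
Qed.

Let D z q := `|K (z - q.1) - K (z - q.2)|.

(** Since [P] has mass 1 in each variable, [T f z] and [T g z] are integrals of the same density
    over pairs, with [K] taken at [z - q.1] for the former and at [z - q.2] for the latter. Their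
    difference carries the cancellation of the bad part. *)
Let T_sub z : (`|T f z - T g z|%:E <= \int[mu4]_q (D z q * Q q)%:E)%E.
Proof.
have mK1 : measurable_fun setT (fun q : (R * R) * (R * R) => K (z - q.1)).
  by apply: (measurable_fcomp mK); meas.
have mK2 : measurable_fun setT (fun q : (R * R) * (R * R) => K (z - q.2)).
  by apply: (measurable_fcomp mK); meas.
have mf1 : measurable_fun setT (fun q : (R * R) * (R * R) => f q.1).
  by apply: (measurable_fcomp mf); meas.
have mPf : measurable_fun setT (fun q : (R * R) * (R * R) => P q.1 q.2 * f q.1).
  by apply: measurable_funM.
have iPf : mu4.-integrable setT (EFin \o (fun q : (R * R) * (R * R) => P q.1 q.2 * f q.1)).
  refine (@integrable_le _ _ _ mu4 _ Q mPf iQ _) => q.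
  by rewrite normrM (ger0_norm (P0 _ _)).
have i1 := integrable_rMbd iPf mK1 (fun q => K_bound (z - q.1)).
have i2 := integrable_rMbd iPf mK2 (fun q => K_bound (z - q.2)).
have iPx x : mu2.-integrable setT (EFin \o P x).
  apply: integrable_ltyP.
    by apply: (measurable_fcomp (f := fun q : (R * R) * (R * R) => P q.1 q.2) (g := fun y => (x, y))) => //; meas.
  under eq_integral => y _ do rewrite (ger0_norm (P0 _ _)).
  by rewrite intP ltry.
have iPy y : mu2.-integrable setT (EFin \o (fun x => P x y * f x)).
  apply: integrable_ltyP; first exact: mPF.
  under eq_integral => x _ do rewrite normrM (ger0_norm (P0 _ _)).
  rewrite -[X in (X < _)%E]/(\int[mu2]_x (P x y * F x)%:E)%E.
  have -> : (\int[mu2]_x (P x y * F x)%:E = ((len y ^+ 2)^-1 * Avg (tau y) y)%:E)%E.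
    rewrite EFinM -AvgE -ge0_integralZ//.
    - apply: eq_integral => x _; rewrite PC /P; congr EFin.
      by case: ifP => _; rewrite ?mul0r ?mulr0.
    - by rewrite invr_ge0 sqr_ge0.
    - have /measurable_EFinP := measurable_int _ (iAvg (tau y) y); exact.
    - by move=> x; case: ifP.
  exact: ltry.
have Tf : T f z = \int[mu4]_q (P q.1 q.2 * f q.1 * K (z - q.1)).
  rewrite -(Rintegral_fubini1 i1); apply: eq_Rintegral => x _ /=.
  under [RHS]eq_Rintegral => y _ do rewrite -mulrA mulrC.
  rewrite (RintegralZl (f x * K (z - x)) measurableT (iPx x)).
  have -> : \int[mu2]_y P x y = 1 by rewrite /Rintegral intP.
  by rewrite mulr1 mulrC.
have Tg : T g z = \int[mu4]_q (P q.1 q.2 * f q.1 * K (z - q.2)).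
  rewrite -(Rintegral_fubini2 i2); apply: eq_Rintegral => y _ /=.
  by rewrite (RintegralZr (K (z - y)) measurableT (iPy y)) mulrC.
rewrite Tf Tg -RintegralB//.
apply: (le_trans (le_normr_RintegralE _ _)).
  by apply: measurable_funB; apply: measurable_funM.
apply: le_integral_any => q; rewrite lee_fin// -mulrBr normrM mulrC.
by rewrite [`|P _ _ * _|]normrM (ger0_norm (P0 _ _)).
Qed.

(* [Phi >= 1] on the dilated stopping cells, so its integral bounds the measure of
   their union without any sum over cells. *)
Let Phi_fun z x :=
  if S x && (supn (z - x) <= (4 * kk + 1) * len x) then F x / (lam * len x ^+ 2) else 0.
Let Phi z := (\int[mu2]_x (Phi_fun z x)%:E)%E.
(** The contribution of selected cells far from [z], the only one to which the Hormander condition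
    is applied. *)
Let H_fun z (q : (R * R) * (R * R)) :=
  if S q.1 && (4 * kk * len q.1 < supn (z - q.1)) then D z q * Q q else 0.
Let H z := (\int[mu4]_q (H_fun z q)%:E)%E.

Let Phi_fun0 z x : 0 <= Phi_fun z x.
Proof.
by rewrite /Phi_fun; case: ifP => // _; rewrite divr_ge0// mulr_ge0 ?sqr_ge0// ltW.
Qed.

Let H_fun0 z q : 0 <= H_fun z q.
Proof. by rewrite /H_fun; case: ifP => // _; rewrite mulr_ge0// normr_ge0. Qed.

Let mS_ d (T' : measurableType d) (h : T' -> R * R) :
  measurable_fun setT h -> measurable_fun setT (fun t => S (h t)).
Proof. by move=> mh; apply: (measurable_fcomp mS). Qed.

Let mlen_ d (T' : measurableType d) (h : T' -> R * R) :
  measurable_fun setT h -> measurable_fun setT (fun t => len (h t)).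
Proof. by move=> mh; apply: (measurable_fcomp mlen). Qed.

Let mF_ d (T' : measurableType d) (h : T' -> R * R) :
  measurable_fun setT h -> measurable_fun setT (fun t => F (h t)).
Proof. by move=> mh; apply: (measurable_fcomp mF). Qed.

Let mPhi_fun : measurable_fun setT (fun p : (R * R) * (R * R) => Phi_fun p.1 p.2).
Proof.
rewrite /Phi_fun; apply: measurable_fun_ifT; last exact: measurable_cst.
  apply: measurable_and; first by apply: mS_; meas.
  apply: measurable_fun_ler; first by apply: measurable_supn; meas.
  by apply: measurable_funM; [exact: measurable_cst|apply: mlen_; meas].
apply: measurable_funM; first by apply: mF_; meas.
apply: measurable_funV; apply: measurable_funM; first exact: measurable_cst.
by apply: measurable_funX; apply: mlen_; meas.
Qed.

Let mH_fun : measurable_fun setT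
  (fun p : (R * R) * ((R * R) * (R * R)) => H_fun p.1 p.2).
Proof.
rewrite /H_fun; apply: measurable_fun_ifT; last exact: measurable_cst.
  apply: measurable_and; first by apply: mS_; meas.
  apply: measurable_fun_ltr; last by apply: measurable_supn; meas.
  by apply: measurable_funM; [exact: measurable_cst|apply: mlen_; meas].
apply: measurable_funM; last by apply: (measurable_fcomp mQ); meas.
apply: measurable_funnormr; apply: measurable_funB; apply: (measurable_fcomp mK); meas.
Qed.

Let S_same x y : same (len x) x y -> S x -> S y.
Proof. by move=> e; rewrite /S (tau_same e) /sel (Avg_same e). Qed.

(** Every [y] in the cell of [x] is within [(4 * kk + 1) * len x] of [z], which explains the [+ 1]
    in [Phi_fun]; the integral of [F] over that selected cell exceeds [lam * len x ^+ 2]. *)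
Let Phi_ge1 z x : S x -> supn (z - x) <= 4 * kk * len x -> (1 <= Phi z)%E.
Proof.
move=> Sx zx; have c0 : 0 < lam * len x ^+ 2 by rewrite mulr_gt0// exprn_gt0.
have h : (((lam * len x ^+ 2)^-1 * Avg (tau x) x)%:E <= Phi z)%E.
  rewrite EFinM -AvgE -ge0_integralZ; first last.
  - by move=> y; case: ifP.
  - have /measurable_EFinP := measurable_int _ (iAvg (tau x) x); exact.
  - by rewrite invr_ge0 ltW.
  apply: le_integral_any => y.
    by rewrite lee_fin mulr_ge0 ?invr_ge0 ?(ltW c0)//; case: ifP.
  rewrite lee_fin; case: ifP => [e|_]; last by rewrite mulr0.
  rewrite /Phi_fun (S_same e Sx) {2 3}/len (tau_same e) -/(len x).
  have -> : supn (z - y) <= (4 * kk + 1) * len x.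
    have -> : z - y = (z - x) + (x - y) by rewrite addrA subrK.
    by rewrite (le_trans (supnD _ _))// mulrDl mul1r lerD// same_supn.
  by rewrite mulrC.
apply: le_trans h; rewrite lee_fin mulrC ler_pdivlMr// mul1r ltW//; exact: Sx.
Qed.

Let measurable_ball x (r : R) : measurable [set z | supn (z - x) <= r].
Proof.
have -> : [set z | supn (z - x) <= r] = (fun z => supn (z - x) <= r) @^-1` [set true].
  by apply/seteqP; split => z /=.
rewrite -[X in measurable X]setTI.
have : measurable_fun [set: R * R] (fun z => supn (z - x) <= r).
  by apply: measurable_fun_ler; [apply: measurable_supn; meas|exact: measurable_cst].
by apply.
Qed.

(** For fixed [x] the admissible [z] form a square of area [4 * (4 * kk + 1) ^+ 2 * len x ^+ 2], at
    most [100 * kk ^+ 2 * len x ^+ 2] as [kk >= 1]; dividing by [lam = kk * alpha] leaves one power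
    of [kk]. *)
Let int_Phi : (\int[mu2]_z Phi z <= (100 * kk / alpha)%:E * Nf%:E)%E.
Proof.
rewrite -[leLHS](@tonelli1 _ _ _ _ R mu2 mu2 _ mPhi_fun (fun p => Phi_fun0 _ _)).
rewrite (@tonelli2 _ _ _ _ R mu2 mu2 _ mPhi_fun (fun p => Phi_fun0 _ _)) /=.
rewrite -NfE -ge0_integralZ//; last by rewrite divr_ge0 ?mulr_ge0 ?(ltW kk0) ?(ltW alpha0).
apply: le_integral_any => x; first by apply: integral_ge0 => z _; rewrite lee_fin.
pose r := (4 * kk + 1) * len x.
have r0 : 0 <= r by rewrite mulr_ge0 ?(ltW (len0 _))// addr_ge0// mulr_ge0// (ltW kk0).
pose c := F x / (lam * len x ^+ 2).
have c0 : 0 <= c by rewrite divr_ge0// mulr_ge0 ?sqr_ge0// ltW.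
have mI : measurable_fun [set: R * R] (\1_[set z | supn (z - x) <= r] : R * R -> R).
  by apply: measurable_indic; exact: measurable_ball.
apply: (@le_trans _ _ (\int[mu2]_z (c * \1_[set z | supn (z - x) <= r] z)%:E)%E).
  apply: le_integral_any => z; rewrite lee_fin// /Phi_fun indicE.
  case: ifP => [/andP[_ h]|_]; last by rewrite mulr_ge0.
  by rewrite mem_set// mulr1.
rewrite ge0_integralZ// integral_indic//; last exact: measurable_ball.
rewrite setIT; have e := leb2_supn_ball x r0; set Bx := [set z | supn (z - x) <= r] in e *.
apply: (@le_trans _ _ (c%:E * mu2 Bx)%E); first by [].
rewrite e.
rewrite -EFinM lee_fin /c /r.
have -> : F x / (lam * len x ^+ 2) * (2 * ((4 * kk + 1) * len x)) ^+ 2 = 4 * (4 * kk + 1) ^+ 2 / lam * F x.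
  by field; rewrite !gt_eqF.
rewrite ler_wpM2r// ler_pdivrMr// /lam.
have -> : 100 * kk / alpha * (kk * alpha) = 100 * kk ^+ 2 by field; rewrite gt_eqF.
have -> : 100 * kk ^+ 2 = 4 * (5 * kk) ^+ 2 by ring.
rewrite ler_wpM2l//; apply: lerXn2r; rewrite ?nnegrE ?addr_ge0 ?mulr_ge0 ?(ltW kk0)//.
have -> : 5 * kk = 4 * kk + kk by ring.
by rewrite lerD2l.
Qed.

(** Integrating in [z] before the pairs and translating by [q.1] leaves the Hormander integral with
    increment [q.2 - q.1], whose sup norm is at most the mesh of the cell. *)
Let int_H : (\int[mu2]_z H z <= (A * kk)%:E * Nf%:E)%E.
Proof.
rewrite -[leLHS](@tonelli1 _ _ _ _ R mu2 mu4 _ mH_fun (fun p => H_fun0 _ _)).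
rewrite (@tonelli2 _ _ _ _ R mu2 mu4 _ mH_fun (fun p => H_fun0 _ _)) /=.
rewrite -intQE -ge0_integralZ//; last by rewrite mulr_ge0// (ltW kk0).
refine (@le_integral_any R _ _ mu4 (fun q => \int[mu2]_z (H_fun z q)%:E)%E (fun q => (A * kk * Q q)%:E) _ _) => q; first by apply: integral_ge0 => z _; rewrite lee_fin.
have [Pq|Pq] := eqVneq (P q.1 q.2) 0.
  rewrite integral0_eq; first by rewrite lee_fin mulr_ge0// mulr_ge0// (ltW kk0).
  by move=> z _; rewrite /H_fun /Q Pq mul0r mulr0; case: ifP.
have hl := len_sup Pq.
have mK' h : measurable_fun setT (fun w => K (w - h)) by apply: (measurable_fcomp mK); meas.
pose G w := if (4 * kk * len q.1 < supn w)%R then `|K w - K (w - (q.2 - q.1))| else 0.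
have mG : measurable_fun setT G.
  apply: measurable_fun_ifT; last exact: measurable_cst.
    by apply: measurable_fun_ltr; [exact: measurable_cst|apply: measurable_supn; meas].
  by apply: measurable_funnormr; apply: measurable_funB; [exact: mK|exact: mK'].
have G0 w : 0 <= G w by rewrite /G; case: ifP.
apply: (@le_trans _ _ (\int[mu2]_z (Q q * G (z - q.1)%R)%:E)%E).
  apply: le_integral_any => z; rewrite lee_fin// /H_fun /G.
  have -> : z - q.1 - (q.2 - q.1) = z - q.2 by rewrite opprB addrA subrK.
  case: (S q.1) => /=; last by rewrite mulr_ge0//; case: ifP.
  by case: ifP => _; rewrite ?mulr0// mulrC.
rewrite ge0_integralZ//; last by apply: (measurable_fcomp mG); meas.
rewrite (ge0_integral_shift2 (g := EFin \o G))//; first last.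
  exact/measurable_EFinP.
rewrite [A * kk * Q q]mulrC (EFinM (Q q) (A * kk)); apply: lee_wpmul2l; first by rewrite lee_fin.
exact: K_hormander (len0 _) hl.
Qed.

Let mT (h : R * R -> R) : measurable_fun setT h -> measurable_fun setT (T h).
Proof.
move=> mh; apply: (@measurable_Rintegral _ _ _ _ R mu2 (fun q : (R * R) * (R * R) => K (q.1 - q.2) * h q.2)).
by apply: measurable_funM; [apply: (measurable_fcomp mK)|apply: (measurable_fcomp mh)]; meas.
Qed.

(** When [Phi z < 1], [z] is outside every dilated selected cell, so pairs in selected cells are
    counted in [H]. The remaining pairs lie in cells of level [N], where the Lipschitz bound gives
    at most [L * l N * Nf]. *)
Let T_le z : (Phi z < 1)%E -> (`|T f z|%:E <= `|T g z|%:E + H z + (alpha / 3)%:E)%E.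
Proof.
move=> Pz; have h1 : (`|T f z|%:E <= `|T g z|%:E + `|T f z - T g z|%:E)%E.
  rewrite -EFinD lee_fin; apply: le_trans (ler_normD _ _).
  by rewrite addrC subrK.
have LN : 0 <= L * l N by apply: mulr_ge0 => //; exact: ltW (lj0 N).
apply: (le_trans h1); rewrite -addeA leeD2l//; apply: (le_trans (T_sub z)).
have mHz : measurable_fun setT (H_fun z).
  by apply: (measurable_fcomp (f := fun p => H_fun p.1 p.2) (g := fun q => (z, q))) => //; meas.
apply: (@le_trans _ _ (\int[mu4]_q (H_fun z q + L * l N * Q q)%:E)%E).
  apply: le_integral_any => q; rewrite lee_fin; first by rewrite mulr_ge0// normr_ge0.
  have LN0 : 0 <= L * l N * Q q by rewrite mulr_ge0.
  have [Pq|Pq] := eqVneq (P q.1 q.2) 0.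
    by rewrite {1}/Q Pq mul0r mulr0 addr_ge0.
  have hl := len_sup Pq; rewrite /H_fun.
  have [Sq|Sq] := boolP (S q.1) => /=.
    have -> : 4 * kk * len q.1 < supn (z - q.1).
      rewrite ltNge; apply/negP => h.
      by have := Phi_ge1 Sq h; rewrite leNgt Pz.
    by rewrite lerDl.
  rewrite add0r ler_wpM2r//.
  have tN : tau q.1 = N.
    apply/eqP; rewrite eqn_leq tau_le leqNgt; apply/negP => tN.
    have ha : has (sel^~ q.1) (iota 0 N) by rewrite has_find size_iota.
    have := nth_find 0 ha; rewrite nth_iota ?add0n; last exact: tN.
    by apply/negP; exact: Sq.
  have := K_lip (z - q.1) (q.2 - q.1).
  have -> : z - q.1 - (q.2 - q.1) = z - q.2 by rewrite opprB addrA subrK.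
  move=> /le_trans; apply; rewrite ler_wpM2l//.
  by move: hl; rewrite /len tN.
rewrite ge0_integral_rD//; last 2 first.
- by apply: measurable_funM => //; exact: measurable_cst.
- by move=> q; rewrite mulr_ge0.
rewrite leeD2l// ge0_integralZ//.
by rewrite intQE -EFinM lee_fin.
Qed.

(** In the constant, [36 * A] comes from Chebyshev for [T g] (9 from the height [alpha / 3], 4 from
    the bound on [g]), [3 * A] from Chebyshev for [H], and 100 from the dilated cells. *)
Theorem calderon_zygmund_weak :
  (leb2 [set z | (alpha < `|\int[mu2]_y (K (z - y) * f y)|)%R] <=
   ((39 * A + 100) * kk / alpha)%:E * \int[mu2]_x `|f x|%:E)%E.
Proof.
have -> : (\int[mu2]_x `|f x|%:E = Nf%:E)%E by exact: NfE.
pose E1 := [set z | alpha / 3 < `|T g z|].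
pose E2 := [set z | (1 <= Phi z)%E].
pose E3 := [set z | ((alpha / 3)%:E <= H z)%E].
have mTg := mT mg.
have mPhi : measurable_fun setT Phi.
  exact: (@measurable_integral1 _ _ _ _ R mu2 _ mPhi_fun (fun p => Phi_fun0 _ _)).
have mH : measurable_fun setT H.
  exact: (@measurable_integral1 _ _ _ _ R mu4 _ mH_fun (fun p => H_fun0 _ _)).
have mE1 : measurable E1.
  have -> : E1 = (fun z => alpha / 3 < `|T g z|) @^-1` [set true].
    by apply/seteqP; split => z /=.
  rewrite -[X in measurable X]setTI.
  have : measurable_fun [set: R * R] (fun z => alpha / 3 < `|T g z|).
    by apply: measurable_fun_ltr; [exact: measurable_cst|apply: measurable_funnormr].
  by apply.
have mE2 : measurable E2.
  by rewrite -[X in measurable X]setTI; exact: emeasurable_fun_c_infty.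
have mE3 : measurable E3.
  by rewrite -[X in measurable X]setTI; exact: emeasurable_fun_c_infty.
have a3 : 0 < alpha / 3 by rewrite divr_gt0.
have m1 : (mu2 E1 <= (36 * A * kk / alpha)%:E * Nf%:E)%E.
  have a32 : 0 < (alpha / 3) ^+ 2 by rewrite exprn_gt0.
  apply: (le_trans (@chebyshev_le _ _ _ mu2 (fun z => (T g z ^+ 2)%:E) _ _ mE1 a32 _ _)).
  - by move=> z; rewrite lee_fin sqr_ge0.
  - move=> z; rewrite /E1 /= lee_fin => h; rewrite -[leRHS]real_normK ?num_real//.
    by apply: lerXn2r; rewrite ?nnegrE ?(ltW a3) ?(ltW h).
  apply: (@le_trans _ _ (((alpha / 3) ^- 2)%:E * (A%:E * (4 * lam * Nf)%:E))%E).
    rewrite lee_wpmul2l ?lee_fin ?invr_ge0 ?sqr_ge0//.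
    by apply: (le_trans (K_L2 ig)); rewrite lee_wpmul2l.
  rewrite -!EFinM lee_fin le_eqVlt; apply/orP; left; apply/eqP.
  by rewrite /lam; move: (Nf) => M; field; rewrite gt_eqF.
have m2 : (mu2 E2 <= (100 * kk / alpha)%:E * Nf%:E)%E.
  apply: (le_trans (@chebyshev_le _ _ _ mu2 Phi _ _ mE2 ltr01 _ _)) => //.
    by move=> z; apply: integral_ge0 => x _; rewrite lee_fin.
  by rewrite invr1 mul1e.
have m3 : (mu2 E3 <= (3 * A * kk / alpha)%:E * Nf%:E)%E.
  apply: (le_trans (@chebyshev_le _ _ _ mu2 H _ _ mE3 a3 _ _)) => //.
    by move=> z; apply: integral_ge0 => x _; rewrite lee_fin.
  apply: (@le_trans _ _ ((alpha / 3)^-1%:E * ((A * kk)%:E * Nf%:E))%E).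
    by rewrite lee_wpmul2l// lee_fin invr_ge0 ltW.
  rewrite -!EFinM lee_fin le_eqVlt; apply/orP; left; apply/eqP.
  by move: (Nf) => M; field; rewrite gt_eqF.
apply: (@le_trans _ _ (leb2 (E1 `|` (E2 `|` E3)))).
  apply: le_leb2 => z /=; rewrite -[X in alpha < `|X|]/(T f z) => az.
  have [h1|h1] := ltP (alpha / 3) `|T g z|; first by left.
  right; have [h2|h2] := leP 1%E (Phi z); first by left.
  right; rewrite /E3 /= leNgt; apply/negP => h3.
  have := T_le h2; have h13 : (`|T g z|%:E <= (alpha / 3)%:E)%E by rewrite lee_fin.
  apply/negP; rewrite -ltNge.
  apply: (@lt_trans _ _ ((alpha / 3)%:E + (alpha / 3)%:E + (alpha / 3)%:E)%E); last first.
    by rewrite -!EFinD lte_fin; move: az; lra.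
  by rewrite lteD2rE// lee_ltD.
apply: (@le_trans _ _ (mu2 E1 + (mu2 E2 + mu2 E3))%E).
  apply: (le_trans (measureU2 mu2 mE1 (measurableU _ _ mE2 mE3))).
  by rewrite leeD2l// measureU2.
apply: (le_trans (leeD m1 (leeD m2 m3))).
rewrite -!EFinM -!EFinD lee_fin le_eqVlt; apply/orP; left; apply/eqP.
by move: (Nf) => M; field; rewrite gt_eqF.
Qed.

End calderon_zygmund.

(** * Regularity of the kernel *)

Local Open Scope complex_scope.

Section power_difference.
Variable C : numDomainType.
Implicit Types (a u p q d : C).

Lemma normr_pow_sub_le u v k : `|u| <= 1 -> `|v| <= 1 ->
  `|u ^+ k - v ^+ k| <= k%:R * `|u - v|.
Proof.
move=> u1 v1; rewrite subrXX normrM mulrC ler_wpM2r//.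
apply: (le_trans (ler_norm_sum _ _ _)); rewrite -[leRHS]mulr_natl mulr1.
rewrite -[k in leRHS]card_ord -sum1_card natr_sum; apply: ler_sum => i _.
by rewrite normrM !normrX mulr_ile1// exprn_ile1.
Qed.

(** The products [a * p] and [a' * p'] have modulus at most 1, so the difference of their powers
    costs only a factor [k]; the two remaining powers of [p] are compared separately and cost
    nothing in [k]. *)
Lemma damped_pow_sub_le a a' p p' d k : 0 <= p -> 0 <= p' ->
  `|a| * p <= 1 -> `|a'| * p' <= 1 -> `|a - a'| <= d -> `|p - p'| <= d * p * p' ->
  `|a ^+ k * p ^+ k.+2 - a' ^+ k * p' ^+ k.+2| <=
  2 * k%:R * d * p ^+ 3 + d * p * p' * (p + p').
Proof.
move=> p0 p'0 ap ap' ad pd.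
have d0 : 0 <= d := le_trans (normr_ge0 _) ad.
set u := a * p; set v := a' * p'.
have u1 : `|u| <= 1 by rewrite normrM (ger0_norm p0).
have v1 : `|v| <= 1 by rewrite normrM (ger0_norm p'0).
have uv : `|u - v| <= 2 * d * p.
  have -> : u - v = (a - a') * p + a' * (p - p') by rewrite /u /v; ring.
  have -> : 2 * d * p = d * p + d * p by ring.
  apply: (le_trans (ler_normD _ _)); apply: lerD.
    by rewrite normrM (ger0_norm p0) ler_wpM2r.
  rewrite normrM; apply: (le_trans (ler_wpM2l (normr_ge0 _) pd)).
  rewrite (_ : `|a'| * (d * p * p') = (d * p) * (`|a'| * p')); last by ring.
  by rewrite ler_piMr// mulr_ge0.
have -> : a ^+ k * p ^+ k.+2 - a' ^+ k * p' ^+ k.+2 =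
    (u ^+ k - v ^+ k) * p ^+ 2 + v ^+ k * ((p - p') * (p + p')).
  by rewrite /u /v !exprMn -addn2 !exprD; ring.
apply: (le_trans (ler_normD _ _)); apply: lerD.
  rewrite normrM (ger0_norm (exprn_ge0 2 p0)) (_ : 2 * _ * _ * _ = k%:R * (2 * d * p) * p ^+ 2); last by ring.
  apply: ler_wpM2r; first exact: exprn_ge0.
  by apply: (le_trans (normr_pow_sub_le k u1 v1)); apply: ler_wpM2l.
rewrite normrM -[leRHS]mul1r; apply: ler_pM => //.
  by rewrite normrX exprn_ile1.
by rewrite normrM (ger0_norm (addr_ge0 p0 p'0)) ler_wpM2r// addr_ge0.
Qed.

End power_difference.

Section kernel_regularity.
Context {R : realType}.
Local Notation mu := (@lebesgue_measure R).
Implicit Types (w x y z h : R * R) (d p : R).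

Definition cbar x : R[i] := x.1 -i* x.2.
Definition nrm x : R := Num.sqrt (nrm2 x).

Lemma nrm_ge0 x : 0 <= nrm x. Proof. exact: sqrtr_ge0. Qed.

Lemma normr_cbar x : `|cbar x| = (nrm x)%:C.
Proof. by rewrite normc_def /= sqrrN. Qed.

Lemma cbar_pow k x : cbar x ^+ k = harm k 1 0 x +i* harm k 0 1 x.
Proof.
elim: k => [|k IHk]; first by rewrite expr0.
rewrite exprS IHk /= oppr0.
have -> : harm k (-1) 0 x = - harm k 1 0 x by rewrite -(oppr0 R) harmN oppr0.
rewrite /cbar; simpc; congr (_ +i* _); ring.
Qed.

Lemma harmE k c1 c2 x : harm k c1 c2 x = c1 * harm k 1 0 x + c2 * harm k 0 1 x.
Proof. by rewrite -!harmZ -harmD !mulr1 !mulr0 addr0 add0r. Qed.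

Lemma cbarB x y : cbar x - cbar y = cbar (x - y).
Proof. by rewrite /cbar; simpc; congr (_ +i* _); rewrite /=; ring. Qed.

Lemma nrm_sub_le x y : `|nrm x - nrm y| <= nrm (x - y).
Proof.
rewrite -lecR -normr_cbar -cbarB (le_trans _ (ler_dist_dist _ _))//.
by rewrite !normr_cbar -rmorphB normc_def /= expr0n addr0 sqrtr_sqr.
Qed.

Lemma supn_le_nrm x : supn x <= nrm x.
Proof.
rewrite supn_le; apply/andP; split; rewrite -sqrtr_sqr; apply: ler_wsqrtr;
  by rewrite /nrm2 ?lerDl ?lerDr sqr_ge0.
Qed.

Lemma nrm_le_supn x : nrm x <= 2 * supn x.
Proof.
have := lexx (supn x); rewrite supn_le => /andP[x1 x2].
have s0 := supn_ge0 x.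
rewrite -(@ger0_norm _ (2 * supn x)) ?mulr_ge0// -sqrtr_sqr; apply: ler_wsqrtr.
have h1 : x.1 ^+ 2 <= supn x ^+ 2 by rewrite -[x.1 ^+ 2]real_normK ?num_real// lerXn2r ?nnegrE.
have h2 : x.2 ^+ 2 <= supn x ^+ 2 by rewrite -[x.2 ^+ 2]real_normK ?num_real// lerXn2r ?nnegrE.
by rewrite /nrm2 exprMn; nra.
Qed.

Definition snrm (dl : R) x : R := Num.sqrt (nrm2 x + dl).

Lemma nrm_le_snrm dl x : 0 <= dl -> nrm x <= snrm dl x.
Proof. by move=> dl0; apply: ler_wsqrtr; rewrite lerDl. Qed.

Lemma snrm_sub_le dl x y : 0 <= dl -> 0 < snrm dl x -> `|snrm dl x - snrm dl y| <= nrm (x - y).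
Proof.
move=> dl0 s0; apply: le_trans (nrm_sub_le x y).
have s'0 : 0 <= snrm dl y by exact: sqrtr_ge0.
have S0 : 0 < snrm dl x + snrm dl y by rewrite ltr_wpDr.
rewrite -(ler_pM2r S0) -{1}(gtr0_norm S0) -normrM -subr_sqr.
have nd z : 0 <= nrm2 z + dl by rewrite addr_ge0// nrm2_ge0.
rewrite !sqr_sqrtr//.
have -> : nrm2 x + dl - (nrm2 y + dl) = (nrm x - nrm y) * (nrm x + nrm y).
  by rewrite -subr_sqr !sqr_sqrtr ?nrm2_ge0//; ring.
rewrite normrM (ger0_norm (addr_ge0 (nrm_ge0 x) (nrm_ge0 y))) ler_wpM2l//.
by apply: lerD; exact: nrm_le_snrm.
Qed.

Lemma kernE k c1 c2 dl x : kern k c1 c2 dl x = k%:R / (2 * pi) *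
  (c1 * complex.Re (cbar x ^+ k * ((snrm dl x)^-1)%:C ^+ k.+2) +
   c2 * complex.Im (cbar x ^+ k * ((snrm dl x)^-1)%:C ^+ k.+2)).
Proof.
rewrite /kern harmE cbar_pow -rmorphXn /=; congr (_ * _); rewrite /snrm.
by set p := _ ^+ k.+2; ring.
Qed.

Lemma Im_le_norm (z : R[i]) : `|complex.Im z|%:C <= `|z|.
Proof.
rewrite normc_def lecR -sqrtr_sqr; apply: ler_wsqrtr; by rewrite lerDr sqr_ge0.
Qed.

Lemma kern_sub_le k c1 c2 dl w w' : 0 <= dl -> `|c1| + `|c2| <= 1 ->
  0 < snrm dl w -> 0 < snrm dl w' ->
  `|kern k c1 c2 dl w - kern k c1 c2 dl w'| <= k%:R / (2 * pi) *
   (2 * k%:R * nrm (w - w') * (snrm dl w)^-1 ^+ 3 +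
    nrm (w - w') * (snrm dl w)^-1 * (snrm dl w')^-1 * ((snrm dl w)^-1 + (snrm dl w')^-1)).
Proof.
move=> dl0 c1c2 s0 s'0; set p := (snrm dl w)^-1; set p' := (snrm dl w')^-1; set d := nrm (w - w').
have p0 : 0 < p by rewrite invr_gt0.
have p'0 : 0 < p' by rewrite invr_gt0.
have ap x : 0 < snrm dl x -> `|cbar x| * ((snrm dl x)^-1)%:C <= 1.
  move=> sx; rewrite normr_cbar -rmorphM lecR ler_pdivrMr// mul1r; exact: nrm_le_snrm.
have pd : `|p%:C - p'%:C| <= d%:C * p%:C * p'%:C.
  rewrite -rmorphB normc_def /= expr0n addr0 sqrtr_sqr -!rmorphM lecR.
  have -> : p - p' = (snrm dl w' - snrm dl w) * (p * p').
    by rewrite /p /p'; field; rewrite !gt_eqF.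
  rewrite normrM (gtr0_norm (mulr_gt0 p0 p'0)) -mulrA ler_wpM2r ?(ltW (mulr_gt0 p0 p'0))//.
  by rewrite distrC; exact: snrm_sub_le.
have ad : `|cbar w - cbar w'| <= d%:C by rewrite cbarB normr_cbar.
have p0C : 0 <= p%:C by rewrite ler0c ltW.
have p'0C : 0 <= p'%:C by rewrite ler0c ltW.
have := damped_pow_sub_le k p0C p'0C (ap _ s0) (ap _ s'0) ad pd.
rewrite !kernE -/p -/p'; set X := cbar w ^+ k * _; set X' := cbar w' ^+ k * _.
have -> : 2 * k%:R * d%:C * p%:C ^+ 3 + d%:C * p%:C * p'%:C * (p%:C + p'%:C) =
    (2 * k%:R * d * p ^+ 3 + d * p * p' * (p + p'))%:C.
  by rewrite !(rmorphD, rmorphM, rmorphXn, rmorph_nat).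
set D := (X in X%:C) => XX.
have k0 : 0 <= k%:R / (2 * pi) :> R by rewrite divr_ge0// mulr_ge0// pi_ge0.
rewrite -mulrBr normrM (ger0_norm k0) ler_wpM2l//.
have -> : c1 * complex.Re X + c2 * complex.Im X - (c1 * complex.Re X' + c2 * complex.Im X') =
   c1 * complex.Re (X - X') + c2 * complex.Im (X - X').
  by case: X XX => a b; case: X' => a' b' _ /=; ring.
have hR : `|complex.Re (X - X')| <= D by rewrite -lecR (le_trans (normc_ge_Re _)).
have hI : `|complex.Im (X - X')| <= D by rewrite -lecR (le_trans (Im_le_norm _)).
have D0 : 0 <= D := le_trans (normr_ge0 _) hR.
apply: (le_trans (ler_normD _ _)); rewrite !normrM.
apply: (@le_trans _ _ ((`|c1| + `|c2|) * D)); last by rewrite ler_piMl.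
by rewrite mulrDl lerD// ler_wpM2l.
Qed.

(** Within half of [snrm dl w] the two regularised moduli are comparable up to 2. The second term of
    [kern_sub_le] is then at most 6 times the cubic term, which with the first one gives the factor
    8 hidden in [4 * k ^ 2 / pi]. The value [dl = 0] is allowed, for use in the lower bound. *)
Lemma kern_sub_far k c1 c2 dl w w' : (1 <= k)%N -> 0 <= dl -> `|c1| + `|c2| <= 1 ->
  0 < snrm dl w -> 2 * nrm (w - w') <= snrm dl w ->
  `|kern k c1 c2 dl w - kern k c1 c2 dl w'| <=
  4 * k%:R ^+ 2 / pi * (nrm (w - w') * (snrm dl w)^-1 ^+ 3).
Proof.
move=> k1 dl0 c1c2 s0 far.
have ss' : snrm dl w / 2 <= snrm dl w'.
  have := snrm_sub_le w' dl0 s0; rewrite ler_norml => /andP[_].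
  by move: (snrm dl w) (snrm dl w') (nrm _) far => a b c; lra.
have s'0 : 0 < snrm dl w' by rewrite (lt_le_trans _ ss')// divr_gt0.
apply: (le_trans (kern_sub_le k dl0 c1c2 s0 s'0)).
have pp' : (snrm dl w')^-1 <= 2 * (snrm dl w)^-1.
  by rewrite -[2]invrK -invfM lef_pV2 ?posrE ?mulr_gt0 ?invr_gt0// mulrC.
have p0 : 0 < (snrm dl w)^-1 by rewrite invr_gt0.
have p'0 : 0 < (snrm dl w')^-1 by rewrite invr_gt0.
have -> : 4 * k%:R ^+ 2 / pi * (nrm (w - w') * (snrm dl w)^-1 ^+ 3) =
  k%:R / (2 * pi) * (8 * k%:R * (nrm (w - w') * (snrm dl w)^-1 ^+ 3)).
  have := lt0r_neq0 (@pi_gt0 R); move: (pi : R) (nrm _) (snrm dl w)^-1 => p d q pn.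
  by field.
rewrite ler_wpM2l ?divr_ge0 ?mulr_ge0 ?pi_ge0//.
have kk : 1 <= k%:R :> R by rewrite ler1n.
have d0 := nrm_ge0 (w - w').
move: (nrm _) (snrm dl w)^-1 (snrm dl w')^-1 p0 p'0 pp' d0 (k%:R) kk => d p p' p0 p'0 pp' d0 K K1.
have p3 : 0 <= p ^+ 3 by rewrite exprn_ge0// ltW.
have h : d * p * p' * (p + p') <= 6 * (d * p ^+ 3).
  rewrite (_ : 6 * (d * p ^+ 3) = d * p * ((2 * p) * (3 * p))); last by ring.
  rewrite -(mulrA (d * p)) ler_wpM2l ?mulr_ge0 ?(ltW p0)//.
  by apply: ler_pM; rewrite ?addr_ge0 ?(ltW p0) ?(ltW p'0)//; lra.
have h2 : 6 * (d * p ^+ 3) <= 6 * K * (d * p ^+ 3).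
  by rewrite ler_wpM2r ?mulr_ge0//; lra.
lra.
Qed.

Lemma sqr_sum_le1 (c1 c2 : R) : `|c1| + `|c2| <= 1 -> c1 ^+ 2 + c2 ^+ 2 <= 1.
Proof.
move=> c1c2; apply: (@le_trans _ _ ((`|c1| + `|c2|) ^+ 2)).
  by rewrite sqrrD !real_normK ?num_real// lerD2r lerDl mulrn_wge0// mulr_ge0.
by rewrite exprn_ile1// addr_ge0.
Qed.

Section positive_regularization.
Variables (k : nat) (c1 c2 dl : R).
Hypotheses (k1 : (1 <= k)%N) (c1c2 : `|c1| + `|c2| <= 1) (dl0 : 0 < dl).

Let sdl0 : 0 < Num.sqrt dl. Proof. by rewrite sqrtr_gt0. Qed.

Let kpi : 0 <= k%:R / (2 * pi) :> R.
Proof. by rewrite divr_ge0// mulr_ge0// pi_ge0. Qed.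

Let sqrt_le_snrm x : Num.sqrt dl <= snrm dl x.
Proof. by apply: ler_wsqrtr; rewrite lerDr nrm2_ge0. Qed.

Let s0 x : 0 < snrm dl x. Proof. exact: lt_le_trans (sqrt_le_snrm x). Qed.

Let p_le x : (snrm dl x)^-1 <= (Num.sqrt dl)^-1.
Proof. by rewrite lef_pV2 ?posrE. Qed.

Lemma kern_bound w : `|kern k c1 c2 dl w| <= k%:R / (2 * pi) * (Num.sqrt dl)^-1 ^+ 2.
Proof.
have p0 : 0 <= (snrm dl w)^-1 by rewrite invr_ge0 ltW.
rewrite /kern -/(snrm dl w) normrM (ger0_norm kpi) ler_wpM2l//.
rewrite normrM (ger0_norm (exprn_ge0 _ p0)).
have cc := ler_wsqrtr (sqr_sum_le1 c1c2); rewrite sqrtr1 in cc.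
apply: (@le_trans _ _ (nrm w ^+ k * (snrm dl w)^-1 ^+ k.+2)).
  rewrite ler_wpM2r ?exprn_ge0// (le_trans (normr_harm_le _ _ _ _))//.
  by rewrite ler_piMl// exprn_ge0// sqrtr_ge0.
rewrite -addn2 exprD mulrA -exprMn -[leRHS]mul1r; apply: ler_pM.
- by rewrite exprn_ge0// mulr_ge0// nrm_ge0.
- exact: exprn_ge0.
- rewrite exprn_ile1//; first by rewrite mulr_ge0// nrm_ge0.
  by rewrite ler_pdivrMr// mul1r; apply: nrm_le_snrm; exact: ltW.
- by rewrite lerXn2r ?nnegrE// invr_ge0 ltW.
Qed.

Lemma kern_lip w h : `|kern k c1 c2 dl w - kern k c1 c2 dl (w - h)| <=
  k%:R / (2 * pi) * ((4 * k%:R + 4) * (Num.sqrt dl)^-1 ^+ 3) * supn h.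
Proof.
apply: (le_trans (kern_sub_le k (ltW dl0) c1c2 (s0 w) (s0 (w - h)))).
have wh : w - (w - h) = h by rewrite opprB addrC subrK.
rewrite -[leRHS]mulrA ler_wpM2l// wh.
have q1 := p_le w; have q2 := p_le (w - h).
have p0 : 0 <= (snrm dl w)^-1 by rewrite invr_ge0 ltW.
have p'0 : 0 <= (snrm dl (w - h))^-1 by rewrite invr_ge0 ltW.
have d2 := nrm_le_supn h; have d0 := nrm_ge0 h.
have K0 : 0 <= k%:R :> R by [].
move: (snrm dl w)^-1 (snrm dl (w - h))^-1 (Num.sqrt dl)^-1 q1 q2 p0 p'0 => p p' q q1 q2 p0 p'0.
move: (nrm h) (supn h) d2 d0 (k%:R) K0 => d s ds d0 K K0.
have q0 : 0 <= q := le_trans p0 q1.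
have p3 : p ^+ 3 <= q ^+ 3 by rewrite lerXn2r ?nnegrE.
have h1 : p * p' * (p + p') <= q * q * (q + q).
  by apply: ler_pM; rewrite ?mulr_ge0 ?addr_ge0//; [apply: ler_pM|apply: lerD].
apply: (@le_trans _ _ (2 * K * d * q ^+ 3 + d * (q * q * (q + q)))).
  apply: lerD; first by rewrite ler_wpM2l ?mulr_ge0.
  rewrite (_ : d * p * p' * (p + p') = d * (p * p' * (p + p'))); last by ring.
  exact: ler_wpM2l.
rewrite (_ : _ + _ = ((2 * K + 2) * q ^+ 3) * d); last by ring.
rewrite (_ : (4 * K + 4) * q ^+ 3 * s = ((2 * K + 2) * q ^+ 3) * (2 * s)); last by ring.
by rewrite ler_wpM2l// mulr_ge0 ?exprn_ge0// addr_ge0// mulr_ge0.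
Qed.

End positive_regularization.

(** Subordination again: the inverse cube is a Mellin superposition of Gaussians, Tonelli integrates
    each of them over the plane, and the ratio of [mellin 1] to [mellin 3] is 2. *)
Lemma integral_snrm3 (r : R) : 0 < r ->
  (\int[mu2]_w ((snrm (r ^+ 2) w)^-1 ^+ 3)%:E = (2 * pi / r)%:E)%E.
Proof.
move=> r0.
have M1 := @mellin_gt0 R 1 isT.
have M3 : mellin 3 = 1 / 2 * mellin 1 :> R := @mellinS R 1 isT.
have sr w : 0 < snrm (r ^+ 2) w by rewrite sqrtr_gt0 ltr_wpDl ?nrm2_ge0// exprn_gt0.
have intE j s : (1 <= j)%N -> 0 < s ->
  (\int[mu]_t (expR (j%:R * t) * expR (- (s ^+ 2 * expR (2 * t))))%:E = (s^-1 ^+ j * mellin j)%:E)%E.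
  move=> j1 s0; have [i <-] := @mellin_scale R j s j1 s0.
  by rewrite /Rintegral fineK//; exact: integrable_fin_num.
pose F (q : (R * R) * R) := expR (3 * q.2) * expR (- ((nrm2 q.1 + r ^+ 2) * expR (2 * q.2))).
have mF : measurable_fun setT F by rewrite /F /nrm2; meas.
have F0 q : 0 <= F q by rewrite mulr_ge0 ?expR_ge0.
have E1 w : (\int[mu]_t (F (w, t))%:E = (mellin 3 * (snrm (r ^+ 2) w)^-1 ^+ 3)%:E)%E.
  rewrite mulrC -(intE 3 _ isT (sr w)); apply: eq_integral => t _.
  by rewrite /F /= sqr_sqrtr// addr_ge0 ?nrm2_ge0// sqr_ge0.
have E2 t : (\int[mu2]_w (F (w, t))%:E = (pi * (expR (1%:R * t) * expR (- (r ^+ 2 * expR (2 * t)))))%:E)%E.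
  pose c := expR (3 * t) * expR (- (r ^+ 2 * expR (2 * t))).
  transitivity (\int[mu2]_w (c * gauss2 (expR (2 * t)) w)%:E)%E.
    apply: eq_integral => w _; congr EFin; rewrite /F /c /gauss2 /= -!expRD; congr expR; ring.
  have mg : measurable_fun setT (gauss2 (expR (2 * t)) : R * R -> R).
    by apply: measurable_gauss2; exact: measurable_id.
  rewrite ge0_integralZ; [|by rewrite mulr_ge0 ?expR_ge0|exact: mg|by move=> x; exact: expR_ge0].
  rewrite integral_gauss2 ?expR_gt0// -EFinM; congr EFin; rewrite /c mul1r.
  have -> : expR (3 * t) = expR t * expR (2 * t) by rewrite -expRD; congr expR; ring.
  by move: (pi : R) => p; field; rewrite gt_eqF// expR_gt0.
have T : (\int[mu2]_w (mellin 3 * (snrm (r ^+ 2) w)^-1 ^+ 3)%:E =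
    \int[mu]_t (pi * (expR (1%:R * t) * expR (- (r ^+ 2 * expR (2 * t)))))%:E)%E.
  under eq_integral => w _ do rewrite -E1.
  under [RHS]eq_integral => t _ do rewrite -E2.
  by rewrite -(@tonelli1 _ _ _ _ R mu2 mu F mF F0) -(@tonelli2 _ _ _ _ R mu2 mu F mF F0).
have mS : measurable_fun setT (fun w : R * R => (snrm (r ^+ 2) w)^-1 ^+ 3) by rewrite /snrm /nrm2; meas.
rewrite ge0_integralZ in T; [|rewrite M3; lra|exact: mS|by move=> w; rewrite exprn_ge0// invr_ge0 ltW].
rewrite ge0_integralZ in T; [|exact: pi_ge0|by meas|by move=> t; rewrite mulr_ge0 ?expR_ge0].
rewrite intE// M3 -EFinM in T.
have M30 : 0 < 1 / 2 * mellin 1 :> R by lra.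
have := congr1 (fun x : \bar R => (1 / 2 * mellin 1)^-1%:E * x)%E T.
rewrite /= muleA -!EFinM mulVf ?gt_eqF// mul1e => ->; congr EFin.
by move: (pi : R) (mellin 1) M1 => p M M1; field; rewrite !gt_eqF.
Qed.

(** Beyond [r = 4 * k * l] the difference is of order [k ^ 2 * l] times the inverse cube of the
    modulus. The cut-off inverse cube is majorised, up to [2 ^+ 3 = 8], by the inverse cube of
    [snrm (r ^+ 2)], whose integral is [2 * pi / r]. As [r] is proportional to [k], one power of [k]
    is left; the factor [2 * l] in [c] bounds the Euclidean norm of [h]. *)
Lemma kern_hormander k c1 c2 dl (l : R) h : (1 <= k)%N -> `|c1| + `|c2| <= 1 -> 0 < dl ->
  0 < l -> supn h <= l ->
  (\int[mu2]_w (if (4 * k%:R * l < supn w)%R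
      then `|kern k c1 c2 dl w - kern k c1 c2 dl (w - h)%R|%R else 0)%:E
    <= (128 * k%:R)%:E)%E.
Proof.
move=> k1 c1c2 dl0 l0 hl.
pose r : R := 4 * k%:R * l.
have kk : 1 <= k%:R :> R by rewrite ler1n.
have r0 : 0 < r by rewrite mulr_gt0// mulr_gt0// (lt_le_trans _ kk).
have pi0 := @pi_gt0 R.
pose c : R := 4 * k%:R ^+ 2 / pi * (2 * l * 8).
have c0 : 0 <= c.
  by apply: mulr_ge0; [apply: divr_ge0; [apply: mulr_ge0; rewrite ?sqr_ge0|exact: ltW]|lra].
have mS : measurable_fun setT (fun w : R * R => (snrm (r ^+ 2) w)^-1 ^+ 3) by rewrite /snrm /nrm2; meas.
apply: (@le_trans _ _ (\int[mu2]_w (c * (snrm (r ^+ 2) w)^-1 ^+ 3)%:E)%E).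
  have sr w : 0 < snrm (r ^+ 2) w by rewrite sqrtr_gt0 ltr_wpDl ?nrm2_ge0// exprn_gt0.
  have rhs0 w : 0 <= c * (snrm (r ^+ 2) w)^-1 ^+ 3 by rewrite mulr_ge0// exprn_ge0// invr_ge0 ltW.
  apply: le_integral_any => w; rewrite lee_fin; case: ifP => // rw.
  have rn : r < nrm w := lt_le_trans rw (supn_le_nrm w).
  have ns : nrm w <= snrm dl w by apply: nrm_le_snrm; exact: ltW.
  have s0 : 0 < snrm dl w by lra.
  have wh : w - (w - h) = h by rewrite opprB addrC subrK.
  have far : 2 * nrm (w - (w - h)) <= snrm dl w.
    rewrite wh; have h2 := nrm_le_supn h.
    have : 4 * l <= r by rewrite /r; nra.
    by lra.
  apply: (le_trans (kern_sub_far k1 (ltW dl0) c1c2 s0 far)); rewrite wh.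
  rewrite /c -[leRHS]mulrA; apply: ler_wpM2l.
    by apply: divr_ge0; [apply: mulr_ge0; rewrite ?sqr_ge0|exact: ltW].
  rewrite -[leRHS]mulrA; apply: ler_pM; rewrite ?nrm_ge0 ?exprn_ge0 ?invr_ge0 ?(ltW s0)//.
    by rewrite (le_trans (nrm_le_supn h))// ler_wpM2l.
  have : snrm (r ^+ 2) w <= 2 * snrm dl w.
    have n0 := nrm_ge0 w.
    rewrite -(@ger0_norm _ (2 * snrm dl w)) ?mulr_ge0 ?(ltW s0)// -sqrtr_sqr; apply: ler_wsqrtr.
    have <- : nrm w ^+ 2 = nrm2 w by rewrite sqr_sqrtr// nrm2_ge0.
    have q1 : r ^+ 2 <= nrm w ^+ 2 by rewrite lerXn2r ?nnegrE ?(ltW r0) ?(ltW rn).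
    have q2 : nrm w ^+ 2 <= snrm dl w ^+ 2 by rewrite lerXn2r ?nnegrE ?(ltW s0).
    by rewrite [leRHS]exprMn; have q3 := sqr_ge0 (snrm dl w); lra.
  move=> ss; rewrite (_ : 8 = 2 ^+ 3); last by ring.
  rewrite -exprMn lerXn2r ?nnegrE ?mulr_ge0 ?invr_ge0 ?(ltW s0) ?(ltW (sr w))//.
  by rewrite -[2]invrK -invfM lef_pV2 ?posrE// ?mulr_gt0 ?invr_gt0//; lra.
rewrite ge0_integralZ; [|exact: c0|exact: mS|]; last first.
  by move=> w; rewrite exprn_ge0// invr_ge0 sqrtr_ge0.
rewrite (integral_snrm3 r0) -EFinM lee_fin /c /r.
have kn : k%:R != 0 :> R by rewrite gt_eqF// (lt_le_trans _ kk).
have := lt0r_neq0 pi0; move: (pi : R) (k%:R : R) kn kk => p K Kn K1 pn.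
rewrite (_ : _ * (2 * p / _) = 32 * K); last by field; rewrite pn Kn gt_eqF.
by lra.
Qed.

(** The constant of [calderon_zygmund_weak] at [A = 128], which covers both the Hormander bound and
    the [L^2] bound. *)
Definition weak_const : R := 39 * 128 + 100.

Lemma kern_weak k c1 c2 dl (f : R * R -> R) (alpha : R) : (1 <= k)%N -> `|c1| + `|c2| <= 1 ->
  0 < dl -> mu2.-integrable setT (EFin \o f) -> 0 < alpha ->
  (leb2 [set z | (alpha < `|\int[mu2]_y (kern k c1 c2 dl (z - y) * f y)|)%R] <=
   (weak_const * k%:R / alpha)%:E * \int[mu2]_x `|f x|%:E)%E.
Proof.
move=> k1 c1c2 dl0 intf alpha0.
have kk : 1 <= k%:R :> R by rewrite ler1n.
refine (@calderon_zygmund_weak R _ _ 128 k%:R _ (measurable_kern k c1 c2 dl)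
  (kern_bound k c1c2 dl0) _ kk _ (kern_lip k c1c2 dl0) _ _ _ _ intf alpha0).
- by [].
- apply: mulr_ge0; first by rewrite divr_ge0// mulr_ge0// pi_ge0.
  by apply: mulr_ge0; [rewrite addr_ge0// mulr_ge0|rewrite exprn_ge0// invr_ge0 sqrtr_ge0].
- move=> g ig; apply: (le_trans (kern_L2 _ _ k1 dl0 ig)); apply: lee_wpmul2r.
    by apply: integral_ge0 => y _; rewrite lee_fin sqr_ge0.
  by rewrite lee_fin; have := sqr_sum_le1 c1c2; lra.
- by move=> l h l0 hl; exact: kern_hormander.
Qed.

End kernel_regularity.

(** * Principal values as limits of regularised integrals *)

Section damping.
Context {R : realType}.
Local Notation mu := (@lebesgue_measure R).
Implicit Types (w x y z : R * R) (s dl : R).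

Lemma Rintegral_itv_if (a c : R) : 0 <= c ->
  mu.-integrable setT (EFin \o (fun s => if (0 < s) && (s < c) then a else 0)) /\
  \int[mu]_s (if (0 < s) && (s < c) then a else 0) = a * c.
Proof.
move=> c0.
have E s : (if (0 < s) && (s < c) then a else 0) = a * \1_(`]0, c[%classic : set R) s.
  rewrite indicE mem_setE in_itv /=.
  by case: (_ && _); rewrite ?mulr1 ?mulr0.
have i1 : mu.-integrable setT (EFin \o (\1_(`]0, c[%classic : set R) : R -> R)).
  exact: integrable_indic_itv.
split; first by apply: eq_integrable (integrable_rZl a i1) => // s _; rewrite /= E.
under eq_Rintegral => s _ do rewrite E.
rewrite RintegralZl//; congr (_ * _).
rewrite /Rintegral integral_indic//= setIT lebesgue_measure_itv/= lte_fin.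
by case: ltP => [_|c1]; rewrite ?oppr0 ?adde0 ?sube0//=; apply/eqP; rewrite eq_le c0 c1.
Qed.

(** The quotient of the regularised kernel by the singular one. *)
Definition damp k dl w : R := (nrm w * (snrm dl w)^-1) ^+ k.+2.

Lemma snrm_gt0 dl w : 0 < dl -> 0 < snrm dl w.
Proof. by move=> dl0; rewrite sqrtr_gt0 ltr_wpDl// nrm2_ge0. Qed.

Lemma measurable_damp k dl : measurable_fun setT (damp k dl).
Proof. by rewrite /damp /nrm /snrm /nrm2; meas. Qed.

Lemma damp_ge0 k dl w : 0 <= damp k dl w.
Proof. by rewrite exprn_ge0// mulr_ge0 ?invr_ge0 ?sqrtr_ge0. Qed.

Let ratio_le1 dl w : 0 < dl -> nrm w * (snrm dl w)^-1 <= 1.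
Proof.
by move=> dl0; rewrite ler_pdivrMr ?snrm_gt0// mul1r nrm_le_snrm// ltW.
Qed.

Lemma damp_le1 k dl w : 0 < dl -> damp k dl w <= 1.
Proof.
by move=> dl0; rewrite exprn_ile1// ?ratio_le1// mulr_ge0 ?invr_ge0 ?sqrtr_ge0.
Qed.

(** Vanishing to second order at the origin compensates the inverse square singularity of the
    kernel, so the damped integrals converge absolutely. *)
Lemma damp_le k dl w : 0 < dl -> damp k dl w <= dl^-1 * nrm2 w.
Proof.
move=> dl0; have s0 := snrm_gt0 w dl0.
have r0 : 0 <= nrm w * (snrm dl w)^-1 by rewrite mulr_ge0 ?invr_ge0 ?sqrtr_ge0.
rewrite /damp -addn2 exprD (@le_trans _ _ ((nrm w * (snrm dl w)^-1) ^+ 2))//.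
  by rewrite ler_piMl ?exprn_ge0// exprn_ile1// ratio_le1.
have nd : 0 <= nrm2 w + dl by rewrite addr_ge0 ?nrm2_ge0// ltW.
rewrite exprMn sqr_sqrtr ?nrm2_ge0// exprVn sqr_sqrtr//.
rewrite mulrC ler_wpM2r ?nrm2_ge0// lef_pV2 ?posrE//; first by rewrite lerDr nrm2_ge0.
by rewrite ltr_wpDl// nrm2_ge0.
Qed.

(* Superlevel sets of the damping factor are complements of discs, so a damped
   integral is an average of truncated ones. *)
Lemma damp_gt k s : 0 < s < 1 -> exists2 e : R, 0 < e &
  forall dl w, 0 < dl -> (s < damp k dl w) = (Num.sqrt dl * e < nrm w).
Proof.
move=> /andP[s0 s1].
(* The radius solves [nrm w = a * snrm dl w], where [a] is the root of order [k.+2] of [s]; by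
   homogeneity it is proportional to the square root of [dl]. *)
pose a := s `^ (k.+2%:R^-1).
have a0 : 0 < a by exact: powR_gt0.
have aK : a ^+ k.+2 = s.
  by rewrite -powR_mulrn ?(ltW a0)// -powRrM mulVf ?pnatr_eq0// powRr1// ltW.
have a1 : a < 1.
  by rewrite -(@ltr_pXn2r _ k.+2) ?nnegrE ?(ltW a0)// expr1n aK.
have b0 : 0 < 1 - a ^+ 2 by rewrite subr_gt0 expr_lt1// ltW.
exists (Num.sqrt (a ^+ 2 / (1 - a ^+ 2))); first by rewrite sqrtr_gt0 divr_gt0// exprn_gt0.
move=> dl w dl0; have sn := snrm_gt0 w dl0.
rewrite /damp -aK ltr_pXn2r ?nnegrE ?(ltW a0)//; last first.
  by rewrite mulr_ge0 ?invr_ge0 ?sqrtr_ge0.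
rewrite ltr_pdivlMr// -sqrtrM ?(ltW dl0)//.
have c0 : 0 <= dl * (a ^+ 2 / (1 - a ^+ 2)).
  by rewrite mulr_ge0 ?(ltW dl0)// divr_ge0 ?sqr_ge0// ltW.
rewrite -[LHS](@ltr_pXn2r _ 2) ?nnegrE ?mulr_ge0 ?sqrtr_ge0 ?(ltW a0)//.
rewrite -[RHS](@ltr_pXn2r _ 2) ?nnegrE ?sqrtr_ge0//.
have nd : 0 <= nrm2 w + dl by rewrite addr_ge0 ?nrm2_ge0// ltW.
rewrite exprMn !sqr_sqrtr ?nrm2_ge0//.
rewrite mulrA ltr_pdivrMr//; apply/idP/idP; lra.
Qed.

Section principal_value.
Variables (h : R * R -> R) (k : nat) (l : R).
Hypotheses (mh : measurable_fun setT h)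
  (ih : mu2.-integrable setT (EFin \o (fun w => h w * nrm2 w))).
Let trunc (e : R) := \int[mu2]_w (if e < nrm w then h w else 0).
Hypothesis cvg_trunc : trunc e @[e --> 0^'+] --> l.

Let mnrm : measurable_fun setT (@nrm R).
Proof. by rewrite /nrm /nrm2; meas. Qed.

(** For small radii the truncations are near their limit; for the others [h] is integrable away from
    the origin. This gives the dominating constant of [damped_cvg]. *)
Let trunc_bound : exists M, forall e, 0 < e -> `|trunc e| <= M.
Proof.
have /cvgrPdist_lt/(_ 1 ltr01) := cvg_trunc.
case=> r /= r0 near_l.
have r20 : 0 < r / 2 by rewrite divr_gt0.
pose I := \int[mu2]_w `|h w * nrm2 w|.
have I0 : 0 <= I by apply: Rintegral_ge0.
exists (`|l| + 1 + I / (r / 2) ^+ 2) => e e0.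
have [er|er] := ltP e r.
  have : `|l - trunc e| < 1.
    by apply: near_l => //=; rewrite sub0r normrN gtr0_norm.
  rewrite distrC => le1; have := ler_normD (trunc e - l) l; rewrite subrK.
  have : 0 <= I / (r / 2) ^+ 2 by rewrite divr_ge0// sqr_ge0.
  by lra.
have ir := integrable_rZl ((r / 2) ^+ 2)^-1 (integrable_norm ih).
have mt : measurable_fun setT (fun w => if e < nrm w then h w else 0).
  by apply: measurable_fun_ifT => //; apply: measurable_fun_ltr => //; exact: measurable_cst.
have tle w : `|if e < nrm w then h w else 0| <= ((r / 2) ^+ 2)^-1 * `|h w * nrm2 w|.
  case: ifP => [ew|_]; last by rewrite normr0 mulr_ge0// invr_ge0 sqr_ge0.
  rewrite normrM (ger0_norm (nrm2_ge0 w)) mulrCA ler_peMr//.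
  rewrite mulrC ler_pdivlMr ?exprn_gt0// mul1r -[nrm2 w]sqr_sqrtr ?nrm2_ge0// -/(nrm w).
  by rewrite lerXn2r ?nnegrE ?(ltW r20) ?nrm_ge0//; lra.
have it := @integrable_le _ _ _ mu2 _ _ mt ir tle.
apply: (le_trans (le_normr_Rintegral measurableT it)).
apply: (@le_trans _ _ (\int[mu2]_w (((r / 2) ^+ 2)^-1 * `|h w * nrm2 w|))).
  by apply: le_Rintegral => //; exact: integrable_norm.
rewrite (RintegralZl _ measurableT (integrable_norm ih)) -/I mulrC lerDr.
by rewrite addr_ge0.
Qed.

(** One layer of the damping factor at [dl = harmonic n ^+ 2]. For [0 < s < 1] it is a truncation at
    radius [harmonic n * e], with [e] depending on [s] but not on [n]. *)
Let F n s := \int[mu2]_w (if (0 < s) && (s < damp k (harmonic n ^+ 2) w) then h w else 0).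

Let dl0 n : 0 < harmonic n ^+ 2 :> R. Proof. by rewrite exprn_gt0// invr_gt0. Qed.

Let FE s : 0 < s < 1 -> exists2 e : R, 0 < e & forall n, F n s = trunc (harmonic n * e).
Proof.
move=> s01; have [e e0 He] := damp_gt k s01; exists e => // m.
apply: eq_Rintegral => w _; rewrite He//.
rewrite sqrtr_sqr ger0_norm ?invr_ge0//.
by case/andP: s01 => -> _.
Qed.

Let F0 n s : ~~ (0 < s < 1) -> F n s = 0.
Proof.
move=> s01; transitivity (\int[mu2]_w (0 : R)).
  apply: eq_Rintegral => w _; case: ifP => // /andP[s0 s1].
  by move: s01; rewrite s0 (lt_le_trans s1)// damp_le1.
by rewrite Rintegral_cst ?mul0r.
Qed.

Let J n (q : (R * R) * R) :=
  if (0 < q.2) && (q.2 < damp k (harmonic n ^+ 2) q.1) then h q.1 else 0.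

Let mJ n : measurable_fun setT (J n).
Proof.
have md := @measurable_damp k (harmonic n ^+ 2).
rewrite /J; apply: measurable_fun_ifT; [|by apply: (measurable_fcomp mh); meas|exact: measurable_cst].
by apply: measurable_and; apply: measurable_fun_ltr; meas.
Qed.

Let ihd n : mu2.-integrable setT (EFin \o (fun w => h w * damp k (harmonic n ^+ 2) w)).
Proof.
have md := @measurable_damp k (harmonic n ^+ 2).
apply: (@integrable_le _ _ _ mu2 _ _ _ (integrable_rZl (harmonic n ^+ 2)^-1 (integrable_norm ih))).
  by meas.
move=> w; rewrite normrM [X in _ <= _ * X]normrM (ger0_norm (damp_ge0 _ _ _)) (ger0_norm (nrm2_ge0 _)) [leRHS]mulrCA.
by rewrite ler_wpM2l// damp_le.
Qed.

Let iJ n : (prodm mu2 mu).-integrable setT (EFin \o J n).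
Proof.
apply: integrable_ltyP; first exact: mJ.
have mJn : measurable_fun setT (fun q => `|J n q|) by apply: measurableT_comp (mJ n).
rewrite (@tonelli1 _ _ _ _ R mu2 mu _ mJn (fun q => normr_ge0 _)).
have /integrableP[_] := integrable_norm (ihd n).
apply: le_lt_trans; apply: le_integral_any => w; first exact: integral_ge0.
have [i e] := Rintegral_itv_if `|h w| (damp_ge0 k (harmonic n ^+ 2) w).
rewrite /= ger0_norm// normrM (ger0_norm (damp_ge0 _ _ _)) -e.
rewrite /Rintegral fineK; last by apply: integrable_fin_num.
by apply: eq_ereal_le; apply: eq_integral => s _; rewrite /J /=; case: ifP; rewrite ?normr0.
Qed.

Let dampE n : \int[mu2]_w (h w * damp k (harmonic n ^+ 2) w) = \int[mu]_s F n s.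
Proof.
rewrite /F -(Rintegral_fubini (iJ n)); apply: eq_Rintegral => w _; rewrite /J /=.
by have [_ ->] := Rintegral_itv_if (h w) (damp_ge0 k (harmonic n ^+ 2) w).
Qed.

(** The damped integral is the integral over [s] of the layers [F n s]. For each [s] in the open
    unit interval the radii tend to 0 and the layer tends to [l]; dominated convergence in [s]
    concludes. *)
Lemma damped_cvg :
  \int[mu2]_w (h w * damp k (harmonic n ^+ 2) w) @[n --> \oo] --> l.
Proof.
have [M Mb] := trunc_bound.
pose ind a s : R := if (0 < s) && (s < 1) then a else 0.
have mF n : measurable_fun setT (F n).
  apply: (@measurable_Rintegral _ _ _ _ R mu2 (fun q : R * (R * R) => J n (q.2, q.1))).
  by apply: (measurable_fcomp (mJ n)); meas.
have [il el] := Rintegral_itv_if l ler01.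
have [iM _] := Rintegral_itv_if M ler01.
have mFe n : measurable_fun setT (EFin \o F n) by exact/measurable_EFinP.
have FM s n : `|F n s| <= ind M s.
  rewrite /ind; case: ifPn => s01; last by rewrite F0// normr0.
  by have [e e0 ->] := FE s01; apply: Mb; rewrite mulr_gt0// invr_gt0.
have Fl s : F n s @[n --> \oo] --> ind l s.
  rewrite /ind; case: ifPn => s01; last first.
    by under eq_fun => n do rewrite F0//; exact: cvg_cst.
  have [e e0 Fe] := FE s01; under eq_fun => n do rewrite Fe.
  move/cvg_at_rightP : cvg_trunc; apply; split=> [n|]; first by rewrite mulr_gt0// invr_gt0.
  by rewrite -(mul0r e); apply: cvgMl; exact: cvg_harmonic.
have Fle s : (EFin \o F n) s @[n --> \oo] --> (EFin \o ind l) s.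
  by apply/fine_cvgP; split; [exact: nearW|exact: Fl].
have FMe n s : (`|(EFin \o F n) s| <= (EFin \o ind M) s)%E by rewrite /= lee_fin.
have mil : measurable_fun setT (EFin \o ind l) by exact: measurable_int il.
have [] := @dominated_convergence _ _ _ mu setT measurableT (fun n => EFin \o F n)
  (EFin \o ind l) (EFin \o ind M) mFe mil _ iM _.
- by apply: aeW => s _; exact: Fle.
- by apply: aeW => s n _; exact: FMe.
move=> _ _ H.
have e1 : (\int[mu]_s (EFin \o ind l) s = l%:E)%E.
  rewrite -[in RHS](mulr1 l) -el /Rintegral fineK//; exact: integrable_fin_num il.
rewrite e1 in H; move/fine_cvg : H.
rewrite (_ : (fun n => _) = (fun n => \int[mu]_s F n s)) //.
by apply/funext => n; rewrite dampE.
Qed.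

End principal_value.
End damping.

(** * Upper bound *)

Section riesz.
Context {R : realType}.
Implicit Types (w x y z : R * R) (dl : R) (f : R * R -> R[i]).

Lemma cabs_le (c : R[i]) : cabs c <= `|complex.Re c| + `|complex.Im c|.
Proof.
rewrite /cabs normc_def /= -[leRHS]ger0_norm ?addr_ge0// -sqrtr_sqr; apply: ler_wsqrtr.
by rewrite sqrrD !real_normK ?num_real// lerD2r lerDl mulrn_wge0// mulr_ge0.
Qed.

Lemma normr_Re_le (c : R[i]) : `|complex.Re c| <= cabs c.
Proof. by rewrite /cabs normc_def /= -sqrtr_sqr; apply: ler_wsqrtr; rewrite lerDl sqr_ge0. Qed.

Lemma normr_Im_le (c : R[i]) : `|complex.Im c| <= cabs c.
Proof. by rewrite /cabs normc_def /= -sqrtr_sqr; apply: ler_wsqrtr; rewrite lerDr sqr_ge0. Qed.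

Lemma cabsE w : cabs (cplx w) = nrm w.
Proof. by rewrite /cabs normc_def. Qed.

(* [i^k = iu k + i (iv k)]. *)
Definition iu k : R := complex.Re ('i%C ^+ k : R[i]).
Definition iv k : R := complex.Im ('i%C ^+ k : R[i]).

Lemma iuv_norm k : `|iu k| + `|iv k| = 1.
Proof.
elim: k => [|k IHk]; first by rewrite /iu /iv expr0 /= normr1 normr0 addr0.
by rewrite /iu /iv exprSr ReiNIm ImiRe normrN addrC.
Qed.

Lemma OmegaE k w : Omega k (cplx w) =
  'i%C ^+ k * (k%:R / (2 * pi))%:C * (cbar w ^+ k * ((nrm w)^-1)%:C ^+ k.+2).
Proof.
have nz : `|cplx w| = (nrm w)%:C by rewrite normc_def.
rewrite /Omega nz; congr (_ * _).
  by rewrite !(rmorphM, fmorphV, rmorph_nat) -mulrA.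
have zV : (cplx w / (nrm w)%:C)^-1 = cbar w * ((nrm w)^-1)%:C.
  rewrite invfM invrK invc_norm nz /cbar fmorphV.
  have -> : (cplx w)^* = w.1 -i* w.2 by [].
  have [->|n0] := eqVneq (nrm w) 0; first by rewrite !(mul0r, mulr0, invr0, expr0n)//=.
  by field; rewrite (inj_eq (@complexI R)).
rewrite -exprVn zV exprMn -[k.+2]addn2 exprD [RHS]mulrA; congr (_ * _).
by rewrite fmorphV exprVn.
Qed.

Lemma Omega_kern k w :
  Omega k (cplx w) = kern k (iu k) (- iv k) 0 w +i* kern k (iv k) (iu k) 0 w.
Proof.
have iE : 'i%C ^+ k = iu k +i* iv k :> R[i] by rewrite /iu /iv; case: ('i%C ^+ k).
rewrite OmegaE iE cbar_pow -rmorphXn /kern [harm k (iu k) _ w]harmE [harm k (iv k) _ w]harmE.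
rewrite addr0 -/(nrm w); simpc.
by congr (_ +i* _); ring.
Qed.

Lemma kern_damp k c1 c2 dl w : (1 <= k)%N -> kern k c1 c2 dl w = kern k c1 c2 0 w * damp k dl w.
Proof.
move=> k1; rewrite /kern addr0 -/(nrm w) -/(snrm dl w) /damp.
have [n0|n0] := eqVneq (nrm w) 0.
  have -> : harm k c1 c2 w = 0.
    apply/eqP; rewrite -normr_le0 (le_trans (normr_harm_le _ _ _ _))// -/(nrm w) n0.
    by rewrite expr0n; case: k k1 => // k _; rewrite mulr0.
  by rewrite !(mul0r, mulr0).
have e : (nrm w)^-1 ^+ k.+2 * nrm w ^+ k.+2 = 1 by rewrite -exprMn mulVf// expr1n.
rewrite exprMn; move: (_ / _) (harm _ _ _ _) (_^-1 ^+ k.+2) ((nrm w)^-1 ^+ k.+2) (nrm w ^+ k.+2) e.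
by move=> c H s p q e; rewrite -[LHS]mulr1 -e; ring.
Qed.

Lemma kern0_le k c1 c2 w : `|c1| + `|c2| <= 1 ->
  `|kern k c1 c2 0 w * nrm2 w| <= k%:R / (2 * pi).
Proof.
move=> c1c2; have kpi : 0 <= k%:R / (2 * pi) :> R by rewrite divr_ge0// mulr_ge0// pi_ge0.
have q0 : 0 <= (nrm w)^-1 by rewrite invr_ge0 nrm_ge0.
have qle : nrm w * (nrm w)^-1 <= 1.
  by have [->|n0] := eqVneq (nrm w) 0; rewrite ?mul0r// mulfV.
rewrite /kern addr0 -/(nrm w) -mulrA normrM (ger0_norm kpi) ler_piMr//.
rewrite normrM [`|harm _ _ _ _ * _|]normrM (ger0_norm (exprn_ge0 _ q0)) (ger0_norm (nrm2_ge0 _)).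
have -> : nrm2 w = nrm w ^+ 2 by rewrite sqr_sqrtr// nrm2_ge0.
have cc := ler_wsqrtr (sqr_sum_le1 c1c2); rewrite sqrtr1 in cc.
have hh : `|harm k c1 c2 w| <= nrm w ^+ k.
  by rewrite (le_trans (normr_harm_le _ _ _ _))// ler_piMl// exprn_ge0// sqrtr_ge0.
apply: (@le_trans _ _ (nrm w ^+ k * (nrm w)^-1 ^+ k.+2 * nrm w ^+ 2)).
  rewrite -mulrA -[leRHS]mulrA; apply: ler_wpM2r hh.
  exact: mulr_ge0 (exprn_ge0 _ q0) (sqr_ge0 _).
have -> : nrm w ^+ k * (nrm w)^-1 ^+ k.+2 * nrm w ^+ 2 = (nrm w * (nrm w)^-1) ^+ k.+2.
  rewrite [RHS]exprMn -[X in _ = nrm w ^+ X * _]addn2 [nrm w ^+ (k + 2)]exprD.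
  by move: (_^-1 ^+ _) (nrm w ^+ k) (nrm w ^+ 2) => a b c; ring.
by rewrite exprn_ile1// mulr_ge0// nrm_ge0.
Qed.

Section convolution.
Variables (k : nat) (z : R * R).
Hypothesis k1 : (1 <= k)%N.

Lemma integrable_shifted (g : R * R -> R) : mu2.-integrable setT (EFin \o g) ->
  mu2.-integrable setT (EFin \o (fun w => g (z - w))).
Proof.
by move=> ig; exact: (@integrable_preserve R _ _ mu2 _ (measurable_reflect z) (@leb2_reflect R z) g ig).
Qed.

Lemma integrable_kern0 c1 c2 (g : R * R -> R) : `|c1| + `|c2| <= 1 ->
  mu2.-integrable setT (EFin \o g) ->
  mu2.-integrable setT (EFin \o (fun w => kern k c1 c2 0 w * g (z - w) * nrm2 w)).
Proof.
move=> cc ig; have mK := @measurable_kern R k c1 c2 0.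
have mKn : measurable_fun setT (fun w => kern k c1 c2 0 w * nrm2 w) by rewrite /nrm2; meas.
have := integrable_rMbd (integrable_shifted ig) mKn (fun w => kern0_le k w cc).
by apply: eq_integrable => // w _ /=; congr EFin; ring.
Qed.

Lemma integrable_kern c1 c2 dl (g : R * R -> R) : `|c1| + `|c2| <= 1 -> 0 < dl ->
  mu2.-integrable setT (EFin \o g) ->
  mu2.-integrable setT (EFin \o (fun w => kern k c1 c2 dl w * g (z - w))).
Proof.
move=> cc dl0 ig.
have := integrable_rMbd (integrable_shifted ig) (@measurable_kern R k c1 c2 dl)
  (kern_bound k cc dl0).
by apply: eq_integrable => // w _ /=; congr EFin; rewrite mulrC.
Qed.

Definition kconv c1 c2 dl (g : R * R -> R) z0 := \int[mu2]_y (kern k c1 c2 dl (z0 - y) * g y).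

Lemma kconvE c1 c2 dl (g : R * R -> R) : measurable_fun setT g ->
  kconv c1 c2 dl g z = \int[mu2]_w (kern k c1 c2 dl w * g (z - w)).
Proof.
move=> mg; have mK := @measurable_kern R k c1 c2 dl.
have mf : measurable_fun setT (fun w => kern k c1 c2 dl w * g (z - w)).
  by apply: measurable_funM => //; apply: (measurable_fcomp mg); exact: measurable_reflect.
rewrite -(@Rintegral_preserve R _ _ mu2 _ (measurable_reflect z) (@leb2_reflect R z) _ mf).
by apply: eq_Rintegral => y _ /=; rewrite subKr.
Qed.

(** The real and the imaginary part of [R^k f] each mix both parts of [f]. Convergence of
    truncations at [z] is known for the mixture, not for its two terms, so both convolutions pass to
    the limit together. *)
Lemma kconv_cvg a1 a2 b1 b2 (g1 g2 : R * R -> R) (l : R) :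
  `|a1| + `|a2| <= 1 -> `|b1| + `|b2| <= 1 ->
  mu2.-integrable setT (EFin \o g1) -> mu2.-integrable setT (EFin \o g2) ->
  (\int[mu2]_w (if e < nrm w then kern k a1 a2 0 w * g1 (z - w) + kern k b1 b2 0 w * g2 (z - w) else 0))
    @[e --> 0^'+] --> l ->
  (kconv a1 a2 (harmonic n ^+ 2) g1 z + kconv b1 b2 (harmonic n ^+ 2) g2 z) @[n --> \oo] --> l.
Proof.
move=> aa bb i1 i2 tl.
have mg1 : measurable_fun setT g1 by apply/measurable_EFinP; exact: measurable_int i1.
have mg2 : measurable_fun setT g2 by apply/measurable_EFinP; exact: measurable_int i2.
have mr := measurable_reflect z.
have mK1 := @measurable_kern R k a1 a2 0; have mK2 := @measurable_kern R k b1 b2 0.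
have mh : measurable_fun setT
    (fun w => kern k a1 a2 0 w * g1 (z - w) + kern k b1 b2 0 w * g2 (z - w)).
  apply: measurable_funD; apply: measurable_funM => //.
    exact: (measurable_fcomp mg1).
  exact: (measurable_fcomp mg2).
have ih : mu2.-integrable setT (EFin \o (fun w =>
    (kern k a1 a2 0 w * g1 (z - w) + kern k b1 b2 0 w * g2 (z - w)) * nrm2 w)).
  have := integrable_rD (integrable_kern0 aa i1) (integrable_kern0 bb i2).
  by apply: eq_integrable => // w _ /=; congr EFin; ring.
have := damped_cvg k mh ih tl.
rewrite (_ : (fun n => kconv _ _ _ _ _ + _) = (fun n => \int[mu2]_w
   ((kern k a1 a2 0 w * g1 (z - w) + kern k b1 b2 0 w * g2 (z - w)) * damp k (harmonic n ^+ 2) w)))//.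
apply/funext => n; have dl0 : 0 < harmonic n ^+ 2 :> R by rewrite exprn_gt0// invr_gt0.
rewrite !kconvE// -RintegralD//; last 2 first.
- exact: integrable_kern.
- exact: integrable_kern.
apply: eq_Rintegral => w _; rewrite (kern_damp a1 a2 _ w k1) (kern_damp b1 b2 _ w k1); ring.
Qed.

End convolution.

End riesz.

Lemma measure_liminf_le d (T : measurableType d) (R : realType)
    (m : {measure set T -> \bar R}) (S : nat -> set T) (B : \bar R) :
  (forall n, measurable (S n)) -> (forall n, (m (S n) <= B)%E) ->
  (m (\bigcup_N \bigcap_(n in [set n | (N <= n)%N]) S n) <= B)%E.
Proof.
move=> mS SB; pose F N := \bigcap_(n in [set n | (N <= n)%N]) S n.
have mF N : measurable (F N) by apply: bigcap_measurable => //; exists N => /=.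
have ndF : nondecreasing_seq F.
  move=> i j ij; apply/subsetPset => x Fi n /= jn; apply: Fi => /=; exact: leq_trans ij jn.
have mU : measurable (\bigcup_N F N) by exact: bigcup_measurable.
have cF := nondecreasing_cvg_mu (mu := m) mF mU ndF.
rewrite -(cvg_lim _ cF)//; apply: lime_le; first by apply/cvg_ex; exists (m (\bigcup_N F N)).
apply: nearW => N; apply: le_trans (SB N); apply: le_measure; rewrite ?inE//.
by move=> x Fx; apply: Fx => /=.
Qed.

Section upper_bound.
Context {R : realType}.
Implicit Types (w x y z : R * R) (dl : R) (f : R * R -> R[i]).

Lemma kernN k c1 c2 dl w : kern k (- c1) (- c2) dl w = - kern k c1 c2 dl w :> R.
Proof. by rewrite /kern harmN; ring. Qed.

Lemma Rintegral_outside (g : R * R -> R) (e : R) :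
  \int[leb2]_(w in [set w | e < cabs (cplx w)]) g w = \int[mu2]_w (if e < nrm w then g w else 0).
Proof.
rewrite Rintegral_mkcond; apply: eq_Rintegral => w _; rewrite /patch.
have -> : (w \in [set w | e < cabs (cplx w)]) = (e < nrm w).
  by apply/idP/idP; rewrite inE /= cabsE.
by [].

Qed.

Lemma riesz_truncE k e f z : riesz_trunc k e f z =
  (\int[mu2]_w (if e < nrm w then
     kern k (iu k) (- iv k) 0 w * complex.Re (f (z - w)) +
     kern k (- iv k) (- iu k) 0 w * complex.Im (f (z - w)) else 0)) +i*
  (\int[mu2]_w (if e < nrm w then
     kern k (iv k) (iu k) 0 w * complex.Re (f (z - w)) +
     kern k (iu k) (- iv k) 0 w * complex.Im (f (z - w)) else 0)).
Proof.
rewrite /riesz_trunc /cintegral !Rintegral_outside; congr (_ +i* _).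
  apply: eq_Rintegral => w _; rewrite kernN Omega_kern; case: (f (z - w)) => a b /=.
  by rewrite mulNr.
apply: eq_Rintegral => w _; rewrite Omega_kern; case: (f (z - w)) => a b /=.
by rewrite addrC.
Qed.

Lemma cvg_Re_Im (F : R -> R[i]) (l : R[i]) :
  (F e : R[i]^o) @[e --> 0^'+] --> (l : R[i]^o) ->
  (complex.Re (F e)) @[e --> 0^'+] --> complex.Re l /\
  (complex.Im (F e)) @[e --> 0^'+] --> complex.Im l.
Proof.
move=> /cvgrPdist_lt Fl; split; apply/cvgrPdist_lt => e e0.
  have e0C : (0 : R[i]) < e%:C by rewrite ltcR.
  apply: filterS (Fl _ e0C) => t lt; rewrite -ltcR (le_lt_trans _ lt)//.
  rewrite (_ : complex.Re l - _ = complex.Re (l - F t)); first exact: normc_ge_Re.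
  by case: (l) (F t) => ? ? [].
have e0C : (0 : R[i]) < e%:C by rewrite ltcR.
apply: filterS (Fl _ e0C) => t lt; rewrite -ltcR (le_lt_trans _ lt)//.
rewrite (_ : complex.Im l - _ = complex.Im (l - F t)); first exact: Im_le_norm.
by case: (l) (F t) => ? ? [].
Qed.

Section weak_bound.
Variables (k : nat) (f : R * R -> R[i]) (alpha : R).
Hypotheses (k1 : (1 <= k)%N) (intf : L1fun f) (alpha0 : 0 < alpha).

Let f1 z := complex.Re (f z).
Let f2 z := complex.Im (f z).
Let i1 : mu2.-integrable setT (EFin \o f1). Proof. exact: (proj1 intf). Qed.
Let i2 : mu2.-integrable setT (EFin \o f2). Proof. exact: (proj2 intf). Qed.

Let A1 n z := kconv k (iu k) (- iv k) (harmonic n ^+ 2) f1 z.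
Let A2 n z := kconv k (- iv k) (- iu k) (harmonic n ^+ 2) f2 z.
Let A3 n z := kconv k (iv k) (iu k) (harmonic n ^+ 2) f1 z.
Let A4 n z := kconv k (iu k) (- iv k) (harmonic n ^+ 2) f2 z.

Let c1 : `|iu k| + `|- iv k| <= 1 :> R. Proof. by rewrite normrN iuv_norm. Qed.
Let c2 : `|- iv k| + `|- iu k| <= 1 :> R. Proof. by rewrite !normrN addrC iuv_norm. Qed.
Let c3 : `|iv k| + `|iu k| <= 1 :> R. Proof. by rewrite addrC iuv_norm. Qed.

Lemma riesz_pow_gt z : alpha < cabs (riesz_pow k f z) ->
  \forall n \near \oo, alpha < `|A1 n z + A2 n z| + `|A3 n z + A4 n z|.
Proof.
rewrite /riesz_pow; set F := (X in lim X); move=> al.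
(* Where the truncations diverge, the limit takes the default value 0, whose modulus is not above
   [alpha]. *)
have [cF|dF] := pselect (cvg F); last first.
  move: al; rewrite (dvgP dF) /cabs normr0 /= => al.
  by have := lt_trans alpha0 al; rewrite ltxx.
move: al cF; set l := lim F => al Fl.
have [] := @cvg_Re_Im (fun e => riesz_trunc k e f z) l Fl.
under eq_fun => e do rewrite riesz_truncE /=.
under [X in _ -> X @ _ --> _ -> _]eq_fun => e do rewrite riesz_truncE /=.
move=> /(kconv_cvg k1 c1 c2 i1 i2) h1 /(kconv_cvg k1 c3 c1 i1 i2) h2.
have h := cvgD (cvg_norm h1) (cvg_norm h2).
have al' : alpha < `|complex.Re l| + `|complex.Im l| := lt_le_trans al (cabs_le l).
apply: cvgr_gt al'. exact: h.
Qed.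

Let measurable_kconv c c' n (g : R * R -> R) : mu2.-integrable setT (EFin \o g) ->
  measurable_fun setT (kconv k c c' (harmonic n ^+ 2) g).
Proof.
move=> ig; have mg : measurable_fun setT g by apply/measurable_EFinP; exact: measurable_int ig.
have mK := @measurable_kern R k c c' (harmonic n ^+ 2).
apply: (@measurable_Rintegral _ _ _ _ R mu2
  (fun q : (R * R) * (R * R) => kern k c c' (harmonic n ^+ 2) (q.1 - q.2) * g q.2)).
by apply: measurable_funM; [apply: (measurable_fcomp mK); meas|apply: (measurable_fcomp mg); meas].
Qed.

Let S (A : nat -> R * R -> R) n := [set z | alpha / 4 < `|A n z|].

Let measurable_S A n : measurable_fun setT (A n) -> measurable (S A n).
Proof.
move=> mA; have -> : S A n = (fun z => alpha / 4 < `|A n z|) @^-1` [set true].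
  by apply/seteqP; split => x.
rewrite -[X in measurable X]setTI.
have : measurable_fun [set: R * R] (fun z => alpha / 4 < `|A n z|).
  by apply: measurable_fun_ltr; meas.
exact.
Qed.

Let coef_ge0 : (0 <= (4 * @weak_const R * k%:R / alpha)%:E)%E.
Proof.
have w0 : 0 <= @weak_const R by rewrite /weak_const addr_ge0// mulr_ge0.
rewrite lee_fin; apply: divr_ge0; last exact: ltW.
by apply: mulr_ge0 => //; apply: mulr_ge0.
Qed.

Let S_le c c' (g : R * R -> R) n : `|c| + `|c'| <= 1 ->
  mu2.-integrable setT (EFin \o g) -> (forall x, `|g x| <= cabs (f x)) ->
  (leb2 (S (fun n => kconv k c c' (harmonic n ^+ 2) g) n) <=
   (4 * @weak_const R * k%:R / alpha)%:E * L1norm f)%E.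
Proof.
move=> cc ig gf.
have dl0 : 0 < harmonic n ^+ 2 :> R by rewrite exprn_gt0// invr_gt0.
have a4 : 0 < alpha / 4 by rewrite divr_gt0.
apply: (le_trans (kern_weak k1 cc dl0 ig a4)).
have -> : weak_const * k%:R / (alpha / 4) = 4 * weak_const * k%:R / alpha.
  by move: (@weak_const R) => C; field; rewrite gt_eqF.
apply: lee_wpmul2l; first exact: coef_ge0.
by apply: le_integral_any => x; rewrite lee_fin.
Qed.

(** Four real convolutions are each compared with [alpha / 4], whence [4 * 4 = 16]. The superlevel
    set is contained in the lower limit of the unions [U n], whose measures are bounded uniformly in
    [n]. *)
Lemma riesz_weak_le : (leb2 [set z | (alpha < cabs (riesz_pow k f z))%R] <=
  (16 * @weak_const R * k%:R / alpha)%:E * L1norm f)%E.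
Proof.
pose U n := (S A1 n `|` S A2 n) `|` (S A3 n `|` S A4 n).
have m1 n : measurable (S A1 n) by apply: measurable_S; exact: measurable_kconv.
have m2 n : measurable (S A2 n) by apply: measurable_S; exact: measurable_kconv.
have m3 n : measurable (S A3 n) by apply: measurable_S; exact: measurable_kconv.
have m4 n : measurable (S A4 n) by apply: measurable_S; exact: measurable_kconv.
have m12 n : measurable (S A1 n `|` S A2 n) by exact: measurableU.
have m34 n : measurable (S A3 n `|` S A4 n) by exact: measurableU.
have mU n : measurable (U n) by exact: measurableU.
apply: (@le_trans _ _ (leb2 (\bigcup_N \bigcap_(n in [set n | (N <= n)%N]) U n))).
  apply: le_leb2 => z /= /riesz_pow_gt [N _ hN]; exists N => // n /= Nn.
  have := hN n Nn; rewrite /U /S /= => h.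
  have t1 := ler_normD (A1 n z) (A2 n z); have t2 := ler_normD (A3 n z) (A4 n z).
  have [a1|a1] := ltP (alpha / 4) `|A1 n z|; first by left; left.
  have [a2|a2] := ltP (alpha / 4) `|A2 n z|; first by left; right.
  have [a3|a3] := ltP (alpha / 4) `|A3 n z|; first by right; left.
  have [a4|a4] := ltP (alpha / 4) `|A4 n z|; first by right; right.
  by exfalso; lra.
refine (@measure_liminf_le _ _ R mu2 U _ mU _) => n.
have f1f x : `|f1 x| <= cabs (f x) by exact: normr_Re_le.
have f2f x : `|f2 x| <= cabs (f x) by exact: normr_Im_le.
have l1 := S_le n c1 i1 f1f; have l2 := S_le n c2 i2 f2f.
have l3 := S_le n c3 i1 f1f; have l4 := S_le n c1 i2 f2f.
have -> : 16 * weak_const * k%:R / alpha = (4 * weak_const * k%:R / alpha + 4 * weak_const * k%:R / alpha) +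
  (4 * weak_const * k%:R / alpha + 4 * weak_const * k%:R / alpha).
  by move: (@weak_const R) => C; ring.
have e0 : (0 <= (4 * weak_const * k%:R / alpha)%:E)%E.
  exact: coef_ge0.
rewrite !EFinD !ge0_muleDl ?adde_ge0//.
have u12 : (mu2 (S A1 n `|` S A2 n) <= mu2 (S A1 n) + mu2 (S A2 n))%E.
  by refine (@measureU2 _ _ R mu2 _ _ (m1 n) (m2 n)).
have u34 : (mu2 (S A3 n `|` S A4 n) <= mu2 (S A3 n) + mu2 (S A4 n))%E.
  by refine (@measureU2 _ _ R mu2 _ _ (m3 n) (m4 n)).
apply: (@le_trans _ _ (mu2 (S A1 n `|` S A2 n) + mu2 (S A3 n `|` S A4 n))%E).
  by refine (@measureU2 _ _ R mu2 _ _ (m12 n) (m34 n)).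
apply: leeD.
  by apply: (le_trans u12); exact: leeD l1 l2.
by apply: (le_trans u34); exact: leeD l3 l4.
Qed.

End weak_bound.

Lemma weak_type_norm_le k : (1 <= k)%N ->
  (weak_type_norm (@riesz_pow R k) <= (16 * @weak_const R * k%:R)%:E)%E.
Proof.
move=> k1; apply: ereal_inf_lbound; exists (16 * @weak_const R * k%:R) => // f intf alpha alpha0.
exact: riesz_weak_le.
Qed.

End upper_bound.

(** * Lower bound *)

Section lower_bound.
Context {R : realType}.
Local Notation mu := (@lebesgue_measure R).
Implicit Types (w x y z : R * R).

Definition usquare w : R := if supn w <= 1 / 2 then 1 else 0.

Lemma measurable_usquare : measurable_fun setT usquare.
Proof.
apply: measurable_fun_ifT; [|exact: measurable_cst|exact: measurable_cst].
by apply: measurable_fun_ler; [apply: measurable_supn; meas|exact: measurable_cst].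
Qed.

Lemma usquare_ge0 w : 0 <= usquare w. Proof. by rewrite /usquare; case: ifP. Qed.

Lemma usquareE w : usquare w = \1_[set x | supn (x - 0) <= 1 / 2] w.
Proof.
rewrite /usquare indicE; have -> : (w \in [set x | supn (x - 0) <= 1 / 2]) = (supn w <= 1 / 2).
  by apply/idP/idP; rewrite inE /= subr0.
by case: ifP.
Qed.

Lemma integral_usquare : (\int[mu2]_w (usquare w)%:E = 1)%E.
Proof.
have mS : measurable [set x : R * R | supn (x - 0) <= 1 / 2].
  have -> : [set x : R * R | supn (x - 0) <= 1 / 2] = (fun x => supn (x - 0) <= 1 / 2) @^-1` [set true].
    by apply/seteqP; split => x.
  rewrite -[X in measurable X]setTI.
  have : measurable_fun [set: R * R] (fun x : R * R => supn (x - 0) <= 1 / 2).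
    by apply: measurable_fun_ler; [apply: measurable_supn; meas|exact: measurable_cst].
  exact.
under eq_integral => w _ do rewrite usquareE.
rewrite integral_indic// setIT [LHS]leb2_supn_ball//.
by congr EFin; field.
Qed.

Lemma integrable_usquare : mu2.-integrable setT (EFin \o usquare).
Proof.
apply: integrable_ltyP; first exact: measurable_usquare.
under eq_integral => w _ do rewrite ger0_norm ?usquare_ge0//.
by rewrite integral_usquare ltry.
Qed.

Lemma Rintegral_usquare z : \int[mu2]_w usquare (z - w) = 1.
Proof.
rewrite (@Rintegral_preserve R _ _ mu2 _ (measurable_reflect z) (@leb2_reflect R z) _ measurable_usquare).
by rewrite /Rintegral integral_usquare.
Qed.

Lemma usquare_eq0 w : 1 < nrm w -> usquare w = 0.
Proof.
move=> w1; rewrite /usquare; case: ifP => // h; have := nrm_le_supn w.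
by lra.
Qed.

Section far_point.
Variables (k : nat) (z : R * R).
Hypotheses (k1 : (1 <= k)%N) (zk : 32 * k%:R <= nrm z).

Let kk : 1 <= k%:R :> R. Proof. by rewrite ler1n. Qed.
Let nz0 : 0 < nrm z. Proof. by rewrite (lt_le_trans _ zk)// mulr_gt0// (lt_le_trans _ kk). Qed.
Let nz2 : 32 <= nrm z. Proof. by apply: le_trans zk; rewrite ler_peMr. Qed.
Let D : R := 4 * k%:R ^+ 2 / pi * (nrm z)^-1 ^+ 3.
Let D0 : 0 <= D.
Proof.
by rewrite mulr_ge0 ?divr_ge0 ?pi_ge0 ?exprn_ge0 ?invr_ge0 ?nrm_ge0// mulr_ge0 ?sqr_ge0.
Qed.

Let kern_near c1 c2 w : `|c1| + `|c2| <= 1 -> nrm (z - w) <= 1 ->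
  `|kern k c1 c2 0 w - kern k c1 c2 0 z| <= D.
Proof.
move=> cc w1.
have sz : snrm 0 z = nrm z by rewrite /snrm addr0.
have s0 : 0 < snrm 0 z by rewrite sz.
have far : 2 * nrm (z - w) <= snrm 0 z by rewrite sz; move: (nrm z) (nrm _) nz2 w1 => a b; lra.
rewrite distrC; apply: (le_trans (kern_sub_far k1 (lexx _) cc s0 far)).
rewrite sz /D ler_wpM2l//; first by rewrite divr_ge0 ?pi_ge0// mulr_ge0 ?sqr_ge0.
by rewrite ler_piMl// exprn_ge0// invr_ge0 nrm_ge0.
Qed.

Let conv_near c1 c2 : `|c1| + `|c2| <= 1 ->
  `|\int[mu2]_w (kern k c1 c2 0 w * usquare (z - w)) - kern k c1 c2 0 z| <= D.
Proof.
move=> cc; have iu := integrable_shifted z integrable_usquare.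
pose c := kern k c1 c2 0 z.
have mK := @measurable_kern R k c1 c2 0.
have mr := measurable_reflect z.
have mq : measurable_fun setT (fun w => usquare (z - w)).
  by apply: (measurable_fcomp measurable_usquare).
have md : measurable_fun setT (fun w => (kern k c1 c2 0 w - c) * usquare (z - w)).
  by apply: measurable_funM => //; apply: measurable_funB => //; exact: measurable_cst.
have dle w : `|(kern k c1 c2 0 w - c) * usquare (z - w)| <= D * usquare (z - w).
  rewrite normrM (ger0_norm (usquare_ge0 _)).
  have [w1|w1] := leP (nrm (z - w)) 1.
    by rewrite ler_wpM2r ?usquare_ge0// kern_near.
  by rewrite usquare_eq0// !mulr0.
have iD := integrable_rZl D iu.
have id := @integrable_le _ _ _ mu2 _ _ md iD dle.
have -> : \int[mu2]_w (kern k c1 c2 0 w * usquare (z - w)) =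
    \int[mu2]_w ((kern k c1 c2 0 w - c) * usquare (z - w)) + c.
  rewrite -[X in _ = _ + X](mulr1 c) -(Rintegral_usquare z) -RintegralZl// -RintegralD//; last first.
    exact: integrable_rZl.
  by apply: eq_Rintegral => w _; ring.
rewrite addrK (le_trans (le_normr_Rintegral measurableT id))//.
rewrite -[leRHS]mulr1 -(Rintegral_usquare z) -RintegralZl//.
apply: le_Rintegral => //; exact: integrable_norm id.
Qed.

Let f w : R[i] := (usquare w)%:C.

(** The square is far from [z], so [f (z - w)] vanishes for small [w] and the truncated integrals
    are constant for [e < 1]. *)
Lemma riesz_pow_far : riesz_pow k f z =
  (\int[mu2]_w (kern k (iu k) (- iv k) 0 w * usquare (z - w))) +i*
  (\int[mu2]_w (kern k (iv k) (iu k) 0 w * usquare (z - w))).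
Proof.
rewrite /riesz_pow; refine (@norm_lim_near_cst _ (R[i]^o) _ _ _ _ _ _).
near=> e; rewrite riesz_truncE.
have e1 : e < 1 by near: e; exact: nbhs_right_lt.
have E (K g : R * R -> R) w : (if e < nrm w then K w * complex.Re (f (z - w)) + g w * complex.Im (f (z - w)) else 0) =
    K w * usquare (z - w).
  rewrite /f /= mulr0 addr0; case: ifPn => //; rewrite -leNgt => we.
  rewrite usquare_eq0 ?mulr0//.
  have := nrm_sub_le z w; rewrite ler_norml => /andP[_]; have n2 := nz2; move: (nrm z) (nrm w) (nrm _) n2 we => a b c; lra.
by congr (_ +i* _); apply: eq_Rintegral => w _; rewrite E.
Unshelve. all: by end_near.
Qed.

Lemma cabs_Omega : cabs (Omega k (cplx z)) = k%:R / (2 * pi) * (nrm z)^-1 ^+ 2.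
Proof.
have k0 : 0 <= k%:R / (2 * pi) :> R by rewrite divr_ge0// mulr_ge0// pi_ge0.
have q0 : 0 <= (nrm z)^-1 by rewrite invr_ge0 nrm_ge0.
rewrite /cabs OmegaE normrM [`|_ * _%:C|]normrM [`|cbar z ^+ k * _|]normrM.
rewrite [`|cbar z ^+ k|]normrX [`|_ ^+ k.+2|]normrX [`|'i%C ^+ k|]normrX normr_cbar.
have -> : `|'i%C| = 1 :> R[i] by rewrite normc_def /= expr0n add0r expr1n sqrtr1.
have nR (a : R) : 0 <= a -> `|a%:C| = a%:C by move=> a0; rewrite ger0_norm// ler0c.
rewrite !nR// expr1n mul1r -!rmorphXn -!rmorphM /=; congr (_ * _).
rewrite -[k.+2]addn2 exprD mulrA -exprMn mulfV ?gt_eqF// expr1n mul1r//.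
Qed.

(** Replacing the average of the kernel over the square by its value at [z] costs at most [D] in
    each of the two parts. The total error is [32 * k / nrm z] times half of the modulus of the
    kernel, hence the threshold [32 * k]. *)
Lemma riesz_pow_far_ge : k%:R / (4 * pi) * (nrm z)^-1 ^+ 2 <= cabs (riesz_pow k f z).
Proof.
have c1 : `|iu k| + `|- iv k| <= 1 :> R by rewrite normrN iuv_norm.
have c2 : `|iv k| + `|iu k| <= 1 :> R by rewrite addrC iuv_norm.
have h1 := conv_near c1; have h2 := conv_near c2.
have hd : cabs (Omega k (cplx z) - riesz_pow k f z) <= D + D.
  apply: (le_trans (cabs_le _)); rewrite riesz_pow_far Omega_kern /=.
  by apply: lerD; rewrite distrC.
have tri (a b : R[i]) : cabs a <= cabs (a - b) + cabs b.
  have := ler_normD (a - b) b; rewrite subrK /cabs !normc_def -rmorphD lecR; exact.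
have := tri (Omega k (cplx z)) (riesz_pow k f z); rewrite cabs_Omega.
have q0 : 0 < (nrm z)^-1 by rewrite invr_gt0.
have DD : D + D <= k%:R / (4 * pi) * (nrm z)^-1 ^+ 2.
  have kq : 32 * k%:R * (nrm z)^-1 <= 1 by rewrite ler_pdivrMr// mul1r.
  have -> : D + D = k%:R / (4 * pi) * (nrm z)^-1 ^+ 2 * (32 * k%:R * (nrm z)^-1).
    rewrite /D; have := lt0r_neq0 (@pi_gt0 R); move: (pi : R) (nrm z)^-1 (k%:R) => p q K pn.
    by field.
  by rewrite ler_piMr// mulr_ge0 ?sqr_ge0// divr_ge0// mulr_ge0// pi_ge0.
have -> : k%:R / (2 * pi) * (nrm z)^-1 ^+ 2 =
   k%:R / (4 * pi) * (nrm z)^-1 ^+ 2 + k%:R / (4 * pi) * (nrm z)^-1 ^+ 2.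
  have := lt0r_neq0 (@pi_gt0 R); move: (pi : R) (nrm z)^-1 (k%:R) => p q K pn.
  by field.
move: (_ / _ * _) (cabs _) (cabs _) hd DD => a b c; lra.
Qed.

End far_point.

Lemma le_weak_type_norm k : (1 <= k)%N ->
  (((64 * pi)^-1 * k%:R)%:E <= weak_type_norm (@riesz_pow R k))%E.
Proof.
move=> k1; have kk : 1 <= k%:R :> R by rewrite ler1n.
apply/ereal_infP => _ [N bN <-].
pose f w : R[i] := (usquare w)%:C.
have fL : L1fun f.
  by split; [exact: integrable_usquare|exact: integrable0].
have nf : L1norm f = 1%E.
  rewrite -integral_usquare; apply: eq_integral => w _; congr EFin.
  by rewrite /cabs /f normc_def /= expr0n addr0 sqrtr_sqr ger0_norm// usquare_ge0.
pose r : R := 32 * k%:R.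
have r0 : 0 < r by rewrite mulr_gt0// (lt_le_trans _ kk).
have p0 := @pi_gt0 R.
(* Half of the bound [k / (4 * pi)] over the squared modulus when that square is [8 * r ^+ 2], its
   largest value on the test square; the half makes the inequality strict. *)
pose alpha : R := k%:R / (64 * pi * r ^+ 2).
have K0 : 0 < k%:R :> R by rewrite (lt_le_trans _ kk).
have alpha0 : 0 < alpha by rewrite divr_gt0// mulr_gt0 ?exprn_gt0// mulr_gt0.
have := bN f fL alpha alpha0; rewrite nf mule1 => h.
(* Centre of a square of side [r] on which both coordinates lie between [r] and [2 * r], so that its
   points are far enough from the origin; its area [r ^+ 2] times [alpha] is the claimed lower
   bound. *)
pose c : R * R := (3 * r / 2, 3 * r / 2).
have r20 : 0 <= r / 2 by rewrite divr_ge0// ltW.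
have sub : [set z | supn (z - c) <= r / 2] `<=` [set z | alpha < cabs (riesz_pow k f z)].
  move=> z /=; rewrite supn_le /= !ler_norml => /andP[/andP[z1 z2] /andP[z3 z4]].
  have z1r : r <= z.1 by lra.
  have z2r : r <= z.2 by lra.
  have z1R : z.1 <= 2 * r by lra.
  have z2R : z.2 <= 2 * r by lra.
  have nz : r <= nrm z.
    apply: le_trans z1r (le_trans _ (supn_le_nrm z)).
    by rewrite /supn le_max ler_norm.
  have nz0 : 0 < nrm z := lt_le_trans r0 nz.
  apply: lt_le_trans (riesz_pow_far_ge k1 nz).
  have n8 : nrm z ^+ 2 <= 8 * r ^+ 2.
    rewrite sqr_sqrtr ?nrm2_ge0// /nrm2; nra.
  have n0 : 0 < nrm z ^+ 2 by rewrite exprn_gt0.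
  rewrite /alpha exprVn -mulrA -[ltRHS]mulrA ltr_pM2l// -invfM ltf_pV2 ?posrE ?mulr_gt0 ?exprn_gt0//.
  move: (nrm z ^+ 2) n8 n0 (exprn_gt0 2 r0) => n n8 n0 R0.
  have : 4 * pi * n <= 4 * pi * (8 * r ^+ 2) by rewrite ler_wpM2l// mulr_ge0// ltW.
  have := mulr_gt0 p0 R0; rewrite !mulrA; lra.
have := le_trans (le_leb2 sub) h.
rewrite [X in (X <= _)%E -> _](leb2_supn_ball c r20) lee_fin => hN.
rewrite lee_fin.
have -> : (64 * pi)^-1 * k%:R = alpha * (2 * (r / 2)) ^+ 2.
  rewrite /alpha; have := lt0r_neq0 p0; have := lt0r_neq0 r0.
  by move: (pi : R) (r) (k%:R) => p q K qn pn; field; rewrite pn qn.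
have := ler_wpM2l (ltW alpha0) hN; rewrite (_ : alpha * (N / alpha) = N)//.
by field; rewrite gt_eqF.
Qed.

End lower_bound.

Theorem theorem1p2 (R : realType) :
  exists c C : R,
    [/\ 0 < c, c <= C
      & forall k : nat, (1 <= k)%N ->
          ((c * k%:R)%:E <= weak_type_norm (@riesz_pow R k))%E /\
          (weak_type_norm (@riesz_pow R k) <= (C * k%:R)%:E)%E].
Proof.
have p0 := @pi_gt0 R.
exists (64 * pi)^-1, (16 * @weak_const R); split.
- by rewrite invr_gt0 mulr_gt0.
- have p2 := @pi_ge2 R.
  have : (64 * pi)^-1 <= 1 :> R by rewrite invf_le1 ?mulr_gt0//; lra.
  rewrite /weak_const; lra.
- by move=> k k1; split; [exact: le_weak_type_norm|exact: weak_type_norm_le].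
Qed.
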